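(* Let $D$ be a non-cyclic simple dimension group with positive cone $D_+$, let $E\subseteq\mathbb{Q}$ be a subgroup strictly containing $\mathbb{Z}$, and let $\mathcal{B}_D$, $\mathcal{C}$, the recipe $(A,B,\rho)$, the homeomorphism $\varphi:AX_{\mathcal{C}}\to BX_{\mathcal{C}}$ and the étale equivalence relation $\mathcal{R}$ (generated by $\mathcal{R}_{\mathcal{C},\mathrm{tail}}$ and $\varphi$) be produced from $D$ and $E$ by the main construction described in the context. Let $\alpha:S(\mathcal{R})\to S(\mathcal{R}_{\mathcal{B}_D,\mathrm{tail}})\cong D_+$ be the homomorphism $\alpha([K])=[s_X(K)]$ ($K\subseteq X_{\mathcal{C}}$ clopen) induced by the shadow homeomorphism $s_X:X_{\mathcal{C}}\to X_{\mathcal{B}_D}$, and let $\beta:S(\mathcal{R})\to E/\mathbb{Z}$ be the homomorphism determined by $\beta([pX_{\mathcal{C}}])=0$ if the finite path $p$ ends at some $v_{i,a}^\ell$ or at $w_a^\ell$, and $\beta([pX_{\mathcal{C}}])=\frac{1}{r_\ell}+\mathbb{Z}$ if $p$ ends at $w_b^\ell$. (Both are well defined.) Then $\alpha$ and $\beta$ combine to give an isomorphism $$(\alpha,\beta):S(\mathcal{R})\to\{(0,0)\}\cup\big((D_+\setminus\{0\})\oplus(E/\mathbb{Z})\big).$$ Consequently, $H_0(\mathcal{R})\cong D\oplus(E/\mathbb{Z})$, with $H_0(\mathcal{R})_+$ identifying with $\{(0,0)\}\cup\big((D_+\setminus\{0\})\oplus(E/\mathbb{Z})\big)$.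
   Context: **Étale equivalence relations.** An étale groupoid is a locally compact Hausdorff groupoid $\mathcal{G}$ whose range map $r:\mathcal{G}\to\mathcal{G}^{(0)}$ is a local homeomorphism. A bisection is a subset on which the range map $r$ and source map $s$ are each injective. An étale equivalence relation is a principal étale groupoid; it is regarded as a set of pairs $(x,y)$ of points of its unit space $X$ (with its own topology, in general not the subspace topology of $X\times X$). **Type semigroup and homology.** For an étale groupoid $\mathcal{G}$ with Cantor unit space, the type semigroup $S(\mathcal{G})$ is the universal abelian semigroup with generators $[K]$, $K\subseteq\mathcal{G}^{(0)}$ compact open, and relations $[s(U)]=[r(U)]$ for each compact open bisection $U$ and $[K]+[L]=[K\cup L]$ whenever $K\cap L=\emptyset$. $H_0(\mathcal{G})$ is the quotient of $C_c(\mathcal{G}^{(0)},\mathbb{Z})$ by the functions $F(x)=\sum_{s(g)=x}k(g)-\sum_{r(g)=x}k(g)$, $k\in C_c(\mathcal{G},\mathbb{Z})$. The positive cone $H_0(\mathcal{G})_+$ is the image of $S(\mathcal{G})$ in $H_0(\mathcal{G})$ under $[K]\mapsto$ class of $1_K$. **Bratteli diagrams.** A Bratteli diagram $\mathcal{B}=(V,E)$ is a directed multigraph with $V=V_{\ell_0}\sqcup V_{\ell_0+1}\sqcup\cdots$, $E=E_{\ell_0}\sqcup E_{\ell_0+1}\sqcup\cdots$ ($\ell_0=0$ unless specified), all $V_\ell,E_\ell$ finite, edges in $E_\ell$ going from $V_\ell$ to $V_{\ell+1}$. Edges carry labels; $E(v,w)$ is the set of labels on edges from $v$ to $w$. $E_{k\dots\ell}$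 is the set of paths from a vertex of $V_k$ to a vertex of $V_\ell$; for $A\subseteq E_{k\dots\ell}$, $AE_{\dots m}$ is the set of paths in $E_{k\dots m}$ beginning with a path in $A$. $X_{\mathcal{B}}$ is the space of infinite paths starting in $V_{\ell_0}$, $AX_{\mathcal{B}}$ is the set of those beginning with a path in $A$, and $wX_{\mathcal{B}}=\{w\}X_{\mathcal{B}}$ (cylinder sets, a basis of the topology). $\mathrm{Trunc}_k(\mathcal{B})$ is the diagram consisting of levels $\ge k$ of $\mathcal{B}$; $\mathrm{Trunc}_k$ also denotes the map deleting the part before level $k$ from a path. $\mathcal{R}_{\mathcal{B},\mathrm{tail}}$ is the set of pairs $(x,y)$ in $X_{\mathcal{B}}$ with $\mathrm{Trunc}_\ell(x)=\mathrm{Trunc}_\ell(y)$ for some $\ell$; it is étale with basis the sets $U_{w,z}=\{(wx,zx):x$ an infinite path starting at $v\}$, where $w,z$ are finite paths starting in $V_{\ell_0}$ and ending at a common vertex $v$. The dimension group of $\mathcal{B}$ is the inductive limit (of ordered groups) of $(\mathbb{Z}^{V_\ell},\mathbb{Z}_+^{V_\ell})$ with connecting matrices with $(w,v)$ entry $|E(v,w)|$; a dimension group is an inductive limit of a sequence of groups $(\mathbb{Z}^n,\mathbb{Z}^n_+)$, and it is simple if it has no nontrivial order ideals. It is known that $S(\mathcal{R}_{\mathcal{B},\mathrm{tail}})$ is isomorphic to the positive cone of the dimension group of $\mathcal{B}$ via $[wX_{\mathcal{B}}]\mapsto$ the image of the basis vector $e_v$, $v$ the end vertex of $w$. **Recipes.**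 For a Bratteli diagram starting at level $\ell_0$, a recipe at level $\ell$ is $(A,B,\rho)$ with $A,B\subseteq E_{\ell_0\dots\ell}$ and $\rho=((w_1,z_1),\dots,(w_m,z_m),(A_1,B_1,\rho_1),\dots,(A_n,B_n,\rho_n))$ where $w_i,z_i\in E_{\ell_0\dots\ell+1}$ end at the same vertex, each $(A_i,B_i,\rho_i)$ is (recursively, without termination) a recipe at level $\ell+1$, $AE_{\dots\ell+1}=\{w_1\}\sqcup\dots\sqcup\{w_m\}\sqcup A_1\sqcup\dots\sqcup A_n$ and $BE_{\dots\ell+1}=\{z_1\}\sqcup\dots\sqcup\{z_m\}\sqcup B_1\sqcup\dots\sqcup B_n$. Its descendants are itself and all descendants of the $(A_i,B_i,\rho_i)$. A function $\varphi:AX\to BX$ fits $(A,B,\rho)$ if for each descendant $(A',B',\rho')$, with $\rho'=((w_i,z_i)_i,(A_i,B_i,\rho_i)_i)$, one has $\varphi(w_ix)=z_ix$ for all $i$ and all $w_ix\in w_iX$, and $\varphi(A_iX)=B_iX$ for all $i$. Reversing a recipe means interchanging all $w$'s with $z$'s and all $A$'s with $B$'s, at all descendants. **Main construction.** Pick natural numbers $(r_\ell)_{\ell\ge1}$ with $r_1>1$, $r_\ell\mid r_{\ell+1}$, $E=\{p/r_\ell:\ell\in\mathbb{N},p\in\mathbb{Z}\}$; put $r_0=1$, $d_\ell=r_\ell/r_{\ell-1}$. Take a Bratteli diagram $\mathcal{B}_D=(V_D,E_D)$ starting at level $0$ with dimension group $D$ (so $S(\mathcal{R}_{\mathcal{B}_D,\mathrm{tail}})\cong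 D_+$ and $H_0(\mathcal{R}_{\mathcal{B}_D,\mathrm{tail}})\cong D$) and $|E_D(v,w)|\ge r_\ell+d_\ell$ for all $v\in(V_D)_{\ell-1}$, $w\in(V_D)_\ell$, $\ell\ge1$. For each $\ell\ge0$ pick $w_a^\ell\in(V_D)_\ell$ and write $v_{1,a}^\ell,\dots,v_{k_\ell,a}^\ell$ for the other vertices of $(V_D)_\ell$. Choose $F(v_{i,a}^\ell)=\emptyset$ and $F(w_a^\ell)\subseteq E_D(w_a^\ell,w_a^{\ell+1})$ with $|F(w_a^\ell)|=r_{\ell+1}$ ($\ell\ge0$), and $F(w_b^\ell)\subseteq E_D(w_a^\ell,w_a^{\ell+1})$ with $|F(w_b^\ell)|=d_{\ell+1}$ ($\ell\ge1$). The diagram $\mathcal{C}$ has level $0$ vertex set $(V_D)_0$ and level $\ell$ vertex set $(V_D)_\ell\sqcup\{w_b^\ell\}$ for $\ell\ge1$, and edges: for $v\in(V_D)_\ell$, $u\in(V_D)_{\ell+1}\setminus\{w_a^{\ell+1}\}$, edges $v\to u$ with label set $E_D(v,u)$; for $v\in(V_D)_\ell$, edges $v\to w_b^{\ell+1}$ with label set $F(v)$ and $v\to w_a^{\ell+1}$ with label set $E_D(v,w_a^{\ell+1})\setminus F(v)$; for $\ell\ge1$, edges $w_b^\ell\to u$ with label set $E_D(w_a^\ell,u)$ for $u\in(V_D)_{\ell+1}\setminus\{w_a^{\ell+1}\}$, $w_b^\ell\to w_b^{\ell+1}$ with label set $F(w_b^\ell)$, and $w_b^\ell\to w_a^{\ell+1}$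 with label set $E_D(w_a^\ell,w_a^{\ell+1})\setminus F(w_b^\ell)$. The graph homomorphism $T:\mathcal{C}\to\mathcal{B}_D$ fixes vertices of $V_D$, sends $w_b^\ell$ to $w_a^\ell$ and preserves edge labels; $s_X:X_{\mathcal{C}}\to X_{\mathcal{B}_D}$ is the homeomorphism applying $T$ to each edge of an infinite path. Recursive construction of recipes: let $0\le k<\ell$, and in $\mathrm{Trunc}_k(\mathcal{C})$ let $A=\{z_{A,1},\dots,z_{A,r_\ell}\}\subseteq E_{k\dots\ell}$ consist of $r_\ell$ paths ending at $w_a^\ell$ and $B=\{z_{B,1},\dots,z_{B,r_\ell}\}\subseteq E_{k\dots\ell}$ of $r_\ell$ paths ending at $w_b^\ell$, such that all paths in $A$ coincide up to level $\ell-1$ and likewise for $B$ (for $\ell-1=k$: they start at the same vertex). Let $M_A$ be the set of all $r_{\ell+1}$ edges from $w_a^\ell$ to $w_b^{\ell+1}$, and $M_B$ a chosen set of $r_{\ell+1}$ edges from $w_b^\ell$ to $w_a^{\ell+1}$. Put $A_i=z_{A,i}M_A$, $B_i=z_{B,i}M_B$ for $i=1,\dots,r_\ell-1$. Apply this same construction in $\mathrm{Trunc}_\ell(\mathcal{C})$ at level $\ell+1$ to $(M_B,M_A)$ to get a recipe, reverse it to get a recipe $(M_A,M_B,\rho_{\mathrm{mod}})$, and for each $i$ let $(A_i,B_i,\rho_i)$ be its pull-back under $\mathrm{Trunc}_\ell$ (i.e. prefix all paths on the $A$-side by $z_{A,i}$ and on the $B$-side by $z_{B,i}$). The remaining paths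 in $AE_{\dots\ell+1}$ and $BE_{\dots\ell+1}$ are matched into pairs $(w_1,z_1),\dots,(w_m,z_m)$ with the two members of each pair ending at the same vertex (the counts agree). Put $\rho=((w_1,z_1),\dots,(w_m,z_m),(A_1,B_1,\rho_1),\dots,(A_{r_\ell-1},B_{r_\ell-1},\rho_{r_\ell-1}))$. The initial recipe $(A,B,\rho)$ is obtained with $k=0$, $\ell=1$. There is a unique function $\varphi:AX_{\mathcal{C}}\to BX_{\mathcal{C}}$ fitting it, and it is a homeomorphism. $\mathcal{R}$ is the equivalence relation on $X_{\mathcal{C}}$ generated by $\mathcal{R}_{\mathcal{C},\mathrm{tail}}$ and $x\sim\varphi(x)$; it is étale in the topology whose basis consists of all finite products $\gamma_1\cdots\gamma_n=\{(x_0,x_n):(x_{i-1},x_i)\in\gamma_i\}$, each $\gamma_i$ being a compact open bisection of $\mathcal{R}_{\mathcal{C},\mathrm{tail}}$ or a set of the form $\mathrm{id}_U$, $\{(x,\varphi(x)):x\in Z\}$ or $\{(\varphi(x),x):x\in Z\}$ with $U\subseteq X_{\mathcal{C}}$ and $Z\subseteq AX_{\mathcal{C}}$ clopen. *)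

(* Defs.v *)
From HB Require Import structures.
From Stdlib Require Import Relations.Relation_Operators.
From mathcomp Require Import all_boot all_order all_algebra finmap.
From mathcomp Require Import all_classical topology.

Set Implicit Arguments.
Unset Strict Implicit.
Unset Printing Implicit Defensive.

Import Order.TTheory GRing.Theory Num.Theory.

Local Open Scope classical_set_scope.
Local Open Scope ring_scope.
Local Open Scope quotient_scope.

(* An equivalence relation [er] on [X] with a basis [er_base] of its own
   topology.  It is viewed as a groupoid with unit space [X] (identified with
   the diagonal), where (x, y) has range x and source y. *)
Record toprel (X : Type) := TopRel {
  er : set (X * X);
  er_base : set (set (X * X)) }.

Record gpd (X : Type) (G : toprel X) := Gpd {
  gpair : X * X;
  gpairP : er G gpair }.

HB.instance Definition _ X (G : toprel X) := gen_eqMixin (gpd G).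
HB.instance Definition _ X (G : toprel X) := gen_choiceMixin (gpd G).
HB.instance Definition _ X (G : toprel X) :=
  @isSubBaseTopological.Build (gpd G) (set (X * X)) (er_base G)
    (fun U => [set g | U (gpair g)]).

Section Groupoid.
Context {X : topologicalType} (G : toprel X).

Definition rg (g : gpd G) : X := (gpair g).1.
Definition sc (g : gpd G) : X := (gpair g).2.

Definition co_bisection (U : set (gpd G)) : Prop :=
  [/\ compact U, open U, set_inj U rg & set_inj U sc].

End Groupoid.
Arguments rg {X G}.
Arguments sc {X G}.

Record copen (X : topologicalType) := COpen {
  cset :> set X;
  copenP : compact cset /\ open cset }.

Lemma copen0P (X : topologicalType) : compact (@set0 X) /\ open (@set0 X).
Proof. by split; [exact: compact0 | exact: open0]. Qed.
Definition copen0 (X : topologicalType) : copen X := COpen (copen0P X).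

HB.instance Definition _ X := gen_eqMixin (copen X).
HB.instance Definition _ X := gen_choiceMixin (copen X).

(* Formal sums of compact open sets. *)
Definition word (X : topologicalType) : choiceType := seq (copen X).

(* In the universal abelian semigroup the generator [set0] is neutral, by the
   relation [K] + [set0] = [K]; hence it is the abelian monoid with the same
   presentation in which moreover the empty sum is [set0]. *)
Inductive ts_eq (X : topologicalType) (G : toprel X) :
    word X -> word X -> Prop :=
| ts_refl a : ts_eq G a a
| ts_sym a b : ts_eq G a b -> ts_eq G b a
| ts_trans a b c : ts_eq G a b -> ts_eq G b c -> ts_eq G a c
| ts_cat a b c d : ts_eq G a b -> ts_eq G c d -> ts_eq G (a ++ c) (b ++ d)
| ts_comm a b : ts_eq G (a ++ b) (b ++ a)
| ts_zero : ts_eq G [:: copen0 X] [::]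
| ts_bisection (U : set (gpd G)) (K L : copen X) :
    co_bisection U -> cset K = sc @` U -> cset L = rg @` U ->
    ts_eq G [:: K] [:: L]
| ts_disjoint (K L M : copen X) :
    K `&` L = set0 -> cset M = K `|` L -> ts_eq G [:: K; L] [:: M].

Section TypeSemigroup.
Context {X : topologicalType} (G : toprel X).

Definition ts_eqb (a b : word X) : bool := `[< ts_eq G a b >].

Lemma ts_eqb_equiv : equiv_class_of ts_eqb.
Proof.
split=> [a|a b|b a c].
- exact/asboolP/ts_refl.
- by apply/idP/idP => /asboolP h; exact/asboolP/ts_sym.
- by move=> /asboolP h /asboolP h'; apply/asboolP; exact: ts_trans h h'.
Qed.
Canonical ts_eqb_rel := EquivRelPack ts_eqb_equiv.
Canonical ts_eqb_encModRel := defaultEncModRel ts_eqb.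

Definition tsemi := {eq_quot ts_eqb}.
HB.instance Definition _ : EqQuotient (word X) ts_eqb tsemi :=
  EqQuotient.on tsemi.
HB.instance Definition _ := Choice.on tsemi.

Definition ts_zeroq : tsemi := \pi_tsemi [::].
Definition ts_addq (s t : tsemi) : tsemi := \pi_tsemi (repr s ++ repr t).

Lemma ts_piP (a b : word X) : ts_eq G a b -> \pi_tsemi a = \pi_tsemi b.
Proof. by move=> h; apply/eqmodP/asboolP. Qed.

Lemma ts_reprP (a : word X) : ts_eq G (repr (\pi_tsemi a)) a.
Proof. by apply/asboolP; rewrite -/(ts_eqb _ _) -(eqquotE tsemi) reprK. Qed.

Lemma ts_addqE a b : ts_addq (\pi a) (\pi b) = \pi_tsemi (a ++ b).
Proof. by apply: ts_piP; apply: ts_cat; exact: ts_reprP. Qed.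

Lemma ts_addqA : associative ts_addq.
Proof.
by move=> s t u; rewrite -[s]reprK -[t]reprK -[u]reprK !ts_addqE catA.
Qed.

Lemma ts_addqC : commutative ts_addq.
Proof.
move=> s t; rewrite -[s]reprK -[t]reprK !ts_addqE.
by apply: ts_piP; exact: ts_comm.
Qed.

Lemma ts_add0q : left_id ts_zeroq ts_addq.
Proof. by move=> s; rewrite -[s]reprK ts_addqE. Qed.

HB.instance Definition _ :=
  GRing.isNmodule.Build tsemi ts_addqA ts_addqC ts_add0q.

(* [K] for K compact open; 0 is a junk value for the other subsets. *)
Definition cls (K : set X) : tsemi :=
  if pselect (compact K /\ open K) is left h then \pi_tsemi [:: COpen h] else 0.

End TypeSemigroup.

(* C_c(X, Z), where Z is discrete. *)
Definition Cc (X : topologicalType) : {pred (X -> int)} :=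
  [pred f : X -> int | `[< (forall n, open (f @^-1` [set n])) /\
                           compact (closure [set x | f x != 0]) >]].
Arguments Cc : clear implicits.

Lemma Cc_zmod_closed (X : topologicalType) : zmod_closed (Cc X).
Proof.
split=> [|f g /asboolP[fo fc] /asboolP[go gc]]; apply/asboolP; split.
- move=> n; have [->|n0] := eqVneq n 0.
    rewrite (_ : _ @^-1` _ = setT); first exact: openT.
    by apply/seteqP; split.
  rewrite (_ : _ @^-1` _ = set0); first exact: open0.
  by apply/seteqP; split => x //= /esym/eqP; rewrite (negPf n0).
- rewrite (_ : [set _ | _] = set0) ?closure0; first exact: compact0.
  by apply/seteqP; split => x //=; rewrite eqxx.
- move=> n.
  rewrite (_ : _ @^-1` _ =
    \bigcup_(m in [set: int]) (f @^-1` [set m] `&` g @^-1` [set m - n])).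
    by apply: bigcup_open => m _; apply: openI.
  apply/seteqP; split=> [x /= <-|x [m _ [/= <- e]]].
    by exists (f x) => //; split => //=; rewrite opprB addrC subrK.
  rewrite /GRing.add /GRing.opp /= in e *; rewrite e.
  by rewrite opprB addrC subrK.
- apply: (@subclosed_compact _ _
    (closure [set x | f x != 0] `|` closure [set x | g x != 0])).
  + exact: closed_closure.
  + exact: compactU.
  + rewrite -closureU; apply: closure_subset => x /= h.
    have [fx0|] := eqVneq (f x) 0; last by left.
    right; apply: contraNneq h => gx0.
    by apply/eqP; rewrite -[LHS]/(f x - g x) fx0 gx0 subrr.
Qed.
HB.instance Definition _ (X : topologicalType) :=
  GRing.isZmodClosed.Build (X -> int) (Cc X) (Cc_zmod_closed X).

Definition CcT (X : topologicalType) := {f : X -> int | f \in Cc X}.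
HB.instance Definition _ (X : topologicalType) := SubChoice.on (CcT X).
HB.instance Definition _ (X : topologicalType) :=
  [SubChoice_isSubZmodule of CcT X by <:].

Section Homology.
Context {X : topologicalType} (G : toprel X).

Definition coboundary (k : gpd G -> int) (x : X) : int :=
  \sum_(g \in [set g : gpd G | sc g = x]) k g
  - \sum_(g \in [set g : gpd G | rg g = x]) k g.

(* The subgroup generated by the functions [coboundary k]; these form a
   subgroup themselves when [G] is etale. *)
Definition coboundaries : {pred CcT X} :=
  [pred f | `[< forall H : set (CcT X),
     H 0 -> (forall a b, H a -> H b -> H (a - b)) ->
     (forall (k : CcT (gpd G)) (a : CcT X),
        \val a = coboundary (\val k) -> H a) ->
     H f >]].

Lemma coboundaries_zmod_closed : zmod_closed coboundaries.
Proof.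
split=> [|f g /asboolP hf /asboolP hg]; apply/asboolP => H H0 HB Hk //.
exact: (HB _ _ (hf H H0 HB Hk) (hg H H0 HB Hk)).
Qed.
HB.instance Definition _ :=
  GRing.isZmodClosed.Build (CcT X) coboundaries coboundaries_zmod_closed.

Definition H0 : zmodType := Quotient.quot coboundaries.

(* The image of the type semigroup under [K] |-> class of 1_K. *)
Definition H0pos : set H0 :=
  [set \pi_H0 f | f in [set f : CcT X | exists s : word X,
     forall x, (\val f) x = \sum_(K <- s) (`[< cset K x >])%:Z]].

End Homology.
Arguments H0pos {X} G.

Section QuotientByZ.
Variable E : zmodClosed rat.

Definition subrat := {q : rat | q \in E}.
HB.instance Definition _ := SubChoice.on subrat.
HB.instance Definition _ := [SubChoice_isSubZmodule of subrat by <:].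

Definition intsub : {pred subrat} := [pred q | \val q \is a Num.int].

Lemma intsub_zmod_closed : zmod_closed intsub.
Proof.
split=> [|p q]; rewrite !inE ?raddf0 ?rpred0 // raddfB => hp hq.
exact: rpredB.
Qed.
HB.instance Definition _ :=
  GRing.isZmodClosed.Build subrat intsub intsub_zmod_closed.

Definition modZ : zmodType := Quotient.quot intsub.

(* The class q + Z; 0 is a junk value for q outside E. *)
Definition modZ_class (q : rat) : modZ := \pi_modZ (insubd (0 : subrat) q).

End QuotientByZ.

Section OrderedLimit.
Variables (I : nat -> finType) (m : forall l, I l.+1 -> I l -> nat).

Definition connecting l (x : {ffun I l -> int}) : {ffun I l.+1 -> int} :=
  [ffun w => \sum_v (m w v)%:Z * x v].

Fixpoint connecting_iter l n (x : {ffun I l -> int}) : {ffun I (n + l) -> int} :=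
  if n is n'.+1 then connecting (connecting_iter n' x) else x.

(* [D], with positive cone [Dp] and canonical maps [iota], is the inductive
   limit of the ordered groups Z^(I l) along the matrices [m]: the union of the
   images of the [iota l], where an element vanishes iff it does at some later
   stage and is positive iff it is the image of a positive vector. *)
Record is_ordered_limit (D : zmodType) (Dp : set D)
    (iota : forall l, {additive {ffun I l -> int} -> D}) : Prop := OrderedLimit {
  limit_compat : forall l x, iota l.+1 (connecting x) = iota l x;
  limit_surj : forall d, exists l x, iota l x = d;
  limit_ker : forall l x, iota l x = 0 -> exists n, connecting_iter n x = 0;
  limit_pos : forall d, Dp d <->
    exists l (x : {ffun I l -> int}), (forall i, 0 <= x i) /\ iota l x = d }.

End OrderedLimit.

Definition dimension_group (D : zmodType) (Dp : set D) : Prop :=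
  exists (n : nat -> nat) (m : forall l, 'I_(n l.+1) -> 'I_(n l) -> nat)
    (iota : forall l, {additive {ffun 'I_(n l) -> int} -> D}),
    is_ordered_limit m Dp iota.

Record order_ideal (D : zmodType) (Dp J : set D) : Prop := OrderIdeal {
  ideal0 : J 0;
  idealB : forall x y, J x -> J y -> J (x - y);
  ideal_hereditary : forall x y, Dp x -> Dp (y - x) -> J y -> J x;
  ideal_directed : forall x, J x ->
    exists a b, [/\ J a, Dp a, J b, Dp b & x = a - b] }.

Definition simple_ordered (D : zmodType) (Dp : set D) : Prop :=
  forall J : set D, order_ideal Dp J -> J = [set 0] \/ J = setT.

Definition cyclic_zmod (D : zmodType) : Prop :=
  exists g : D, forall x, exists n : int, x = g *~ n.

(* [vlev l] is the set of vertices at level l and [elab l v w] the set E(v, w)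
   of labels, for v at level l and w at level l.+1.  A vertex of the diagram is
   a pair of a level and an element of [vlev] at that level, so that the
   [vlev l] need not be disjoint. *)
Record bratteli := Bratteli {
  bvert : choiceType;
  blabel : choiceType;
  vlev : nat -> {fset bvert};
  elab : nat -> bvert -> bvert -> {fset blabel} }.

Section BratteliTheory.
Variable B : bratteli.

Definition is_dimension_group_of (D : zmodType) (Dp : set D)
    (iota : forall l, {additive {ffun vlev B l -> int} -> D}) : Prop :=
  is_ordered_limit (fun l (w : vlev B l.+1) (v : vlev B l) =>
    #|` elab l (\val v) (\val w)|) Dp iota.

Definition basis_vec l (v : bvert B) : {ffun vlev B l -> int} :=
  [ffun u => (\val u == v)%:Z].

(* A finite path: its initial vertex, followed by the labels and end vertices
   of its successive edges. *)
Definition bpath : choiceType := (bvert B * seq (blabel B * bvert B))%type.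

Implicit Types (p q w z : bpath).

Fixpoint edges_from l (v : bvert B) (s : seq (blabel B * bvert B)) : bool :=
  if s is (e, u) :: s' then
    [&& u \in vlev B l.+1, e \in elab l v u & edges_from l.+1 u s']
  else true.

(* p is in E_{k...l} *)
Definition in_E k l p : bool :=
  [&& p.1 \in vlev B k, edges_from k p.1 p.2 & (k + size p.2 == l)%N].

Definition pend p : bvert B := last p.1 [seq e.2 | e <- p.2].

Definition pstarts p q : bool := (p.1 == q.1) && prefix p.2 q.2.

Definition pcut n p : bpath := (p.1, take n p.2).

Definition pcat p q : bpath := (p.1, p.2 ++ q.2).

Record ipath := IPath {
  ivtx : nat -> bvert B;
  ilab : nat -> blabel B;
  ipathP : forall l, ivtx l \in vlev B l /\
                     ilab l \in elab l (ivtx l) (ivtx l.+1) }.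

Definition initial (x : ipath) n : bpath :=
  (ivtx x 0, [seq (ilab x i, ivtx x i.+1) | i <- iota 0 n]).

Definition starts w (x : ipath) : Prop := initial x (size w.2) = w.

(* wX and AX *)
Definition cyl w : set ipath := [set x | starts w x].
Definition cyls (A : {fset bpath}) : set ipath :=
  [set x | exists2 w, w \in A & starts w x].

HB.instance Definition _ := gen_eqMixin ipath.
HB.instance Definition _ := gen_choiceMixin ipath.
HB.instance Definition _ := @isSubBaseTopological.Build ipath
  (set ipath) [set cyl w | w in [set w | exists l, in_E 0 l w]] id.

(* Trunc_l(x) = Trunc_l(y) *)
Definition same_trunc l (x y : ipath) : Prop :=
  forall n, (l <= n)%N -> ivtx x n = ivtx y n /\ ilab x n = ilab y n.

(* The set U_{w,z} of the pairs (wx, zx), for w, z in E_{0...l}. *)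
Definition Ubasic l w z : set (ipath * ipath) :=
  [set xy | [/\ starts w xy.1, starts z xy.2 & same_trunc l xy.1 xy.2]].

Definition tail_rel : toprel ipath := TopRel
  [set xy | exists l, same_trunc l xy.1 xy.2]
  [set U | exists l w z,
     [/\ in_E 0 l w, in_E 0 l z, pend w = pend z & U = Ubasic l w z]].

(* The constituents A, B, (w_i, z_i)_i of a recipe and the number n of its
   subrecipes (A_i, B_i, rho_i). *)
Record rnode := RNode {
  nodeA : {fset bpath};
  nodeB : {fset bpath};
  nodepairs : seq (bpath * bpath);
  nodesub : nat }.

(* A recipe is an infinite tree of nodes: a node is reached by the list of the
   indices (counted from 0) of the subrecipes chosen successively.  The values
   at addresses using an index not below [nodesub] are irrelevant. *)
Definition recipe : Type := seq nat -> rnode.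

Definition rA (rho : recipe) := nodeA (rho [::]).
Definition rB (rho : recipe) := nodeB (rho [::]).
Definition rpairs (rho : recipe) := nodepairs (rho [::]).
Definition rsub (rho : recipe) := nodesub (rho [::]).
Definition subrecipe (rho : recipe) (i : nat) : recipe := fun s => rho (i :: s).

Inductive descendant (rho : recipe) : recipe -> Prop :=
| desc_self : descendant rho rho
| desc_sub i rho' : (i < rsub rho)%N ->
    descendant (subrecipe rho i) rho' -> descendant rho rho'.

Definition rev_recipe (rho : recipe) : recipe := fun s =>
  let n := rho s in
  RNode (nodeB n) (nodeA n) [seq (wz.2, wz.1) | wz <- nodepairs n] (nodesub n).

Definition pullback (a b : bpath) (rho : recipe) : recipe := fun s =>
  let n := rho s in
  RNode [fset pcat a p | p in nodeA n]%fset [fset pcat b p | p in nodeB n]%fset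
    [seq (pcat a wz.1, pcat b wz.2) | wz <- nodepairs n] (nodesub n).

(* [phi] only matters on AX. *)
Definition fits (phi : ipath -> ipath) (rho : recipe) : Prop :=
  set_fun (cyls (rA rho)) (cyls (rB rho)) phi /\
  forall rho', descendant rho rho' ->
    (forall w z x, (w, z) \in rpairs rho' -> starts w x ->
       starts z (phi x) /\ same_trunc (size w.2) x (phi x)) /\
    (forall i, (i < rsub rho')%N ->
       phi @` cyls (rA (subrecipe rho' i)) = cyls (rB (subrecipe rho' i))).

Definition comp_rel (U W : set (ipath * ipath)) : set (ipath * ipath) :=
  [set xz | exists y, U (xz.1, y) /\ W (y, xz.2)].

Inductive finite_product (S : set (set (ipath * ipath))) :
    set (ipath * ipath) -> Prop :=
| prod_one U : S U -> finite_product S U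
| prod_cons U W : S U -> finite_product S W -> finite_product S (comp_rel U W).

Definition factors (A : set ipath) (phi : ipath -> ipath) :
    set (set (ipath * ipath)) :=
  [set U | [\/ exists2 W : set (gpd tail_rel),
                 co_bisection W & U = @gpair _ tail_rel @` W,
               exists2 K, clopen K & U = [set (x, x) | x in K],
               exists Z, [/\ clopen Z, Z `<=` A & U = [set (x, phi x) | x in Z]]
             | exists Z, [/\ clopen Z, Z `<=` A &
                             U = [set (phi x, x) | x in Z]]]].

Definition generated_rel (A : set ipath) (phi : ipath -> ipath) :
    toprel ipath := TopRel
  [set xy | clos_refl_sym_trans ipath
     (fun x y => er tail_rel (x, y) \/ (A x /\ y = phi x)) xy.1 xy.2]
  (finite_product (factors A phi)).

End BratteliTheory.

(* The vertices of the diagram C at level l are represented in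
   [option (bvert BD)]: [Some v] is the vertex v of B_D and [None] is w_b^l.
   [wa l] is w_a^l, [F_ l x] is F(x) for x at level l of C, and d_{l+1} is
   r_{l+1} %/ r_l. *)
Record main_data (D : zmodType) (Dp : set D) (E : zmodClosed rat) := MainData {
  r_ : nat -> nat;
  r_0 : r_ 0 = 1%N;
  r_1 : (1 < r_ 1)%N;
  r_gt0 : forall l, (0 < r_ l)%N;
  r_dvd : forall l, (r_ l %| r_ l.+1)%N;
  r_E : forall q, q \in E <-> exists l (p : int), q = p%:~R / (r_ l)%:R;
  BD : bratteli;
  BD_iota : forall l, {additive {ffun vlev BD l -> int} -> D};
  BD_dim : is_dimension_group_of Dp BD_iota;
  BD_edges : forall l v w, v \in vlev BD l -> w \in vlev BD l.+1 ->
    (r_ l.+1 + r_ l.+1 %/ r_ l <= #|` elab l v w|)%N;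
  wa : nat -> bvert BD;
  wa_lev : forall l, wa l \in vlev BD l;
  F_ : nat -> option (bvert BD) -> {fset blabel BD};
  F_other : forall l v, v \in vlev BD l -> v != wa l -> F_ l (Some v) = fset0;
  F_wa_sub : forall l, (F_ l (Some (wa l)) `<=` elab l (wa l) (wa l.+1))%fset;
  F_wa_card : forall l, #|` F_ l (Some (wa l))| = r_ l.+1;
  F_wb_sub : forall l, (0 < l)%N ->
    (F_ l None `<=` elab l (wa l) (wa l.+1))%fset;
  F_wb_card : forall l, (0 < l)%N -> #|` F_ l None| = (r_ l.+1 %/ r_ l)%N }.

Arguments BD {D Dp E}.
Arguments wa {D Dp E}.
Arguments r_ {D Dp E}.
Arguments F_ {D Dp E}.
Arguments BD_iota {D Dp E}.

Section MainConstruction.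
Variables (D : zmodType) (Dp : set D) (E : zmodClosed rat).
Variable M : main_data Dp E.

Definition Tvert l (v : option (bvert (BD M))) : bvert (BD M) := odflt (wa M l) v.

Definition C_lev l : {fset option (bvert (BD M))} :=
  let old := [fset Some v | v in vlev (BD M) l]%fset in
  if l is 0 then old else (None |` old)%fset.

Definition C_lab l (v u : option (bvert (BD M))) : {fset blabel (BD M)} :=
  match u with
  | None => F_ M l v
  | Some u' =>
      if u' == wa M l.+1 then (elab l (Tvert l v) u' `\` F_ M l v)%fset
      else elab l (Tvert l v) u'
  end.

Definition Cdiag : bratteli := Bratteli C_lev C_lab.

Lemma C_lev_Some l v : (Some v \in C_lev l) = (v \in vlev (BD M) l).
Proof.
have h : (Some v \in [fset Some v | v in vlev (BD M) l]%fset) =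
         (v \in vlev (BD M) l).
  by apply/imfsetP/idP => [[u hu [->]]|hv] //; exists v.
by case: l h => [|l] h //; rewrite /C_lev in_fset1U.
Qed.

Lemma C_lev_None l : (None \in C_lev l) = (0 < l)%N.
Proof.
case: l => [|l] /=; last by rewrite in_fset1U eqxx.
by apply/negP => /imfsetP[].
Qed.

Lemma sX_subproof (x : ipath Cdiag) l :
  Tvert l (ivtx x l) \in vlev (BD M) l /\
  ilab x l \in elab l (Tvert l (ivtx x l)) (Tvert l.+1 (ivtx x l.+1)).
Proof.
have [] := ipathP x l; have [] := ipathP x l.+1; rewrite /=.
case: (ivtx x l) => [v|]; case: (ivtx x l.+1) => [u|];
  rewrite /= ?C_lev_Some ?C_lev_None => hu _ hv.
- by case: ifP => _; rewrite ?in_fsetD => h; split=> //; case/andP: h.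
- have [->|nv] := eqVneq v (wa M l); last by rewrite F_other.
  by move=> h; split; [exact: wa_lev | exact: (fsubsetP (F_wa_sub M l))].
- by case: ifP => _; rewrite ?in_fsetD => h; split; rewrite ?wa_lev //;
    case/andP: h.
- move=> h; split; first exact: wa_lev.
  exact: (fsubsetP (F_wb_sub M hv)).
Qed.

Definition sX (x : ipath Cdiag) : ipath (BD M) := IPath (sX_subproof x).

(* [z] enumerates r_l distinct paths in E_{k...l} which end at [e] and coincide
   up to level l - 1. *)
Definition admissible k l (e : bvert Cdiag) (z : 'I_(r_ M l) -> bpath Cdiag) :
    Prop :=
  [/\ injective z,
      forall i, in_E k l (z i) /\ pend (z i) = e
    & forall i j, pcut (l.-1 - k) (z i) = pcut (l.-1 - k) (z j)].

(* [ws] lists the paths in AE_{...l.+1} that lie in none of the sets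
   A_i = z_i M, i = 1, ..., r_l - 1. *)
Definition lists_remaining k l (z : 'I_(r_ M l) -> bpath Cdiag)
    (N : 'I_(r_ M l.+1) -> bpath Cdiag) (ws : seq (bpath Cdiag)) : Prop :=
  uniq ws /\
  forall p, p \in ws <->
    [/\ in_E k l.+1 p, exists i, pstarts (z i) p
      & ~ exists (i : 'I_(r_ M l)) j, (i.+1 < r_ M l)%N /\ p = pcat (z i) (N j)].

(* [rho] results from the recursive construction applied in Trunc_k(C) at level
   l to A = {zA 0, ..., zA (r_l - 1)} and B = {zB 0, ..., zB (r_l - 1)}; the
   paths of E_{k...l} are those of Trunc_k(C). *)
CoInductive main_recipe (k l : nat) (zA zB : 'I_(r_ M l) -> bpath Cdiag)
    (rho : recipe Cdiag) : Prop :=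
| MainRecipe (MA MB : 'I_(r_ M l.+1) -> bpath Cdiag) (rho' : recipe Cdiag) :
    (k < l)%N ->
    admissible k (Some (wa M l)) zA ->
    admissible k None zB ->
    injective MA ->
    (forall p, (exists j, MA j = p) <->
       [/\ in_E l l.+1 p, p.1 = Some (wa M l) & pend p = None]) ->
    injective MB ->
    (forall j, [/\ in_E l l.+1 (MB j), (MB j).1 = None
                 & pend (MB j) = Some (wa M l.+1)]) ->
    main_recipe l MB MA rho' ->
    rA rho = [fset zA i | i in 'I_(r_ M l)]%fset ->
    rB rho = [fset zB i | i in 'I_(r_ M l)]%fset ->
    rsub rho = (r_ M l).-1 ->
    (forall i : 'I_(r_ M l), (i.+1 < r_ M l)%N ->
       subrecipe rho i = pullback (zA i) (zB i) (rev_recipe rho')) ->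
    lists_remaining k zA MA (unzip1 (rpairs rho)) ->
    lists_remaining k zB MB (unzip2 (rpairs rho)) ->
    (forall w z, (w, z) \in rpairs rho -> pend w = pend z) ->
    main_recipe k zA zB rho.

Definition Rmain (rho : recipe Cdiag) (phi : ipath Cdiag -> ipath Cdiag) :
    toprel (ipath Cdiag) :=
  generated_rel (cyls (rA rho)) phi.

(* The isomorphism of S(R_{B_D,tail}) with D_+ through which alpha takes its
   values in D_+. *)
Definition is_dim_iso (kappa : {additive tsemi (tail_rel (BD M)) -> D}) : Prop :=
  [/\ forall l w, in_E 0 l w ->
        kappa (cls _ (cyl w)) = BD_iota M l (basis_vec l (pend w)),
      injective kappa
    & range kappa = Dp].

Definition is_alpha rho phi
    (alpha : {additive tsemi (Rmain rho phi) -> tsemi (tail_rel (BD M))}) : Prop :=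
  forall K, clopen K -> alpha (cls _ K) = cls _ (sX @` K).

Definition is_beta rho phi
    (beta : {additive tsemi (Rmain rho phi) -> modZ E}) : Prop :=
  forall l p, in_E 0 l p ->
    beta (cls _ (cyl p)) =
      if pend p is Some _ then 0 else modZ_class E (r_ M l)%:R^-1.

End MainConstruction.

(* {(0, 0)} together with (D_+ \ {0}) + E/Z *)
Definition target_cone (D : zmodType) (Dp : set D) (E : zmodClosed rat) :
    set (D * modZ E) :=
  [set (0, 0)] `|` [set dt | Dp dt.1 /\ dt.1 <> 0].
Arguments target_cone {D} Dp E.

(* Main.v *)
(* Harmonic weights on the vertices of a Bratteli diagram integrate locally
   constant functions on its path space, with values in any abelian group.
   Every basic set of the relation [R] is, near each of its points, either a
   tail move or a "zigzag": the partial map that follows the left and the right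
   edges of the recipe in parallel, until a matched pair is met and both tails
   coincide.  Germs of this kind are closed under composition, whence [R] is
   etale, and they preserve the integral of a weight as soon as r_l times its
   value at w_a^l equals r_l times its value at w_b^l.  Two weights of this kind,
   with values in D and in E/Z, induce alpha and beta on S(R), and D + E/Z-valued
   invariants on H_0(R).

   Conversely S(R) is generated by the classes [v]_l of the vertices v of level l,
   and the zigzag sets at level l give r_l [w_a^l] = r_l [w_b^l].  Two words with the
   same alpha have, at a late level, the same multiplicities up to the splitting
   between w_a and w_b; with the same beta, these splittings differ by a multiple
   of r_l, and the relation above identifies the words.  For the range, a nonzero
   positive vector becomes, at a late level, at least r_l at w_a^l, so that any
   number c < r_l of copies of w_a^l can be moved to w_b^l. *)

Require Import Defs.
From HB Require Import structures.
From Stdlib Require Import Relations.Relation_Operators.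
From mathcomp Require Import all_boot all_order all_algebra finmap.
From mathcomp Require Import all_classical topology.

Set Implicit Arguments.
Unset Strict Implicit.
Unset Printing Implicit Defensive.

Import Order.TTheory GRing.Theory Num.Theory.

Local Open Scope classical_set_scope.
Local Open Scope ring_scope.

(** The obstacle is the points where the recipe never reaches a matched pair: there x and [phi x]
    are at different vertices w_a, w_b on every level from 1 on, so [phi] is not a tail move however
    far one truncates. Hence germs come in three kinds (tail move, zigzag, inverse zigzag), and
    images of clopen sets are computed by induction on the level that determines the set, not on the
    length of the zigzag. Three kinds suffice for composition: a path between two zigzags of the
    same direction would be at w_a and w_b at once, and opposite zigzags cancel.

    The constants of the diagram make the weight 1/r_l + Z at w_b^l, 0 elsewhere, harmonic:
    |F(w_a^l)| = r_{l+1} gives the integer r_{l+1}/r_{l+1}, and |F(w_b^l)| = d_{l+1} gives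
    d_{l+1}/r_{l+1} = 1/r_l. The weight in D is pulled back along T, since the labels of the edges
    to w_b are those withdrawn from the edges to w_a.

    The functions k in the definition of H_0 are arbitrary, so their coboundaries are integrated
    directly; the bisection relation of S(R) is the case of an indicator function. *)

Lemma uniform_bound (T : eqType) (s : seq T) (P : T -> nat -> Prop) :
  (forall a n m, (n <= m)%N -> P a n -> P a m) ->
  (forall a, a \in s -> exists n, P a n) ->
  exists n, forall a, a \in s -> P a n.
Proof.
move=> Pmono; elim: s => [|a s IH] h; first by exists 0%N.
have [n hn] := h a (mem_head _ _).
have [m hm] : exists m, forall b, b \in s -> P b m.
  by apply: IH => b hb; apply: h; rewrite in_cons hb orbT.
exists (maxn n m) => b; rewrite in_cons => /orP[/eqP ->|/hm].
  by apply: Pmono hn; exact: leq_maxl.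
by apply: Pmono; exact: leq_maxr.
Qed.

(** * Finite and infinite paths in a Bratteli diagram *)

Section FinitePaths.
Variable B : bratteli.
Implicit Types (p q w : bpath B) (x y z : ipath B).

Definition outs l (v : bvert B) : seq (blabel B * bvert B) :=
  [seq (e, u) | u <- vlev B l.+1, e <- elab l v u].

Lemma mem_outs l v eu :
  (eu \in outs l v) = (eu.2 \in vlev B l.+1) && (eu.1 \in elab l v eu.2).
Proof.
case: eu => e u; apply/allpairsPdep/andP => /=.
  by case=> u' [e' [hu he]] [? ?]; subst.
by case=> hu he; exists u, e.
Qed.

Lemma uniq_outs l v : uniq (outs l v).
Proof.
apply: allpairs_uniq_dep; [exact: fset_uniq|by move=> u _; exact: fset_uniq|].
by move=> [u e] [u' e'] _ _ /= [? ?]; subst.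
Qed.

Definition prcons p eu : bpath B := (p.1, rcons p.2 eu).

Lemma pend_prcons p eu : pend (prcons p eu) = eu.2.
Proof. by rewrite /pend /= map_rcons last_rcons. Qed.

Lemma prcons_inj p q eu eu' : prcons p eu = prcons q eu' -> p = q /\ eu = eu'.
Proof.
move=> e; have /rcons_inj[e2 ->] := congr1 snd e.
by have := congr1 fst e; case: p q e2 {e} => v s [u t] /= -> ->.
Qed.

Lemma pcatA p q w : pcat (pcat p q) w = pcat p (pcat q w).
Proof. by rewrite /pcat /= catA. Qed.

Lemma edges_from_cat l (v : bvert B) (s t : seq (blabel B * bvert B)) :
  edges_from l v (s ++ t) =
  edges_from l v s && edges_from (l + size s)%N (last v [seq e.2 | e <- s]) t.
Proof.
elim: s l v => [|[e u] s IH] l v /=; first by rewrite addn0.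
by rewrite IH -!andbA addSnnS.
Qed.

Lemma in_E_prcons k l p eu :
  in_E k l.+1 (prcons p eu) = in_E k l p && (eu \in outs l (pend p)).
Proof.
rewrite /in_E /= -cats1 edges_from_cat size_cat addn1 addnS eqSS mem_outs.
case: eqP => [->|_]; last by rewrite !andbF.
by case: eu => e u /=; rewrite !andbT -!andbA.
Qed.

Lemma in_E_vlev k l p : in_E k l p -> pend p \in vlev B l.
Proof.
case: p => v s; elim/last_ind: s l => [|s eu _] [|l].
- by move=> /and3P[h _ /eqP]; rewrite addn0 => <-.
- by move=> /and3P[h _ /eqP]; rewrite addn0 => <-.
- by rewrite /in_E size_rcons addnS andbF andbF.
by rewrite -[(v, rcons s eu)]/(prcons (v, s) eu) in_E_prcons pend_prcons mem_outs => /and3P[].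
Qed.

Fixpoint paths n : seq (bpath B) :=
  if n is n'.+1 then [seq prcons p eu | p <- paths n', eu <- outs n' (pend p)]
  else [seq (v, [::]) | v <- vlev B 0].

Lemma mem_paths n p : (p \in paths n) = in_E 0 n p.
Proof.
case: p => v s; elim: n s => [|n IH] s.
  apply/mapP/and3P => [[u hu [-> ->]]|[hv _ /eqP/size0nil hs]]; first by split.
  by exists v => //; rewrite (hs : s = [::]).
apply/allpairsPdep/idP => [[p [eu [hp heu e]]]|].
  rewrite e in_E_prcons heu andbT; by move: hp; rewrite (congr1 fst e : v = p.1) in IH *; case: p {heu e} IH => v' s' /= <-.
case: (lastP s) => [|s' eu]; first by rewrite /in_E /= !andbF.
rewrite (@in_E_prcons 0 n (v, s')) => /andP[h1 h2].
by exists (v, s'), eu; rewrite IH.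
Qed.

Lemma uniq_paths n : uniq (paths n).
Proof.
elim: n => [|n IH] /=; first by rewrite map_inj_uniq ?fset_uniq // => u v [].
apply: allpairs_uniq_dep; [exact: IH|by move=> p _; exact: uniq_outs|].
move=> [[v s] e] [[u t] e'] _ _ /= [? /rcons_inj[? ?]]; by subst.
Qed.

Lemma big_paths_succ (G : nmodType) n (F : bpath B -> G) :
  \sum_(p <- paths n.+1) F p =
  \sum_(p <- paths n) \sum_(eu <- outs n (pend p)) F (prcons p eu).
Proof. by rewrite /= big_allpairs_dep. Qed.

Lemma big_outs (G : nmodType) n v (F : bvert B -> G) :
  \sum_(eu <- outs n v) F eu.2 =
  \sum_(u <- vlev B n.+1) F u *+ #|` elab n v u|.
Proof.
rewrite big_allpairs_dep /=; apply: eq_bigr => u _.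
by rewrite big_const_seq count_predT iter_addr addr0.
Qed.

Definition seg n k x := [seq (ilab x i, ivtx x i.+1) | i <- iota n k].

Lemma seg_eqP n k x y :
  seg n k x = seg n k y <-> (forall i, (n <= i < n + k)%N ->
    ilab x i = ilab y i /\ ivtx x i.+1 = ivtx y i.+1).
Proof.
split=> [e i /andP[h1 h2]|e].
  have /(congr1 (fun s => nth (ilab x 0, ivtx x 0) s (i - n))) := e.
  have h : (i - n < k)%N by rewrite ltn_subLR.
  by rewrite !(nth_map 0%N) ?size_iota // nth_iota // subnKC // => -[-> ->].
by apply/eq_in_map => i; rewrite mem_iota => /e[-> ->].
Qed.

Lemma ipath_eq x y : ivtx x =1 ivtx y -> ilab x =1 ilab y -> x = y.
Proof.
case: x y => v e h [v' e' h'] /= /funext ev /funext ee.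
by case: _ / ev in h' *; case: _ / ee in h' *; congr IPath; exact: Prop_irrelevance.
Qed.

Definition agree n x y : Prop := initial x n = initial y n.

Lemma agreeP n x y : agree n x y <->
  (forall i, (i <= n)%N -> ivtx x i = ivtx y i) /\
  (forall i, (i < n)%N -> ilab x i = ilab y i).
Proof.
split=> [[e0 /seg_eqP e]|[ev el]].
  split=> [[|i] //|i] hi; by have [] := e i hi.
congr pair; first exact: ev.
by apply/seg_eqP => i /andP[_ hi]; split; [exact: el|exact: ev].
Qed.

Lemma agree_refl n x : agree n x x. Proof. by []. Qed.

Lemma agree_sym n x y : agree n x y -> agree n y x.
Proof. exact: esym. Qed.

Lemma agree_trans n x y z : agree n x y -> agree n y z -> agree n x z.
Proof. exact: etrans. Qed.

Lemma agree_le n m x y : (n <= m)%N -> agree m x y -> agree n x y.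
Proof.
move=> nm /agreeP[hv hl]; apply/agreeP; split=> i hi.
  by apply: hv; exact: leq_trans nm.
by apply: hl; exact: leq_trans nm.
Qed.

Lemma agree_maxl n m x y : agree (maxn n m) x y -> agree n x y.
Proof. exact: agree_le (leq_maxl n m). Qed.

Lemma agree_maxr n m x y : agree (maxn n m) x y -> agree m x y.
Proof. exact: agree_le (leq_maxr n m). Qed.

Lemma agree_vtx n i x y : (i <= n)%N -> agree n x y -> ivtx x i = ivtx y i.
Proof. by move=> h /agreeP[+ _]; apply. Qed.

Lemma agree_all x y : (forall n, agree n x y) -> x = y.
Proof.
by move=> h; apply: ipath_eq => i; have /agreeP[hv hl] := h i.+1;
  [apply: hv|apply: hl].
Qed.

Lemma same_trunc_le n m x y : (n <= m)%N -> same_trunc n x y -> same_trunc m x y.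
Proof. by move=> nm h i hi; apply: h; exact: leq_trans hi. Qed.

Lemma same_trunc_refl n x : same_trunc n x x.
Proof. by []. Qed.

Lemma same_trunc_sym n x y : same_trunc n x y -> same_trunc n y x.
Proof. by move=> h i /h[-> ->]. Qed.

Lemma same_trunc_trans n x y z :
  same_trunc n x y -> same_trunc n y z -> same_trunc n x z.
Proof. by move=> h h' i hi; have [-> ->] := h i hi; exact: h'. Qed.

Lemma agree_trunc_eq n x y : agree n x y -> same_trunc n x y -> x = y.
Proof.
move=> /agreeP[hv hl] h; apply: ipath_eq => i.
  by case: (leqP i n) => [/hv//|/ltnW/h[]].
by case: (ltnP i n) => [/hl//|/h[]].
Qed.

Lemma same_trunc0 x y : same_trunc 0 x y -> x = y.
Proof.
by move=> t; apply: (agree_trunc_eq _ t); rewrite /agree /initial /=; have [-> _] := t 0%N (leqnn 0).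
Qed.

Lemma initialS x n : initial x n.+1 = prcons (initial x n) (ilab x n, ivtx x n.+1).
Proof. by rewrite /initial -[n.+1]addn1 iotaD map_cat /= add0n addn1 cats1. Qed.

Lemma pend_initial x n : pend (initial x n) = ivtx x n.
Proof. by case: n => // n; rewrite initialS pend_prcons. Qed.

Lemma in_E_initial x n : in_E 0 n (initial x n).
Proof.
elim: n => [|n IH]; first by rewrite /in_E /= andbT; have [] := ipathP x 0.
rewrite initialS in_E_prcons IH mem_outs pend_initial /=.
by have [_ ->] := ipathP x n; have [-> _] := ipathP x n.+1.
Qed.

Lemma starts_initial n p x : in_E 0 n p -> starts p x <-> initial x n = p.
Proof. by move=> /and3P[_ _ /eqP]; rewrite add0n /starts => ->. Qed.

Lemma starts_prcons n p eu x : in_E 0 n p ->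
  starts (prcons p eu) x <-> starts p x /\ (ilab x n, ivtx x n.+1) = eu.
Proof.
move=> hp; have /and3P[_ _ /eqP hs] := hp; rewrite add0n in hs.
rewrite /starts /= size_rcons hs initialS; split=> [/prcons_inj//|[-> ->]//].
Qed.

Lemma size_in_E k l p : in_E k l p -> (k + size p.2 = l)%N.
Proof. by move=> /and3P[_ _ /eqP]. Qed.

Lemma in_paths_initial n x : initial x n \in paths n.
Proof. by rewrite mem_paths in_E_initial. Qed.

Lemma in_E_take n i p : (i <= n)%N -> in_E 0 n p -> in_E 0 i (pcut i p).
Proof.
move=> hi /and3P[h1 h2 /eqP h3]; apply/and3P; split=> //=.
  by move: h2; rewrite -{1}(cat_take_drop i p.2) edges_from_cat => /andP[].
by rewrite add0n size_takel // -[size _]add0n h3.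
Qed.

Lemma ipath_limit n (q : nat -> bpath B) :
  (forall k, in_E 0 (n + k)%N (q k)) ->
  (forall k, exists eu, q k.+1 = prcons (q k) eu) ->
  exists x, forall k, initial x (n + k)%N = q k.
Proof.
move=> hE hS.
have hsz k : size (q k).2 = (n + k)%N by have := size_in_E (hE k).
have cut1 k i : (i <= n + k)%N -> pcut i (q k.+1) = pcut i (q k).
  move=> hi; have [eu ->] := hS k; rewrite /pcut /= -cats1 takel_cat // ?hsz //.
have cutk k j i : (i <= n + k)%N -> pcut i (q (k + j)%N) = pcut i (q k).
  move=> hi; elim: j => [|j IH]; first by rewrite addn0.
  by rewrite addnS cut1 // (leq_trans hi) // leq_add2l leq_addr.
(* [q i] reaches level n + i >= i, so its truncation at i has full length, and by [cutk] no later
   [q j] changes it. *)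
pose V i := pend (pcut i (q i)).
have exE i : exists eu, pcut i.+1 (q i.+1) = prcons (pcut i (q i)) eu.
  rewrite -(cutk i 1 i (leq_addl _ _)) addn1.
  have := hsz i.+1; case: (q i.+1) => v s /= hs.
  have his : (i < size s)%N by rewrite hs addnS ltnS leq_addl.
  case: s his {hs} => // e s his.
  by exists (nth e (e :: s) i); rewrite /pcut /prcons /= -(take_nth e).
have [g hg] := choice exE.
have Vg i : V i.+1 = (g i).2 by rewrite /V hg pend_prcons.
pose L i := (g i).1.
have VL i : pcut i.+1 (q i.+1) = prcons (pcut i (q i)) (L i, V i.+1).
  by rewrite Vg /L hg; case: (g i).
have hcut i : in_E 0 i (pcut i (q i)) by apply: in_E_take (hE i); exact: leq_addl.
have P l : V l \in vlev B l /\ L l \in elab l (V l) (V l.+1).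
  split; first exact: in_E_vlev (hcut l).
  have := hcut l.+1; rewrite VL in_E_prcons mem_outs /= => /and3P[_ _].
  by rewrite -/(V l).
exists (IPath P) => k.
have I i : initial (IPath P) i = pcut i (q i).
  elim: i => [|i IH]; last by rewrite initialS IH VL.
  by rewrite /initial /pcut /= take0 /V /pend /pcut /= take0.
rewrite I addnC cutk; last by rewrite addnC.
by rewrite /pcut addnC take_oversize ?hsz //; case: (q k).
Qed.

(** Dependent choice along the tree of finite paths, followed by passage to the limit. It serves
    three times: for nonempty cylinders (trivial Q), for the infinite branch in [konig], and for
    lifting paths through the shadow map. *)
Lemma grow (Q : bpath B -> Prop) n p :
  (forall m q, in_E 0 m q -> Q q ->
     exists2 eu, eu \in outs m (pend q) & Q (prcons q eu)) ->
  in_E 0 n p -> Q p ->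
  exists x, starts p x /\ forall m, (n <= m)%N -> Q (initial x m).
Proof.
move=> hQ hp Qp.
pose P (kq : nat * bpath B) := in_E 0 (n + kq.1)%N kq.2 /\ Q kq.2.
pose T := {kq | P kq}.
have step (t : T) : exists t' : T, (sval t').1 = (sval t).1.+1 /\
    exists eu, (sval t').2 = prcons (sval t).2 eu.
  case: t => -[k q] [/= hq Qq]; have [eu heu Qeu] := hQ _ _ hq Qq.
  have h : P (k.+1, prcons q eu).
    by rewrite /P /= addnS in_E_prcons hq heu.
  by exists (exist P _ h); split=> //; exists eu.
have [f hf] := choice step.
have h0 : P (0%N, p) by rewrite /P addn0.
pose g k := iter k f (exist P _ h0).
have gk k : (sval (g k)).1 = k.
  by elim: k => //= k IH; have [-> _] := hf (g k); rewrite IH.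
have [x hx] : exists x, forall k, initial x (n + k)%N = (sval (g k)).2.
  apply: ipath_limit => k; first by have [] := svalP (g k); rewrite gk.
  by have [_ [eu h]] := hf (g k); exists eu.
exists x; split; first by apply/(starts_initial x hp); rewrite -[n]addn0 hx.
by move=> m /subnKC <-; rewrite hx; have [] := svalP (g (m - n)%N).
Qed.

Lemma splice n x y : ivtx x n = ivtx y n ->
  exists z, agree n x z /\ same_trunc n y z.
Proof.
move=> e.
pose V i := if (i <= n)%N then ivtx x i else ivtx y i.
pose L i := if (i < n)%N then ilab x i else ilab y i.
have P l : V l \in vlev B l /\ L l \in elab l (V l) (V l.+1).
  rewrite /V /L; case: (ltngtP l n) => h; first exact: (ipathP x).
    exact: (ipathP y).
  by rewrite h e; exact: (ipathP y).
exists (IPath P); split.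
  by apply/agreeP; split=> i hi /=; rewrite /V /L hi.
move=> i; rewrite leq_eqVlt => /orP[/eqP <-|hi] /=; rewrite /V /L.
  by rewrite leqnn ltnn e.
by rewrite leqNgt hi ltnNge (ltnW hi).
Qed.

(** Call a node bad if at every level some path through it still violates Q. A node has finitely
    many successors, so a bad node has a bad one; a bad root would therefore start an infinite path
    along which Q never holds. *)
Lemma konig (Q : bpath B -> Prop) :
  (forall n p eu, in_E 0 n p -> Q p -> Q (prcons p eu)) ->
  (forall x, exists n, Q (initial x n)) ->
  exists N, forall x, Q (initial x N).
Proof.
move=> Qmono Qex.
have Qle x n m : (n <= m)%N -> Q (initial x n) -> Q (initial x m).
  move=> /subnKC <- Qn; elim: (m - n)%N => [|k IH]; first by rewrite addn0.
  by rewrite addnS initialS; apply: Qmono IH; exact: in_E_initial.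
pose bad p := forall N, exists2 x, starts p x & ~ Q (initial x N).
apply: contrapT => noN.
have bad_step m q : in_E 0 m q -> bad q ->
    exists2 eu, eu \in outs m (pend q) & bad (prcons q eu).
  move=> hq bq; apply: contrapT => nobad.
  have good eu : eu \in outs m (pend q) ->
      exists N, forall x, starts (prcons q eu) x -> Q (initial x N).
    move=> heu; apply: contrapT => h; apply: nobad; exists eu => // N.
    apply: contrapT => h'; apply: h; exists N => x hx.
    by apply: contrapT => h''; apply: h'; exists x.
  have [N hN] : exists N, forall eu, eu \in outs m (pend q) ->
      forall x, starts (prcons q eu) x -> Q (initial x N).
    apply: uniform_bound good => eu n1 n2 n12 h x hx.
    by apply: Qle (h x hx).
  have [x hx] := bq N; apply; apply: (hN (ilab x m, ivtx x m.+1)).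
    have := in_E_initial x m.+1; rewrite initialS in_E_prcons => /andP[_].
    by move/(starts_initial x hq): hx => ->.
  rewrite -(_ : initial x m.+1 = prcons q (ilab x m, ivtx x m.+1)).
    by apply/(starts_initial x (in_E_initial x m.+1)).
  by rewrite initialS; move/(starts_initial x hq): hx => ->.
have [v hv bv] : exists2 v, v \in vlev B 0 & bad (v, [::]).
  apply: contrapT => nobad.
  have good v : v \in vlev B 0 ->
      exists N, forall x, ivtx x 0 = v -> Q (initial x N).
    move=> hv; apply: contrapT => h; apply: nobad; exists v => // N.
    apply: contrapT => h'; apply: h; exists N => x hx.
    by apply: contrapT => h''; apply: h'; exists x => //; rewrite /starts /initial /= hx.
  have [N hN] : exists N, forall v, v \in (vlev B 0 : seq _) ->
      forall x, ivtx x 0 = v -> Q (initial x N).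
    apply: uniform_bound good => v n1 n2 n12 h x hx.
    by apply: Qle (h x hx).
  apply: noN; exists N => x; apply: (hN (ivtx x 0)) => //.
  by have [] := ipathP x 0.
have h0 : in_E 0 0 (v, [::]) by rewrite /in_E /= hv.
have [x [_ hx]] := grow bad_step h0 bv.
have [n Qn] := Qex x.
have [y hy] := hx n (leq0n n) n; apply.
by move/(starts_initial y (in_E_initial x n)): hy => ->.
Qed.

End FinitePaths.

(** The near-covering form of compactness, applied to the filter generated by the sets of all
    sequences containing a given finite sequence; a large sequence in this filter is the finite
    subcover. *)
Lemma compact_finite_cover (T : topologicalType) (A : set T) (U : T -> set T) :
  compact A -> (forall x, A x -> nbhs x (U x)) ->
  exists s : seq T, (forall t, t \in s -> A t) /\
    forall x, A x -> exists2 t, t \in s & U t x.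
Proof.
move=> cA hU.
pose F : set_system (seq T) :=
  [set S | exists s0 : seq T, forall s : seq T, {subset s0 <= s} -> S s].
have FF : Filter F.
  split; first by exists [::].
    move=> P Q [s1 h1] [s2 h2]; exists (s1 ++ s2) => s hs; split.
      by apply: h1 => t ht; apply: hs; rewrite mem_cat ht.
    by apply: h2 => t ht; apply: hs; rewrite mem_cat ht orbT.
  by move=> P Q PQ [s1 h1]; exists s1 => s hs; apply: PQ; exact: h1.
have [|s0 hs0] := (iffLR (compact_near_coveringP A)) cA _ F
    (fun s x => exists t, [/\ t \in s, A t & U t x]) FF.
  move=> x Ax; exists (U x, [set s : seq T | x \in s]); first split=> /=; first exact: hU.
    by exists [:: x] => s; apply; exact: mem_head.
  by move=> [y s] /= [Uy xs]; exists x.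
exists [seq t <- s0 | `[< A t >]]; split; first by move=> t; rewrite mem_filter => /andP[/asboolP].
move=> x Ax; have [t [ht At Ut]] := hs0 s0 (fun _ h => h) x Ax.
by exists t => //; rewrite mem_filter ht andbT; exact/asboolP.
Qed.

(** * The topology of the path space *)

Section PathSpace.
Variable B : bratteli.
Implicit Types (p q w : bpath B) (x y z : ipath B) (K L : set (ipath B)).

Definition lc n K := forall x y, agree n x y -> K x -> K y.

Definition det (T : Type) n (f : ipath B -> T) :=
  forall x y, agree n x y -> f x = f y.

Lemma open_cyl l p : in_E 0 l p -> open (cyl p).
Proof.
move=> hp; exists [set cyl p]; last by rewrite bigcup_set1.
by move=> _ ->; apply: finI_from1; exists p => //; exists l.
Qed.

Lemma open_agree K x : open K -> K x -> exists n, forall y, agree n x y -> K y.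
Proof.
move=> [D' sD' <-] [A D'A Ax].
have [S hS defA] := sD' _ D'A.
have {}hS : forall C, C \in (S : seq _) -> C x /\ exists n, forall y, agree n x y -> C y.
  move=> C hC; have Cx : C x by move: Ax; rewrite -defA; apply.
  split=> //; have := hS C hC; rewrite inE => -[w [l hw] e].
  move: Cx; rewrite -e /cyl /= => /(starts_initial x hw) Cx.
  by exists l => y; rewrite /agree Cx => ey; apply/(starts_initial y hw).
have [n hn] : exists n, forall C, C \in (S : seq _) -> forall y, agree n x y -> C y.
  apply: uniform_bound => [C n m nm h y /(agree_le nm)/h//|C hC].
  by have [_] := hS C hC.
exists n => y xy; exists A => //.
apply: (eq_ind _ (fun Z : set (ipath B) => Z y) _ _ defA) => C /= hC.
exact: hn hC y xy.
Qed.

Lemma openP_agree K :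
  (forall x, K x -> exists n, forall y, agree n x y -> K y) -> open K.
Proof.
move=> h; rewrite openE => x /h[n hn]; rewrite /interior nbhsE.
exists (cyl (initial x n)) => [|y hy].
  split; first exact: open_cyl (in_E_initial x n).
  exact/(starts_initial x (in_E_initial x n)).
apply: hn; apply: esym; exact/(starts_initial y (in_E_initial x n)).
Qed.

(** A filter without cluster point gives every path a cylinder that misses some member of the
    filter. [konig] makes the level N of these cylinders uniform, and intersecting over the finitely
    many paths of level N yields an empty member. *)
Lemma compact_ipath : compact [set: ipath B].
Proof.
move=> F FF _; apply: contrapT => noclus.
pose Q p := exists2 A, F A & forall y, starts p y -> ~ A y.
have [N hN] : exists N, forall x, Q (initial x N).
  apply: konig => [n p eu hp [A FA hA]|x].
    by exists A => // y /(starts_prcons _ _ hp)[/hA].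
  apply: contrapT => noQ; apply: noclus; exists x; split=> // A C FA.
  rewrite nbhsE => -[W [oW Wx] WC]; have [n hn] := open_agree oW Wx.
  apply: contrapT => h; apply: noQ; exists n; exists A => // y hy Ay; apply: h.
  exists y; split=> //; apply/WC/hn/esym.
  exact/(starts_initial y (in_E_initial x n)).
have [A FA hA] : exists2 A, F A & forall p, p \in paths B N ->
    forall y, initial y N = p -> ~ A y.
  elim: (paths B N) => [|p s [A FA hA]]; first by exists setT => //; exact: filterT.
  have [[x hx]|hp] := pselect (exists x, initial x N = p); last first.
    exists A => // q; rewrite in_cons => /orP[/eqP ->|/hA//] y hy.
    by case: hp; exists y.
  have [C FC hC] := hN x; exists (A `&` C); first exact: filterI.
  move=> q; rewrite in_cons => /orP[/eqP ->|hq] y hy [Ay Cy]; last exact: hA hq y hy Ay.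
  by apply: hC Cy; apply/(starts_initial y (in_E_initial x N)); rewrite hx.
have [y Ay] := filter_ex FA.
exact: (hA _ (in_paths_initial N y) y).
Qed.

Lemma lc_le n m K : (n <= m)%N -> lc n K -> lc m K.
Proof. by move=> nm h x y /(agree_le nm); exact: h. Qed.

Lemma det_le (T : Type) n m (f : ipath B -> T) : (n <= m)%N -> det n f -> det m f.
Proof. by move=> nm h x y /(agree_le nm); exact: h. Qed.

Lemma lc_det n K : lc n K <-> det n K.
Proof.
split=> [h x y xy|h x y /h ->//].
by apply/propext; split; apply: h => //; exact: agree_sym.
Qed.

Lemma starts_initial_agree n x y : starts (initial x n) y <-> agree n x y.
Proof.
split=> [/(starts_initial y (in_E_initial x n))//|h].
by apply/(starts_initial y (in_E_initial x n)).
Qed.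

Lemma lc_cyl n p : in_E 0 n p -> lc n (cyl p).
Proof.
move=> hp x y xy /(starts_initial x hp) hx; apply/(starts_initial y hp).
by rewrite -hx.
Qed.

(** [konig], applied to the property that f is constant on a cylinder, makes the local levels
    uniform. This is how clopen sets and the functions in C_c become combinatorial data of a finite
    level. *)
Lemma locally_det (T : Type) (f : ipath B -> T) :
  (forall x, exists n, forall y, agree n x y -> f x = f y) -> exists n, det n f.
Proof.
move=> hf.
have [|x|N hN] := @konig B
    (fun p => forall y z, starts p y -> starts p z -> f y = f z).
- move=> n p eu hp h y z /(starts_prcons _ _ hp)[hy _].
  by move=> /(starts_prcons _ _ hp)[hz _]; exact: h.
- have [n hn] := hf x; exists n => y z /starts_initial_agree/hn <-.
  by move=> /starts_initial_agree/hn <-.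
- by exists N => x y xy; apply: (hN x); exact/starts_initial_agree.
Qed.

Lemma lc_open n K : lc n K -> open K.
Proof. by move=> h; apply: openP_agree => x Kx; exists n => y /h; apply. Qed.

Lemma lc_setC n K : lc n K -> lc n (~` K).
Proof. by move=> h x y xy nKx Ky; apply: nKx; apply: h Ky; exact: agree_sym. Qed.

Lemma lc_closed n K : lc n K -> closed K.
Proof. by move=> /lc_setC/lc_open; rewrite -openC. Qed.

Lemma lc_compact n K : lc n K -> compact K.
Proof.
by move=> /lc_closed h; apply: (subclosed_compact h compact_ipath).
Qed.

Lemma hausdorff_ipath : hausdorff_space (ipath B).
Proof.
rewrite open_hausdorff => x y; apply: contra_neqP => h.
apply: agree_all => n; apply: contrapT => nxy; apply: h.
exists (cyl (initial x n), cyl (initial y n)) => /=.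
  by rewrite !inE; split; exact/starts_initial_agree.
split; try exact: open_cyl (in_E_initial _ n).
apply/eqP/seteqP; split=> // z [/starts_initial_agree xz /starts_initial_agree yz].
by apply: nxy; apply: agree_trans xz (agree_sym yz).
Qed.

Lemma clopen_lc K : clopen K <-> exists n, lc n K.
Proof.
split=> [[oK cK]|[n h]]; last by split; [exact: lc_open h|exact: lc_closed h].
have [x|n /lc_det h] := @locally_det Prop K; last by exists n.
have [Kx|nKx] := pselect (K x).
  have [n h] := open_agree oK Kx; exists n => y /h Ky.
  by apply/propext; split.
have [n h] := open_agree (closed_openC cK) nKx; exists n => y /h Ky.
by apply/propext; split.
Qed.

Lemma copen_lc (K : copen (ipath B)) : exists n, lc n K.
Proof.
apply/clopen_lc; have [cK oK] := copenP K.
by split=> //; exact: compact_closed hausdorff_ipath cK.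
Qed.

Lemma lc_copen n K : lc n K -> compact K /\ open K.
Proof. by move=> h; split; [exact: lc_compact h|exact: lc_open h]. Qed.

Lemma Cc_det (f : ipath B -> int) : f \in Cc (ipath B) <-> exists n, det n f.
Proof.
split=> [/asboolP[hf _]|[n h]].
  apply: locally_det => x; have [n h] := open_agree (hf (f x)) (erefl (f x)).
  by exists n => y /h.
apply/asboolP; split=> [m|].
  apply: (@lc_open n) => x y /h e; rewrite /preimage /= => <-; exact/esym.
have l : lc n [set x | f x != 0] by move=> x y /h /= ->.
by rewrite -(iffLR (closure_id _) (lc_closed l)); exact: lc_compact l.
Qed.

End PathSpace.

Definition ind (T : Type) (K : set T) (x : T) : int := (`[< K x >])%:Z.

Lemma ind_bigU (T : Type) (J : eqType) (s : seq J) (K : set T) (L : J -> set T) :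
  uniq s -> (forall x, K x <-> exists2 j, j \in s & L j x) ->
  (forall x i j, i \in s -> j \in s -> L i x -> L j x -> i = j) ->
  ind K = fun x => \sum_(j <- s) ind (L j) x.
Proof.
move=> us hK hL; apply/funext => x; rewrite /ind.
have [/hK[j js Lj]|nK] := pselect (K x).
  rewrite (bigD1_seq j) //= big1_seq ?addr0 => [|i /andP[ij hi]]; last first.
    by case: asboolP => // Li; case/eqP: ij; exact: hL Li Lj.
  by rewrite !asboolT //; apply/hK; exists j.
rewrite asboolF // big1_seq // => j /andP[_ js].
by case: asboolP => // Lj; case: nK; apply/hK; exists j.
Qed.

Definition has_successors (B : bratteli) := forall l (v : bvert B),
  v \in vlev B l -> exists eu, eu \in outs l v.

Definition harmonic (B : bratteli) (G : zmodType) (m : nat -> bvert B -> G) :=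
  forall l v, v \in vlev B l ->
    m l v = \sum_(u <- vlev B l.+1) m l.+1 u *+ #|` elab l v u|.

Lemma in_E_starts (B : bratteli) (hB : has_successors B) n (p : bpath B) :
  in_E 0 n p -> exists x, starts p x.
Proof.
move=> hp; have [m q hq _|x [hx _]] := @grow B (fun=> True) n p _ hp I; last by exists x.
  by have [eu heu] := hB _ _ (in_E_vlev hq); exists eu.
Qed.

(** * Integrals of locally constant functions *)

Section Integral.
Variables (B : bratteli) (hB : has_successors B).
Variables (G : zmodType) (m : nat -> bvert B -> G).
Hypothesis hm : harmonic m.
Implicit Types (p q w : bpath B) (x y z : ipath B) (f g : ipath B -> int).
Implicit Types (K L : set (ipath B)).

(** The value of f on the cylinder of p, meaningful when f is constant there; 0 is a default for an
    empty cylinder. *)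
Definition valp f p : int :=
  if pselect (exists x, starts p x) is left h then f (projT1 (cid h)) else 0.

Lemma valpE n f p x : det n f -> in_E 0 n p -> starts p x -> valp f p = f x.
Proof.
move=> hf hp hx; rewrite /valp; case: pselect => [h|]; last by case; exists x.
case: (cid h) => y /= hy; apply: hf; rewrite /agree.
by move/(starts_initial y hp): hy => ->; move/(starts_initial x hp): hx => ->.
Qed.

Lemma valp_initial n f x : det n f -> valp f (initial x n) = f x.
Proof.
by move=> hf; apply: valpE hf (in_E_initial x n) _; exact/starts_initial_agree.
Qed.

Definition Isum n f : G := \sum_(p <- paths B n) m n (pend p) *~ valp f p.

(** Refining splits the term of p over the outgoing edges, and harmonicity is exactly the statement
    that the weights reached by these edges add up to the weight at the end of p. So the level in
    [Int] does not matter. *)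
Lemma Isum_refine n f : det n f -> Isum n f = Isum n.+1 f.
Proof.
move=> hf; rewrite /Isum big_paths_succ; apply: eq_big_seq => p.
rewrite mem_paths => hp.
under eq_big_seq => eu heu.
  have [x hx] : exists x, starts (prcons p eu) x.
    by apply: in_E_starts hB n.+1 _ _; rewrite in_E_prcons hp.
  rewrite (_ : valp f (prcons p eu) = valp f p); first over.
  have /(starts_prcons _ _ hp)[hx' _] := hx.
  rewrite (valpE hf hp hx') (@valpE n.+1 _ _ x) //; first exact: det_le hf.
  by rewrite in_E_prcons hp.
rewrite -mulrz_suml; congr (_ *~ _).
under eq_bigr do rewrite pend_prcons.
by rewrite (big_outs n (pend p) (m n.+1)); apply: hm; exact: in_E_vlev hp.
Qed.

Lemma Isum_le n k f : det n f -> (n <= k)%N -> Isum n f = Isum k f.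
Proof.
move=> hf /subnKC <-; elim: (k - n)%N => [|j IH]; first by rewrite addn0.
by rewrite IH addnS; apply: Isum_refine; apply: det_le hf; exact: leq_addr.
Qed.

Definition Int f : G := Isum (xget 0%N [set n | det n f]) f.

Lemma IntE n f : det n f -> Int f = Isum n f.
Proof.
move=> hf; rewrite /Int; case: xgetP => [k _ hk|/(_ _ hf)//].
by rewrite (Isum_le hk (leq_maxl k n)) (Isum_le hf (leq_maxr k n)).
Qed.

Lemma Int_ext f g : f =1 g -> Int f = Int g.
Proof. by move=> /funext ->. Qed.

Lemma valp_add f g p : valp (fun x => f x + g x) p = valp f p + valp g p.
Proof. by rewrite /valp; case: pselect. Qed.

Lemma valp_opp f p : valp (fun x => - f x) p = - valp f p.
Proof. by rewrite /valp; case: pselect; rewrite ?oppr0. Qed.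

Lemma Int0 : Int (fun=> 0) = 0.
Proof.
rewrite (@IntE 0) // /Isum big1 // => p _.
by rewrite /valp; case: pselect => *; rewrite mulr0z.
Qed.

Lemma IntD n f g : det n f -> det n g -> Int (fun x => f x + g x) = Int f + Int g.
Proof.
move=> hf hg; rewrite (IntE hf) (IntE hg) (@IntE n); last first.
  by move=> x y xy; rewrite (hf _ _ xy) (hg _ _ xy).
by rewrite /Isum -big_split /=; apply: eq_bigr => p _; rewrite valp_add mulrzDr.
Qed.

Lemma IntN n f : det n f -> Int (fun x => - f x) = - Int f.
Proof.
move=> hf; rewrite (IntE hf) (@IntE n) => [|x y xy]; last by rewrite (hf _ _ xy).
by rewrite /Isum -sumrN; apply: eq_bigr => p _; rewrite valp_opp mulrNz.
Qed.

Lemma IntZ n (c : int) f : det n f -> Int (fun x => c * f x) = Int f *~ c.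
Proof.
move=> hf; rewrite (IntE hf) (@IntE n) => [|x y xy]; last by rewrite (hf _ _ xy).
rewrite /Isum mulrz_suml; apply: eq_bigr => p _; rewrite -mulrzA mulrC.
by congr (_ *~ _); rewrite /valp; case: pselect; rewrite ?mulr0.
Qed.

Lemma IntB n f g : det n f -> det n g -> Int (fun x => f x - g x) = Int f - Int g.
Proof.
move=> hf hg; rewrite (@IntD n) ?(@IntN n) //.
by move=> x y xy; rewrite (hg _ _ xy).
Qed.

Lemma det_sum n (J : eqType) (s : seq J) (F : J -> ipath B -> int) :
  (forall j, j \in s -> det n (F j)) -> det n (fun x => \sum_(j <- s) F j x).
Proof.
by move=> h x y xy; apply: eq_big_seq => j js; exact: h.
Qed.

Lemma Int_sum (J : eqType) (s : seq J) (F : J -> ipath B -> int) :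
  (forall j, j \in s -> exists n, det n (F j)) ->
  Int (fun x => \sum_(j <- s) F j x) = \sum_(j <- s) Int (F j).
Proof.
move=> h; have [n hn] : exists n, forall j, j \in s -> det n (F j).
  by apply: uniform_bound => // j a b ab; exact: det_le.
elim: s {h} hn => [|j s IH] hn.
  by rewrite big_nil -Int0; apply: Int_ext => x; rewrite big_nil.
rewrite big_cons -IH => [|i hi]; last by apply: hn; rewrite in_cons hi orbT.
rewrite -(@IntD n); first by apply: Int_ext => x; rewrite big_cons.
  by apply: hn; exact: mem_head.
by apply: det_sum => i hi; apply: hn; rewrite in_cons hi orbT.
Qed.

Lemma det_ind n K : lc n K -> det n (ind K).
Proof. by move=> /lc_det h x y xy; rewrite /ind (h _ _ xy). Qed.

Definition mu K : G := Int (ind K).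

Lemma mu_bigU (J : eqType) (s : seq J) K (L : J -> set (ipath B)) :
  uniq s -> (forall x, K x <-> exists2 j, j \in s & L j x) ->
  (forall x i j, i \in s -> j \in s -> L i x -> L j x -> i = j) ->
  (forall j, j \in s -> exists n, lc n (L j)) ->
  mu K = \sum_(j <- s) mu (L j).
Proof.
move=> us hK hL hlc; rewrite /mu (ind_bigU us hK hL) Int_sum // => j js.
by have [n h] := hlc j js; exists n; exact: det_ind.
Qed.

Lemma mu_cyl n p : in_E 0 n p -> mu (cyl p) = m n (pend p).
Proof.
move=> hp; rewrite /mu (IntE (det_ind (lc_cyl hp))) /Isum.
rewrite (bigD1_seq p) ?uniq_paths ?mem_paths //= big1_seq ?addr0.
  have [x hx] := in_E_starts hB hp.
  by rewrite (valpE (det_ind (lc_cyl hp)) hp hx) /ind asboolT.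
move=> q /andP[qp]; rewrite mem_paths => hq.
have [x hx] := in_E_starts hB hq.
rewrite (valpE (det_ind (lc_cyl hp)) hq hx) /ind asboolF ?mulr0z //.
move=> /(starts_initial x hp) e; move/(starts_initial x hq): hx => hx.
by rewrite -hx e eqxx in qp.
Qed.

End Integral.

Lemma asboolZ (P Q : Prop) : (P <-> Q) -> (`[< P >])%:Z = (`[< Q >])%:Z.
Proof. by move=> h; rewrite (asbool_equiv_eq h). Qed.

(** Each piece meets A at most once, so the sum over A, which may be an infinite fibre of the range
    or source map, becomes a count of the pieces that meet it. *)
Lemma fsum_pieces (T : choiceType) (A : set T) (k : T -> int) (J : eqType)
    (s : seq J) (c : J -> int) (E : J -> set T) :
  (forall g, A g -> k g = \sum_(j <- s) c j * ind (E j) g) ->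
  (forall j g h, j \in s -> A g -> A h -> E j g -> E j h -> g = h) ->
  \sum_(g \in A) k g = \sum_(j <- s) c j * (`[< exists g, A g /\ E j g >])%:Z.
Proof.
move=> hk hE.
pose pk j : option T := if pselect (exists g, A g /\ E j g) is left h
  then Some (projT1 (cid h)) else None.
(* The points of A lying on some piece; this finite list contains the support of k in A. *)
pose r := undup (pmap pk s).
have inr g j : j \in s -> A g -> E j g -> g \in r.
  move=> js Ag Eg; rewrite mem_undup mem_pmap; apply/mapP; exists j => //.
  rewrite /pk; case: pselect => [h|]; last by case; exists g.
  by case: (cid h) => g' /= [Ag' Eg']; congr Some; exact: hE Eg Eg'.
have rA g : g \in r -> A g.
  rewrite mem_undup mem_pmap => /mapP[j _]; rewrite /pk.
  by case: pselect => // h [->]; case: (cid h) => g' /= [].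
rewrite (@fsbigE _ _ _ _ A r) ?undup_uniq //; last first.
  move=> g /= Ag gr; rewrite hk // big1_seq // => j /andP[_ js].
  by rewrite /ind asboolF ?mulr0 // => Eg; rewrite (inr g j) in gr.
rewrite big_seq_cond (eq_bigl (fun g => g \in r)); last first.
  by move=> g /=; case: (boolP (g \in r)) => //= /rA /mem_set.
rewrite -big_seq (eq_big_seq (fun g => \sum_(j <- s) c j * ind (E j) g)); last first.
  by move=> g /rA; exact: hk.
rewrite exchange_big /=; apply: eq_big_seq => j js; rewrite -mulr_sumr.
congr (_ * _); case: asboolP => [[g [Ag Eg]]|nE].
  rewrite (bigD1_seq g) ?undup_uniq ?(inr g j) //= big1_seq; last first.
    move=> h /andP[hg hr]; rewrite /ind asboolF // => Eh.
    by case/eqP: hg; apply: hE js (rA _ hr) Ag Eh Eg.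
  by rewrite addr0 /ind asboolT.
rewrite big1_seq // => g /andP[_ /rA Ag]; rewrite /ind asboolF // => Eg.
by apply: nE; exists g.
Qed.

(** * Etale relations on a path space *)

Definition im (S T : Type) (P : set (S * T)) (K : set S) : set T :=
  [set y | exists2 x, K x & P (x, y)].

Definition lcs (B : bratteli) (K : set (ipath B)) := exists n, lc n K.

(** Etaleness expressed on single basic sets, with levels of agreement in place of open sets: basic
    sets are graphs of partial injections with locally full domain, they determine each other near a
    common point ([eb_germ]), can be shrunk ([eb_small]), and carry small clopen sets to clopen sets
    ([eb_im]). *)
Record etale_basis (B : bratteli) (G : toprel (ipath B)) : Prop := EtaleBasis {
  eb_inj : forall P x x' y, er_base G P -> P (x, y) -> P (x', y) -> x = x';
  eb_fun : forall P x y y', er_base G P -> P (x, y) -> P (x, y') -> y = y';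
  eb_sub : forall P xy, er_base G P -> P xy -> er G xy;
  eb_cov : forall xy, er G xy -> exists2 P, er_base G P & P xy;
  eb_germ : forall P P' x y, er_base G P -> er_base G P' -> P (x, y) -> P' (x, y) ->
    exists n, forall x' y', agree n x x' -> P (x', y') -> P' (x', y');
  eb_small : forall P x y n, er_base G P -> P (x, y) ->
    exists P', [/\ er_base G P', P' (x, y) & forall x' y', P' (x', y') ->
      [/\ P (x', y'), agree n x x' & agree n y y']];
  eb_dom : forall P x y, er_base G P -> P (x, y) ->
    exists n, forall x', agree n x x' -> exists y', P (x', y');
  eb_im : forall P x y, er_base G P -> P (x, y) ->
    exists n, forall K, lcs K -> (forall x', K x' -> agree n x x') -> lcs (im P K) }.

(** Invariance is asked only for clopen sets near x, because a product of factors is understood only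
    near each of its points; compactness assembles the local statements in [Int_coboundary]. *)
Definition preserves (B : bratteli) (A : zmodType) (m : nat -> bvert B -> A)
    (G : toprel (ipath B)) :=
  forall P x y, er_base G P -> P (x, y) ->
    exists n, forall K, lcs K -> (forall x', K x' -> agree n x x') ->
      mu m K = mu m (im P K).

Lemma gpd_eq (X : Type) (G : toprel X) (g h : gpd G) : gpair g = gpair h -> g = h.
Proof. by case: g h => a p [b q] /= e; case: _ / e q => q; congr Gpd; exact: Prop_irrelevance. Qed.

Section LocallyConstantSets.
Variable B : bratteli.
Implicit Types (K L : set (ipath B)).

Lemma lcsI K L : lcs K -> lcs L -> lcs (K `&` L).
Proof.
move=> [n hn] [k hk]; exists (maxn n k) => x y xy [Kx Lx]; split.
  by apply: hn Kx; exact: agree_maxl xy.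
by apply: hk Lx; exact: agree_maxr xy.
Qed.

Lemma lcsC K : lcs K -> lcs (~` K).
Proof. by move=> [n /lc_setC h]; exists n. Qed.

Lemma lcsU K L : lcs K -> lcs L -> lcs (K `|` L).
Proof. by rewrite -(setCK (K `|` L)) setCU => /lcsC lK /lcsC lL; apply/lcsC/lcsI. Qed.

Lemma lcs_agree n x : lcs [set y : ipath B | agree n x y].
Proof. by exists n => y z yz xy; exact: agree_trans yz. Qed.

Lemma lcs_local K : (forall x, exists n, forall y, agree n x y -> (K x <-> K y)) ->
  lcs K.
Proof.
move=> h; have [x|n /lc_det hn] := @locally_det B Prop K; last by exists n.
by have [n hn] := h x; exists n => y /hn e; exact/propext.
Qed.

Lemma lcs0 : lcs (@set0 (ipath B)). Proof. by exists 0%N. Qed.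

Lemma lcs_bigU (J : eqType) (s : seq J) K (L : J -> set (ipath B)) :
  (forall x, K x <-> exists2 j, j \in s & L j x) ->
  (forall j, j \in s -> lcs (L j)) -> lcs K.
Proof.
move=> hK hL; have [n hn] : exists n, forall j, j \in s -> lc n (L j).
  by apply: uniform_bound hL => j a b ab; exact: lc_le.
exists n => x y xy /hK[j js Lj]; apply/hK; exists j => //.
exact: hn Lj.
Qed.

End LocallyConstantSets.

Section EtaleBasis.
Variables (B : bratteli) (G : toprel (ipath B)) (eG : etale_basis G).
Implicit Types (g h : gpd G) (x y : ipath B) (P : set (ipath B * ipath B)).

Lemma gpair_rgsc g : gpair g = (rg g, sc g).
Proof. exact: surjective_pairing. Qed.

Lemma gpd_of P x y : er_base G P -> P (x, y) -> exists g, gpair g = (x, y).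
Proof. by move=> bP Pxy; exists (Gpd (eb_sub eG bP Pxy)). Qed.

(** The family [er_base] generates the topology only as a subbasis. By [eb_germ] one basic set
    through g lies in another near g, and [eb_small] cuts it down accordingly; so finite
    intersections can be replaced by single basic sets. *)
Lemma open_gpdP (W : set (gpd G)) g : open W -> W g ->
  exists P, [/\ er_base G P, P (gpair g) & forall h, P (gpair h) -> W h].
Proof.
move=> [D' sD' <-] [A D'A Ag].
have [S hS defA] := sD' _ D'A.
suff [P [bP Pg hP]] : exists P, [/\ er_base G P, P (gpair g) &
    forall C, C \in (S : seq _) -> forall h, P (gpair h) -> C (gpair h)].
  exists P; split=> // h Ph; exists A => //.
  by apply: (eq_ind _ (fun Z : set (gpd G) => Z h) _ _ defA) => C /= hC; exact: hP hC h Ph.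
have {}hS : forall C, C \in (S : seq _) -> er_base G C /\ C (gpair g).
  move=> C hC; split; first by have := hS C hC; rewrite inE.
  by move: Ag; rewrite -defA => /(_ C hC).
elim: (S : seq _) hS => [|C s IH] hS.
  by have [P bP Pg] := eb_cov eG (gpairP g); exists P.
have [|P [bP Pg hP]] := IH; first by move=> D hD; apply: hS; rewrite in_cons hD orbT.
have [bC Cg] := hS C (mem_head _ _).
rewrite gpair_rgsc in Pg Cg *.
have [n hn] := eb_germ eG bP bC Pg Cg.
have [P' [bP' P'g hP']] := eb_small eG n bP Pg.
exists P'; split=> // D; rewrite in_cons => /orP[/eqP ->|hD] h; rewrite !gpair_rgsc => /hP'[Ph xh _].
  exact: hn.
by rewrite -gpair_rgsc; apply: hP hD _ _; rewrite gpair_rgsc.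
Qed.

Lemma open_base P : er_base G P -> open [set g : gpd G | P (gpair g)].
Proof.
move=> bP; exists [set [set g : gpd G | P (gpair g)]]; last by rewrite bigcup_set1.
by move=> _ ->; exact: (@finI_from1 _ _ (er_base G) (fun U => [set g | U (gpair g)])).
Qed.

Lemma open_gpd_local (W : set (gpd G)) :
  (forall g, W g -> exists P, [/\ er_base G P, P (gpair g) &
     forall h, P (gpair h) -> W h]) -> open W.
Proof.
move=> hW; rewrite openE => g /hW[P [bP Pg hP]]; rewrite /interior nbhsE.
by exists [set g | P (gpair g)] => //; split=> //; exact: open_base.
Qed.

Lemma open_rg (O : set (ipath B)) : lcs O -> open [set g : gpd G | O (rg g)].
Proof.
move=> [n hO]; apply: open_gpd_local => g Og.
have [P bP] := eb_cov eG (gpairP g); rewrite gpair_rgsc => Pg.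
have [P' [bP' P'g hP']] := eb_small eG n bP Pg.
by exists P'; split=> // h; rewrite gpair_rgsc => /hP'[_ xh _]; exact: hO Og.
Qed.

Lemma open_sc (O : set (ipath B)) : lcs O -> open [set g : gpd G | O (sc g)].
Proof.
move=> [n hO]; apply: open_gpd_local => g Og.
have [P bP] := eb_cov eG (gpairP g); rewrite gpair_rgsc => Pg.
have [P' [bP' P'g hP']] := eb_small eG n bP Pg.
by exists P'; split=> // h; rewrite gpair_rgsc => /hP'[_ _ xh]; exact: hO Og.
Qed.

(** Two arrows of a relation differ in range or in source, and both maps are continuous into the
    path space. The property is needed to know that compact bisections are closed, so that their
    indicators lie in C_c. *)
Lemma hausdorff_gpd : hausdorff_space (gpd G).
Proof.
rewrite open_hausdorff => g h; apply: contra_neqP => hgh.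
suff e : rg g = rg h /\ sc g = sc h.
  by apply: gpd_eq; rewrite !gpair_rgsc; case: e => -> ->.
split; apply: agree_all => n; apply: contrapT => nxy; apply: hgh.
  exists ([set k | agree n (rg g) (rg k)], [set k | agree n (rg h) (rg k)]).
    by rewrite !inE.
  split; try exact: open_rg (lcs_agree n _).
  apply/eqP/seteqP; split=> // k [/= xz yz]; apply: nxy.
  exact: agree_trans xz (agree_sym yz).
exists ([set k | agree n (sc g) (sc k)], [set k | agree n (sc h) (sc k)]).
  by rewrite !inE.
split; try exact: open_sc (lcs_agree n _).
apply/eqP/seteqP; split=> // k [/= xz yz]; apply: nxy.
exact: agree_trans xz (agree_sym yz).
Qed.

(** For compactness, a filter on the bisection is pushed by the range map to the compact set O. A
    cluster point x of the image lifts to the unique arrow g over x, and g is a cluster point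
    because any basic set around g contains the arrows of P with range near x. *)
Lemma co_bisection_base P (O : set (ipath B)) : er_base G P -> lcs O ->
  (forall x, O x -> exists y, P (x, y)) ->
  [/\ co_bisection [set g : gpd G | P (gpair g) /\ O (rg g)],
      rg @` [set g : gpd G | P (gpair g) /\ O (rg g)] = O &
      sc @` [set g : gpd G | P (gpair g) /\ O (rg g)] = im P O].
Proof.
move=> bP lO dO; set U := [set g | _].
have inj_rg g h : U g -> U h -> rg g = rg h -> g = h.
  move=> [Pg _] [Ph _] e; apply: gpd_eq; rewrite !gpair_rgsc in Pg Ph *.
  by rewrite e in Pg *; congr pair; exact: (eb_fun eG bP Pg Ph).
have rgU x : O x -> exists2 g, U g & rg g = x.
  move=> Ox; have [y Pxy] := dO x Ox; have [g hg] := gpd_of bP Pxy.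
  by exists g; rewrite /U /= /rg hg.
split; first split.
- move=> F FF FU.
  have [x [Ox clx]] : O `&` cluster (fmap (@rg _ G) F) !=set0.
    have [n hO] := lO; apply: (lc_compact hO).
    by change (F (@rg _ G @^-1` O)); apply: (filterS _ FU) => g [].
  have [g Ug gx] := rgU x Ox; exists g; split=> // A W FA; rewrite nbhsE => -[V [oV Vg] VW].
  have [P' [bP' P'g hP']] := open_gpdP oV Vg.
  rewrite gpair_rgsc in P'g; have Pg : P (rg g, sc g) by rewrite -gpair_rgsc; case: Ug.
  have [n hn] := eb_germ eG bP bP' Pg P'g.
  have [||_ [[h [Ah Uh] <-] hz]] := clx (@rg _ G @` (A `&` U)) (cyl (initial x n)).
  + by change (F (@rg _ G @^-1` (@rg _ G @` (A `&` U)))); apply: filterS (filterI FA FU) => h Uh;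
      exists h.
  + by rewrite nbhsE; exists (cyl (initial x n)) => //; split;
      [exact: open_cyl (in_E_initial x n)|exact/starts_initial_agree].
  exists h; split=> //; apply/VW/hP'; rewrite gpair_rgsc; apply: hn.
    by rewrite gx; exact/starts_initial_agree.
  by rewrite -gpair_rgsc; case: Uh.
- exact: openI (open_base bP) (open_rg lO).
- by move=> g h; rewrite !inE; exact: inj_rg.
- move=> g h; rewrite !inE => -[Pg _] [Ph _] e; apply: gpd_eq; rewrite !gpair_rgsc in Pg Ph *.
  by rewrite e in Pg *; congr pair; exact: (eb_inj eG bP Pg Ph).
- apply/seteqP; split=> [x [g [_ Og] <-] //|x /rgU[g Ug <-]].
  by exists g.
- apply/seteqP; split=> [y [g [Pg Og] <-]|y [x Ox Pxy]].
    by exists (rg g) => //; rewrite -gpair_rgsc.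
  have [g hg] := gpd_of bP Pxy.
  by exists g; rewrite /U /= /rg /sc hg.
Qed.

Lemma coboundary_ind (U : set (gpd G)) x : set_inj U rg -> set_inj U sc ->
  coboundary (ind U) x = ind (sc @` U) x - ind (rg @` U) x.
Proof.
move=> ir is_; rewrite /coboundary.
rewrite (@fsum_pieces _ _ _ unit [:: tt] (fun=> 1) (fun=> U)); first last.
- by move=> [] g h _ /= eg eh Ug Uh; apply: is_; rewrite ?inE // eg eh.
- by move=> g _; rewrite big_cons big_nil addr0 mul1r.
rewrite (@fsum_pieces _ _ _ unit [:: tt] (fun=> 1) (fun=> U)); first last.
- by move=> [] g h _ /= eg eh Ug Uh; apply: ir; rewrite ?inE // eg eh.
- by move=> g _; rewrite big_cons big_nil addr0 mul1r.
rewrite !big_cons !big_nil !addr0 !mul1r /ind.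
congr (_ - _); apply: asboolZ.
  by split=> [[g [e Ug]]|[g Ug e]]; exists g.
by split=> [[g [e Ug]]|[g Ug e]]; exists g.
Qed.

Variables (hB : has_successors B) (A : zmodType) (m : nat -> bvert B -> A).
Hypotheses (hm : harmonic m) (pG : preserves m G).

(** The support of k is cut into finitely many disjoint clopen pieces of basic bisections on which k
    is constant. Each piece contributes a multiple of the indicator of its source minus that of its
    range, and this has integral 0 by [pG]. Openness is required only over nonzero values, so that
    [ind U] is covered before U is known to be closed. *)
Lemma Int_coboundary (k : gpd G -> int) :
  (forall n, n != 0 -> open (k @^-1` [set n])) -> compact [set g | k g != 0] ->
  Int m (coboundary k) = 0.
Proof.
move=> ok ck.
have piece g : k g != 0 -> exists PO : set (ipath B * ipath B) * set (ipath B),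
    [/\ er_base G PO.1, PO.1 (gpair g), PO.2 (rg g), lcs PO.2 &
      [/\ forall h, PO.1 (gpair h) -> k h = k g,
        forall x, PO.2 x -> exists y, PO.1 (x, y),
        forall K, lcs K -> K `<=` PO.2 -> lcs (im PO.1 K) &
        forall K, lcs K -> K `<=` PO.2 -> mu m K = mu m (im PO.1 K)]].
  move=> kg; have [P [bP Pg hP]] := open_gpdP (ok _ kg) (erefl (k g)).
  rewrite gpair_rgsc in Pg *.
  have [n1 h1] := eb_dom eG bP Pg.
  have [n2 h2] := eb_im eG bP Pg.
  have [n3 h3] := pG bP Pg.
  pose n := maxn n1 (maxn n2 n3).
  exists (P, [set x | agree n (rg g) x]); split=> //=; first exact: lcs_agree.
  split=> [h /hP //|x xy|K lK hK|K lK hK].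
  - by apply: h1; exact: agree_maxl xy.
  - apply: h2 => // x /hK; apply: agree_le.
    by rewrite /n (leq_trans _ (leq_maxr _ _)) // leq_maxl.
  - apply: h3 => // x /hK; apply: agree_le.
    by rewrite /n (leq_trans _ (leq_maxr _ _)) // leq_maxr.
pose PO g := if pselect (k g != 0) is left h then projT1 (cid (piece g h)) else (set0, set0).
have POP g (kg : k g != 0) : [/\ er_base G (PO g).1, (PO g).1 (gpair g), (PO g).2 (rg g), lcs (PO g).2 &
      [/\ forall h, (PO g).1 (gpair h) -> k h = k g,
        forall x, (PO g).2 x -> exists y, (PO g).1 (x, y),
        forall K, lcs K -> K `<=` (PO g).2 -> lcs (im (PO g).1 K) &
        forall K, lcs K -> K `<=` (PO g).2 -> mu m K = mu m (im (PO g).1 K)]].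
  by rewrite /PO; case: pselect => // kg'; exact: projT2 (cid (piece g kg')).
pose U g := [set h : gpd G | (PO g).1 (gpair h) /\ (PO g).2 (rg h)].
have [s [sk hs]] : exists s : seq (gpd G), (forall g, g \in s -> k g != 0) /\ forall g, k g != 0 -> exists2 t, t \in s & U t g.
  apply: compact_finite_cover ck _ => g /= kg.
  have [bP Pg Og lO _] := POP g kg.
  rewrite nbhsE; exists (U g) => //; split=> //.
  exact: openI (open_base bP) (open_rg lO).
(* The cover is made disjoint one set at a time: from the domain of the new piece one removes the
   set D of those x whose arrow already belongs to a set of the remaining list. The work is to see
   that D is clopen. *)
have [l [lk l1]] : exists l : seq (gpd G * set (ipath B)),
    (forall a, a \in l -> [/\ k a.1 != 0, lcs a.2 & a.2 `<=` (PO a.1).2]) /\ forall h, \sum_(a <- l) ind [set g | (PO a.1).1 (gpair g) /\ a.2 (rg g)] h =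
      (`[< exists2 t, t \in s & U t h >])%:Z.
  elim: s sk {hs} => [|t s IH] sk.
    exists [::]; split=> // h; rewrite big_nil asboolF // => -[].
    by [].
  have [|l [lk l1]] := IH; first by move=> g gs; apply: sk; rewrite in_cons gs orbT.
  have kt := sk t (mem_head _ _).
  have [bP Pt Ot lO [hk hO him hmu]] := POP t kt.
  pose D := [set x | exists2 u, u \in s & exists y,
    [/\ (PO t).1 (x, y), (PO u).1 (x, y), (PO t).2 x & (PO u).2 x]].
  have lD : lcs D.
    apply: (@lcs_bigU _ _ s _ (fun u => [set x | exists y,
      [/\ (PO t).1 (x, y), (PO u).1 (x, y), (PO t).2 x & (PO u).2 x]])) => // u us.
    have ku : k u != 0 by apply: sk; rewrite in_cons us orbT.
    have [bP' Pu Ou lO' [hk' hO' him' hmu']] := POP u ku.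
    apply: lcs_local => x.
    have lI := lcsI lO lO'; have [n hn] := lI.
    have [[Ox O'x]|nO] := pselect (((PO t).2 `&` (PO u).2) x); last first.
      exists n => y xy; split=> [[z [_ _ Ox O'x]]|[z [_ _ Oy O'y]]].
        by case: nO.
      by case: nO; apply: hn (agree_sym xy) _.
    have [y Pxy] := hO _ Ox; have [y' P'xy] := hO' _ O'x.
    have [e|ne] := pselect (y = y').
      subst y'; have [n1 h1] := eb_germ eG bP bP' Pxy P'xy.
      exists (maxn n n1) => z xz.
      have [Oz O'z] : ((PO t).2 `&` (PO u).2) z.
        by apply: (hn x z) => //; exact: agree_maxl xz.
      split=> _; last by exists y.
      have [y1 Pz] := hO _ Oz; exists y1; split=> //.
      by apply: h1 Pz; exact: agree_maxr xz.
    (* The two basic sets send x to different points. These differ up to level N, and by continuity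
       the images of nearby points differ as well, so D contains no point near x on account of u. *)
    have [N yy'] : exists N, ~ agree N y y'.
      by apply/existsNP => h; apply: ne; exact: agree_all.
    have cont P z : er_base G P -> P (x, z) -> exists n, forall x' z',
        agree n x x' -> P (x', z') -> agree N z z'.
      move=> bQ Qxz; have [Q' [bQ' Q'xz hQ']] := eb_small eG N bQ Qxz.
      have [n1 h1] := eb_germ eG bQ bQ' Qxz Q'xz.
      by exists n1 => x' z' xx' /(h1 _ _ xx')/hQ'[].
    have [n1 h1] := cont _ _ bP Pxy; have [n2 h2] := cont _ _ bP' P'xy.
    exists (maxn n1 n2) => z xz; split=> [[w [Pxw P'xw _ _]]|[w [Pzw P'zw _ _]]].
      by case: ne; rewrite (eb_fun eG bP Pxy Pxw) (eb_fun eG bP' P'xy P'xw).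
    case: yy'; apply: (@agree_trans _ _ _ w).
      by apply: h1 Pzw; exact: agree_maxl xz.
    by apply: agree_sym; apply: h2 P'zw; exact: agree_maxr xz.
  exists ((t, (PO t).2 `&` ~` D) :: l); split=> [a|h].
    rewrite in_cons => /orP[/eqP ->|/lk//]; split=> //=.
    exact: lcsI lO (lcsC lD).
  rewrite big_cons l1 /ind /=.
  have [[u us Uu]|nU] := pselect (exists2 t, t \in s & U t h).
    rewrite [X in _ + X]/= asboolF ?add0r; last first.
      move=> [Ph [Oh nD]]; apply: nD; exists u => //; exists (sc h).
      by rewrite -gpair_rgsc; case: Uu.
    by rewrite !asboolT //; exists u => //; rewrite in_cons us orbT.
  rewrite (asboolF nU) addr0; apply: asboolZ; split.
    by move=> [Ph [Oh _]]; exists t; [exact: mem_head|].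
  move=> [u]; rewrite in_cons => /orP[/eqP -> [Ph Oh]|us Uu]; last by case: nU; exists u.
  split=> //; split=> // -[v vs [y [Pty Pvy Oty Ovy]]]; case: nU; exists v => //.
  rewrite gpair_rgsc in Ph; split=> //.
  by rewrite gpair_rgsc (eb_fun eG bP Ph Pty).
pose c (a : gpd G * set (ipath B)) := k a.1.
pose E (a : gpd G * set (ipath B)) := [set g : gpd G | (PO a.1).1 (gpair g) /\ a.2 (rg g)].
have kE g : k g = \sum_(a <- l) c a * ind (E a) g.
  have [kg|kg] := eqVneq (k g) 0.
    rewrite kg big1_seq // => a /andP[_ al]; have [ka la sa] := lk a al.
    rewrite /ind asboolF ?mulr0 // => -[Pg Og]; have [_ _ _ _ [hk _ _ _]] := POP _ ka.
    by move: ka; rewrite -(hk g Pg) kg eqxx.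
  rewrite (eq_big_seq (fun a => k g * ind (E a) g)) => [|a al]; last first.
    have [ka la sa] := lk a al; have [_ _ _ _ [hk _ _ _]] := POP _ ka.
    rewrite /ind; case: asboolP => [[Pg Og]|_]; last by rewrite !mulr0.
    by rewrite /c (hk g Pg).
  by rewrite -mulr_sumr l1 asboolT ?mulr1 //; exact: hs.
(* An arrow (x, y) has range x and source y: summing over the arrows with a given source sees the
   image of [a.2], summing over those with a given range sees [a.2] itself. *)
have -> : coboundary k = fun x => \sum_(a <- l) c a * (ind (im (PO a.1).1 a.2) x - ind a.2 x).
  apply/funext => x; rewrite /coboundary.
  rewrite (@fsum_pieces _ _ _ _ l c E); first last.
  - move=> a g h al /= eg eh [Pg _] [Ph _]; apply: gpd_eq.
    have [/POP[bP _ _ _ _] _ _] := lk a al.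
    by rewrite !gpair_rgsc eg eh in Pg Ph *; congr pair; exact: (eb_inj eG bP Pg Ph).
  - by move=> g _; exact: kE.
  rewrite (@fsum_pieces _ _ _ _ l c E); first last.
  - move=> a g h al /= eg eh [Pg _] [Ph _]; apply: gpd_eq.
    have [/POP[bP _ _ _ _] _ _] := lk a al.
    by rewrite !gpair_rgsc eg eh in Pg Ph *; congr pair; exact: (eb_fun eG bP Pg Ph).
  - by move=> g _; exact: kE.
  rewrite -sumrB; apply: eq_big_seq => a al; rewrite -mulrBr; congr (_ * _).
  have [/POP[bP _ _ _ [_ hO _ _]] la sa] := lk a al.
  rewrite /ind; congr (_ - _); apply: asboolZ; split.
  - by move=> [g [/= <- [Pg Og]]]; exists (rg g) => //; rewrite -gpair_rgsc.
  - move=> [y ay Pyx]; have [g hg] := gpd_of bP Pyx; exists g.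
    by rewrite /E /= /sc /rg hg.
  - by move=> [g [/= <- [Pg Og]]].
  move=> ax; have [y Pxy] := hO x (sa x ax).
  have [g hg] := gpd_of bP Pxy; exists g.
  by rewrite /E /= /sc /rg hg.
have dd a : a \in l -> exists n, det n (fun x => ind (im (PO a.1).1 a.2) x - ind a.2 x) /\ (det n (ind (im (PO a.1).1 a.2)) /\ det n (ind a.2)).
  move=> al; have [/POP[bP _ _ _ [_ hO him _]] la sa] := lk a al.
  have [n1 h1] := la; have [n2 h2] := him _ la sa.
  exists (maxn n1 n2); rewrite andC; split.
    split; first by apply: det_ind; apply: lc_le h2; exact: leq_maxr.
    by apply: det_ind; apply: lc_le h1; exact: leq_maxl.
  move=> x y xy; rewrite (det_ind (lc_le (leq_maxr n1 n2) h2) xy).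
  by rewrite (det_ind (lc_le (leq_maxl n1 n2) h1) xy).
rewrite (Int_sum hB hm) => [|a /dd[n [dn _]]]; last first.
  by exists n => x y xy; rewrite (dn _ _ xy).
rewrite big1_seq // => a /andP[_ al].
have [n [dn [d1 d2]]] := dd a al.
rewrite (IntZ hB hm _ dn) (IntB hB hm d1 d2).
have [/POP[bP _ _ _ [_ _ _ hmu]] la sa] := lk a al.
by rewrite -/(mu m (im _ _)) -/(mu m a.2) (hmu _ la sa) subrr mul0rz.
Qed.

End EtaleBasis.

Definition copen_of (X : topologicalType) (K : set X) : copen X :=
  if pselect (compact K /\ open K) is left h then COpen h else copen0 X.

Lemma copen_ofE (B : bratteli) (K : set (ipath B)) : lcs K -> cset (copen_of K) = K.
Proof. by move=> [n /lc_copen h]; rewrite /copen_of; case: pselect. Qed.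

(** * The type semigroup and H_0 *)

Section Words.
Variable B : bratteli.
Implicit Types (p q : bpath B) (x y : ipath B) (K L : set (ipath B)).
Implicit Types (a b : word (ipath B)).

Definition indw a x : int := \sum_(K <- a) ind K x.

Definition lc_word n a := forall K : copen (ipath B), K \in a -> lc n K.

Lemma lc_word_le n m a : (n <= m)%N -> lc_word n a -> lc_word m a.
Proof. by move=> nm h K /h; exact: lc_le. Qed.

Lemma lc_wordP a : exists n, lc_word n a.
Proof.
apply: (uniform_bound (P := fun (K : copen (ipath B)) n => lc n K)).
  by move=> K n m; exact: lc_le.
by move=> K _; exact: copen_lc.
Qed.

Lemma det_indw n a : lc_word n a -> det n (indw a).
Proof. by move=> h; apply: det_sum => K /h; exact: det_ind. Qed.

Lemma indw_cat a b x : indw (a ++ b) x = indw a x + indw b x.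
Proof. by rewrite /indw big_cat. Qed.

Definition meets K p : bool := `[< exists x, starts p x /\ K x >].

Lemma meetsE n K p x : lc n K -> in_E 0 n p -> starts p x -> meets K p <-> K x.
Proof.
move=> hK hp hx; split=> [/asboolP[y [hy Ky]]|Kx]; last by apply/asboolP; exists x.
apply: hK Ky; rewrite /agree.
by move/(starts_initial y hp): hy => ->; move/(starts_initial x hp): hx => ->.
Qed.

Lemma meets_prcons n K p eu : has_successors B -> lc n K -> in_E 0 n p ->
  eu \in outs n (pend p) -> meets K (prcons p eu) = meets K p.
Proof.
move=> hB hK hp heu; have hpe : in_E 0 n.+1 (prcons p eu) by rewrite in_E_prcons hp.
have [x hx] := in_E_starts hB hpe.
have [hx' _] := iffLR (starts_prcons _ _ hp) hx.
apply/idP/idP => h.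
  by apply/(meetsE hK hp hx'); apply/(meetsE (lc_le (leqnSn n) hK) hpe hx).
by apply/(meetsE (lc_le (leqnSn n) hK) hpe hx); apply/(meetsE hK hp hx').
Qed.

Lemma lc_cyls n K : lc n K -> forall x,
  K x <-> exists2 p, p \in [seq p <- paths B n | meets K p] & cyl p x.
Proof.
move=> hK x; split=> [Kx|[p]].
  exists (initial x n); last exact/starts_initial_agree.
  rewrite mem_filter in_paths_initial andbT; apply/asboolP.
  by exists x; split=> //; exact/starts_initial_agree.
by rewrite mem_filter mem_paths => /andP[h hp] hx; apply/(meetsE hK hp hx).
Qed.

Lemma cyl_disjoint n x p q : p \in paths B n -> q \in paths B n ->
  cyl p x -> cyl q x -> p = q.
Proof.
by rewrite !mem_paths => hp hq /(starts_initial x hp) <- /(starts_initial x hq).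
Qed.

Lemma mu_lc (hB : has_successors B) (A : zmodType) (m : nat -> bvert B -> A) n K :
  harmonic m -> lc n K ->
  mu m K = \sum_(p <- paths B n | meets K p) m n (pend p).
Proof.
move=> hm hK; rewrite (mu_bigU hB hm (filter_uniq _ (uniq_paths B n)) (lc_cyls hK)).
- rewrite -[RHS]big_filter; apply: eq_big_seq => p.
  by rewrite mem_filter mem_paths => /andP[_ hp]; exact: mu_cyl.
- move=> x p q; rewrite !mem_filter => /andP[_ hp] /andP[_ hq].
  exact: (cyl_disjoint hp hq).
- move=> p; rewrite mem_filter mem_paths => /andP[_ hp].
  by exists n; exact: lc_cyl.
Qed.

(** The vector of Z_+^{V_n} that a word defines once all its sets are unions of cylinders of level
    n. *)
Definition cnt n a (v : bvert B) : nat :=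
  (\sum_(K <- a) \sum_(p <- paths B n | pend p == v) meets K p)%N.

Lemma sum_by_vertex (A : nmodType) n K (F : bvert B -> A) :
  \sum_(p <- paths B n | meets K p) F (pend p) =
  \sum_(v <- vlev B n) F v *+ (\sum_(p <- paths B n | pend p == v) meets K p)%N.
Proof.
transitivity (\sum_(p <- paths B n) \sum_(v <- vlev B n | pend p == v) F v *+ meets K p).
  rewrite big_mkcond; apply: eq_big_seq => p; rewrite mem_paths => hp.
  rewrite (big_rem (pend p)) ?(in_E_vlev hp) //= eqxx big1_seq; last first.
    by move=> v /andP[/eqP <-]; rewrite mem_rem_uniq ?fset_uniq // !inE eqxx.
  by rewrite addr0; case: meets; rewrite ?mulr1n ?mulr0n.
rewrite (exchange_big_dep predT) //=; apply: eq_bigr => v _.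
rewrite -sumrMnr; exact: eq_bigr.
Qed.

Lemma sum_cnt (A : nmodType) n a (F : bvert B -> A) :
  \sum_(K <- a) \sum_(p <- paths B n | meets K p) F (pend p) =
  \sum_(v <- vlev B n) F v *+ cnt n a v.
Proof.
under eq_bigr do rewrite sum_by_vertex.
by rewrite exchange_big /=; apply: eq_bigr => v _; rewrite -sumrMnr.
Qed.

Lemma cnt_refine n a w : has_successors B -> lc_word n a -> w \in vlev B n.+1 ->
  cnt n.+1 a w = (\sum_(v <- vlev B n) cnt n a v * #|` elab n v w|)%N.
Proof.
move=> hB ha hw.
(* The number of edges towards w, as a function of the end vertex, is summed once over paths and
   once over vertices. *)
have := @sum_cnt nat n a (fun v => #|` elab n v w|).
under [RHS]eq_bigr do rewrite -mulr_natl.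
move=> h; transitivity (\sum_(v <- vlev B n) (cnt n a v)%:R * #|` elab n v w|)%R; last first.
  by apply: eq_bigr => v _; rewrite natn.
rewrite -h /cnt; apply: eq_big_seq => K Ka; rewrite big_mkcond big_paths_succ.
rewrite [RHS]big_mkcond; apply: eq_big_seq => p; rewrite mem_paths => hp.
transitivity (\sum_(eu <- outs n (pend p)) (if eu.2 == w then nat_of_bool (meets K p) else 0%N)).
  by apply: eq_big_seq => eu heu; rewrite pend_prcons (meets_prcons hB (ha K Ka) hp heu).
rewrite (big_outs n (pend p) (fun u => if u == w then nat_of_bool (meets K p) else 0%N)).
rewrite (big_rem w) //= eqxx big1_seq; last first.
  move=> u /andP[_]; rewrite mem_rem_uniq ?fset_uniq // !inE => /andP[/negPf -> _].
  by rewrite mul0rn.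
by rewrite addr0; case: meets; rewrite ?natn ?mul0rn.
Qed.

Definition wmu (A : zmodType) (m : nat -> bvert B -> A) a : A := \sum_(K <- a) mu m K.

Lemma Int_indw (hB : has_successors B) (A : zmodType) (m : nat -> bvert B -> A) a :
  harmonic m -> Int m (indw a) = wmu m a.
Proof.
move=> hm; rewrite /indw (Int_sum hB hm) // => K Ka.
by have [n h] := copen_lc K; exists n; exact: det_ind.
Qed.

Lemma wmu_cnt (hB : has_successors B) (A : zmodType) (m : nat -> bvert B -> A) n a :
  harmonic m -> lc_word n a ->
  wmu m a = \sum_(v <- vlev B n) m n v *+ cnt n a v.
Proof.
move=> hm ha; rewrite -sum_cnt; apply: eq_big_seq => K /ha hK.
exact: mu_lc.
Qed.

End Words.

Section TypeSemigroupLift.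
Local Open Scope quotient_scope.
Variables (B : bratteli) (G : toprel (ipath B)).
Implicit Types (p q : bpath B) (x y : ipath B) (K L : set (ipath B)).
Implicit Types (a b : word (ipath B)).
Local Notation S := (tsemi G).

Lemma cls_copen (K : copen (ipath B)) : cls G K = \pi_S [:: K].
Proof.
rewrite /cls; case: pselect => [h|]; last by case; exact: copenP.
by congr (\pi_S [:: _]); case: K h => K k h; congr COpen; exact: Prop_irrelevance.
Qed.

Lemma lcs_copen K : lcs K -> exists K' : copen (ipath B), K = K'.
Proof. by move=> [n /lc_copen h]; exists (COpen h). Qed.

Lemma piD a b : \pi_S (a ++ b) = \pi_S a + \pi_S b.
Proof. by rewrite -ts_addqE. Qed.

Lemma pi_word a : \pi_S a = \sum_(K <- a) cls G K.
Proof.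
elim: a => [|K a IH]; first by rewrite big_nil.
by rewrite big_cons -IH cls_copen -piD.
Qed.

Lemma cls0 : cls G set0 = 0.
Proof. by rewrite (cls_copen (copen0 _)); apply: ts_piP; exact: ts_zero. Qed.

Lemma clsU K L : lcs K -> lcs L -> K `&` L = set0 ->
  cls G (K `|` L) = cls G K + cls G L.
Proof.
move=> lK lL KL; have lU := lcsU lK lL.
have [U eU] := lcs_copen lU; have [K' eK] := lcs_copen lK; have [L' eL] := lcs_copen lL.
rewrite eU eK eL !cls_copen -piD; apply/esym/ts_piP; apply: ts_disjoint.
  by rewrite -eK -eL.
by rewrite -eU eK eL.
Qed.

Lemma cls_bigU (J : eqType) (s : seq J) K (L : J -> set (ipath B)) :
  uniq s -> (forall x, K x <-> exists2 j, j \in s & L j x) ->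
  (forall x i j, i \in s -> j \in s -> L i x -> L j x -> i = j) ->
  (forall j, j \in s -> lcs (L j)) ->
  cls G K = \sum_(j <- s) cls G (L j).
Proof.
elim: s K => [|j s IH] K.
  move=> _ hK _ _; rewrite big_nil (_ : K = set0) ?cls0 //.
  by apply/seteqP; split=> // x /hK[].
move=> /= /andP[js us] hK hd hl; rewrite big_cons.
have hs i : i \in s -> i \in j :: s by move=> h; rewrite in_cons h orbT.
pose U := [set x | exists2 i, i \in s & L i x].
rewrite -(IH U) //; first rewrite -clsU.
- congr (cls G _); apply/seteqP; split=> [x /hK[i]|x [Lj|[i si Li]]].
  + by rewrite in_cons => /orP[/eqP ->|si Li]; [left|right; exists i].
  + by apply/hK; exists j => //; exact: mem_head.
  by apply/hK; exists i => //; exact: hs.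
- exact: hl (mem_head _ _).
- by apply: (@lcs_bigU _ _ s U L) => // i /hs/hl.
- apply/seteqP; split=> // x [Lj [i si Li]].
  by move: js; rewrite (hd x j i (mem_head _ _) (hs _ si) Lj Li) si.
- by move=> x i k /hs hi /hs hk; exact: hd hi hk.
by move=> i /hs/hl.
Qed.

Lemma cls_lc n K : lc n K ->
  cls G K = \sum_(p <- paths B n | meets K p) cls G (cyl p).
Proof.
move=> hK; rewrite (cls_bigU (filter_uniq _ (uniq_paths B n)) (lc_cyls hK)).
- by rewrite big_filter.
- move=> x p q; rewrite !mem_filter => /andP[_ hp] /andP[_ hq].
  exact: (cyl_disjoint hp hq).
- move=> p; rewrite mem_filter mem_paths => /andP[_ hp].
  by exists n; exact: lc_cyl.
Qed.

(** A clopen set is a finite disjoint union of cylinders, so the values on cylinders determine an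
    additive map. This is what allows the final statement to speak of every alpha and beta with the
    prescribed values. *)
Lemma additive_wmu (hB : has_successors B) (A : zmodType) (m : nat -> bvert B -> A)
    (theta : {additive S -> A}) a : harmonic m ->
  (forall n p, in_E 0 n p -> theta (cls G (cyl p)) = m n (pend p)) ->
  theta (\pi_S a) = wmu m a.
Proof.
move=> hm ht; have [n ha] := lc_wordP a.
rewrite pi_word raddf_sum /=; apply: eq_big_seq => K /ha hK.
rewrite (cls_lc hK) raddf_sum (mu_lc hB hm hK) -big_filter -[RHS]big_filter.
apply: eq_big_seq => p; rewrite mem_filter mem_paths => /andP[_].
exact: ht.
Qed.

Hypothesis tail_cls : forall n p q, in_E 0 n p -> in_E 0 n q -> pend p = pend q ->
  cls G (cyl p) = cls G (cyl q).

(** The class shared by all cylinders of paths ending at v; 0 is a default for a vertex that no path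
    reaches. *)
Definition vcls n (v : bvert B) : S :=
  if pselect (exists p, in_E 0 n p /\ pend p = v) is left h
  then cls G (cyl (projT1 (cid h))) else 0.

Lemma vclsE n p : in_E 0 n p -> cls G (cyl p) = vcls n (pend p).
Proof.
move=> hp; rewrite /vcls; case: pselect => [h|]; last by case; exists p.
by case: (cid h) => q /= [hq e]; exact: (tail_cls hp hq (esym e)).
Qed.

Lemma pi_cnt n a : lc_word n a -> \pi_S a = \sum_(v <- vlev B n) vcls n v *+ cnt n a v.
Proof.
move=> ha; rewrite -sum_cnt pi_word; apply: eq_big_seq => K /ha hK.
rewrite (cls_lc hK) -big_filter -[RHS]big_filter; apply: eq_big_seq => p.
by rewrite mem_filter mem_paths => /andP[_]; exact: vclsE.
Qed.

End TypeSemigroupLift.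

Section Lifts.
Local Open Scope quotient_scope.
Variables (B : bratteli) (G : toprel (ipath B)) (eG : etale_basis G).
Variables (hB : has_successors B) (A : zmodType) (m : nat -> bvert B -> A).
Hypotheses (hm : harmonic m) (pG : preserves m G).
Implicit Types (a b : word (ipath B)).

(** The coboundary of the indicator of U is the indicator of its source minus that of its range. *)
Lemma mu_bisection (U : set (gpd G)) (K L : copen (ipath B)) :
  co_bisection U -> cset K = sc @` U -> cset L = rg @` U -> mu m K = mu m L.
Proof.
move=> [cU oU ir is_] eK eL.
have [[nK hK] [nL hL]] := (copen_lc K, copen_lc L).
pose n := maxn nK nL.
have dK : det n (ind K) by apply: det_ind; apply: lc_le hK; exact: leq_maxl.
have dL : det n (ind L) by apply: det_ind; apply: lc_le hL; exact: leq_maxr.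
apply/eqP; rewrite -subr_eq0 -(IntB hB hm dK dL); apply/eqP.
rewrite -[RHS](@Int_coboundary _ _ eG hB _ m hm pG (ind U)).
- by congr Int; apply/funext => x; rewrite coboundary_ind // eK eL.
- move=> k k0; have [->|k1] := eqVneq k 1.
    rewrite (_ : _ @^-1` _ = U) //; apply/seteqP; split=> g /=; rewrite /ind.
      by case: asboolP.
    by move=> Ug; rewrite asboolT.
  rewrite (_ : _ @^-1` _ = set0); first exact: open0.
  apply/seteqP; split=> g //=; rewrite /ind; case: asboolP => _ e; move: k0 k1;
    by rewrite -e eqxx.
rewrite (_ : [set g | _] = U) //; apply/seteqP; split=> g /=; rewrite /ind.
  by case: asboolP.
by move=> Ug; rewrite asboolT.
Qed.

Lemma mu_set0 : mu m set0 = 0.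
Proof.
rewrite /mu (_ : ind set0 = fun=> 0) ?(Int0 hB hm) //.
by apply/funext => x; rewrite /ind asboolF.
Qed.

Lemma muU (K L M : set (ipath B)) : lcs K -> lcs L -> K `&` L = set0 ->
  M = K `|` L -> mu m M = mu m K + mu m L.
Proof.
move=> lK lL KL ->.
rewrite (@mu_bigU _ hB _ m hm bool [:: true; false] _ (fun c : bool => if c then K else L)) //.
- by rewrite !big_cons big_nil addr0.
- by move=> x; split=> [[Kx|Lx]|[[] _ h]]; [exists true|exists false|left|right].
- move=> x [] [] // _ _ h h'; suff: (K `&` L) x by rewrite KL.
    by [].
  by [].
by case.
Qed.

Lemma ts_eq_wmu a b : ts_eq G a b -> wmu m a = wmu m b.
Proof.
elim=> //= {a b} [a b c _ -> _ ->//|a b c d _ ab _ cd|a b||U K L hU hK hL|K L M KL eM].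
- by rewrite /wmu !big_cat /= -/(wmu m a) -/(wmu m b) ab -/(wmu m c) -/(wmu m d) cd.
- by rewrite /wmu !big_cat /= addrC.
- by rewrite /wmu big_cons !big_nil addr0 mu_set0.
- by rewrite /wmu !big_cons !big_nil (mu_bisection hU hK hL).
rewrite /wmu !big_cons !big_nil !addr0 -(@muU K L M) //.
  exact: copen_lc.
exact: copen_lc.
Qed.

Lemma lift_tsemi : exists theta : {additive tsemi G -> A},
  forall a, theta (\pi a) = wmu m a.
Proof.
pose f (s : tsemi G) := wmu m (repr s).
have fpi a : f (\pi a) = wmu m a by apply: ts_eq_wmu; exact: ts_reprP.
have fN : nmod_morphism f.
  split=> [|s t]; first by rewrite -[0]/(\pi_(tsemi G) [::]) fpi /wmu big_nil.
  rewrite -[s]reprK -[t]reprK -piD !fpi /wmu big_cat /=.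
  by rewrite -!/(wmu m _) -/(f s) -/(f t).
exists (HB.pack_for {additive tsemi G -> A} f (GRing.isNmodMorphism.Build _ _ f fN)); exact: fpi.
Qed.

Lemma Int_coboundaries (f : CcT (ipath B)) :
  f \in coboundaries G -> Int m (\val f) = 0.
Proof.
move=> /asboolP/(_ [set f | Int m (\val f) = 0]); apply=> /=.
- exact: Int0.
- move=> g h g0 h0; have [[ng hg] [nh hh]] := (iffLR (Cc_det _) (valP g), iffLR (Cc_det _) (valP h)).
  transitivity (Int m (\val g) - Int m (\val h)); last first.
    by rewrite [Int m _]g0 [Int m _]h0 subr0.
  apply: (@IntB _ hB _ _ hm (maxn ng nh)).
    by apply: det_le hg; exact: leq_maxl.
  by apply: det_le hh; exact: leq_maxr.
move=> k g ->; have /asboolP[ok ck] := valP k.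
apply: (Int_coboundary eG hB hm pG); first by move=> n _; exact: ok.
suff cl : closed [set g | \val k g != 0] by rewrite (iffLR (closure_id _) cl).
rewrite (_ : [set g | _] = ~` (\val k @^-1` [set 0])); last first.
  by apply/seteqP; split=> h /=; move/eqP.
exact: open_closedC.
Qed.

Lemma lift_H0 : exists h : {additive H0 G -> A},
  forall f : CcT (ipath B), h (\pi_(H0 G) f) = Int m (\val f).
Proof.
have IB (f g : CcT (ipath B)) : Int m (\val (f - g)) = Int m (\val f) - Int m (\val g).
  have [[nf hf] [ng hg]] := (iffLR (Cc_det _) (valP f), iffLR (Cc_det _) (valP g)).
  rewrite raddfB; apply: (@IntB _ hB _ _ hm (maxn nf ng)).
    by apply: det_le hf; exact: leq_maxl.
  by apply: det_le hg; exact: leq_maxr.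
pose h (s : H0 G) := Int m (\val (repr s)).
have hpi (f : CcT (ipath B)) : h (\pi_(H0 G) f) = Int m (\val f).
  apply/eqP; rewrite -subr_eq0 -IB; apply/eqP/Int_coboundaries.
  by rewrite Quotient.idealrBE reprK.
have hB' : zmod_morphism h.
  move=> s t; rewrite -[s]reprK -[t]reprK.
  by rewrite -(raddfB (\pi_(H0 G))) !hpi IB.
exists (HB.pack_for {additive H0 G -> A} h (GRing.isZmodMorphism.Build _ _ h hB')).
exact: hpi.
Qed.

End Lifts.

Section WordFunctions.
Local Open Scope quotient_scope.
Variables (B : bratteli) (G : toprel (ipath B)) (eG : etale_basis G).
Implicit Types (a b : word (ipath B)).

Lemma indw_Cc a : indw a \in Cc (ipath B).
Proof. by apply/Cc_det; have [n /det_indw h] := lc_wordP a; exists n. Qed.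

Definition wfun a : CcT (ipath B) := exist _ (indw a) (indw_Cc a).

Lemma ind_bisection_Cc (U : set (gpd G)) : co_bisection U -> ind U \in Cc (gpd G).
Proof.
move=> [cU oU _ _]; have clU := compact_closed (hausdorff_gpd eG) cU.
have e : [set g | ind U g != 0] = U.
  apply/seteqP; split=> g /=; rewrite /ind; first by case: asboolP.
  by move=> Ug; rewrite asboolT.
apply/asboolP; split; last by rewrite e -(iffLR (closure_id U) clU).
move=> n; have [->|n1] := eqVneq n 1.
  rewrite (_ : _ @^-1` _ = U) //; apply/seteqP; split=> g /=; rewrite /ind.
    by case: asboolP.
  by move=> Ug; rewrite asboolT.
have [->|n0] := eqVneq n 0.
  rewrite (_ : _ @^-1` _ = ~` U); first exact: closed_openC.
  by apply/seteqP; split=> g /=; rewrite /ind; case: asboolP.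
rewrite (_ : _ @^-1` _ = set0); first exact: open0.
apply/seteqP; split=> g //=; rewrite /ind; case: asboolP => _ e'; move: n0 n1;
  by rewrite -e' eqxx.
Qed.

Lemma wfun_cat a b : wfun (a ++ b) = wfun a + wfun b.
Proof. by apply: val_inj; apply/funext => x; exact: indw_cat. Qed.

(** Among the defining relations only the one for a bisection U changes the function of a word, and
    it does so by the coboundary of the indicator of U. Injectivity on H_0 is deduced from
    injectivity on the type semigroup through this lemma. *)
Lemma ts_eq_coboundary a b : ts_eq G a b -> wfun a - wfun b \in coboundaries G.
Proof.
elim=> {a b} [a|a b _ IH|a b c _ ab _ bc|a b c d _ ab _ cd|a b||U K L hU hK hL|K L M KL eM].
- by rewrite subrr rpred0.
- by rewrite -opprB rpredN.
- by rewrite -(subrKA (wfun b)) rpredD.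
- by rewrite !wfun_cat opprD addrACA rpredD.
- by rewrite !wfun_cat [wfun b + _]addrC subrr rpred0.
- rewrite (_ : _ - _ = 0) ?rpred0 //; apply: val_inj; apply/funext => x /=.
  by rewrite /GRing.add /GRing.opp /= /indw big_seq1 big_nil /ind asboolF.
- apply/asboolP => H H0 HB /(_ (exist _ (ind U) (ind_bisection_Cc hU))); apply.
  apply/funext => x /=; have [_ _ ir is_] := hU.
  rewrite coboundary_ind // -hK -hL /GRing.add /GRing.opp /=.
  by rewrite /indw !big_cons !big_nil !addr0.
rewrite (_ : _ - _ = 0) ?rpred0 //; apply: val_inj; apply/funext => x /=.
rewrite /GRing.add /GRing.opp /= /indw !big_cons !big_nil !addr0.
apply/eqP; rewrite subr_eq0; apply/eqP; rewrite /ind eM.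
have [Kx|nK] := pselect (cset K x); have [Lx|nL] := pselect (cset L x).
- by have : (cset K `&` cset L) x by []; rewrite KL.
- by rewrite (asboolT Kx) (asboolF nL) asboolT //; left.
- by rewrite (asboolF nK) (asboolT Lx) asboolT //; right.
- by rewrite (asboolF nK) (asboolF nL) asboolF // => -[].
Qed.

Lemma H0posE s : H0pos G s <-> exists a, s = \pi_(H0 G) (wfun a).
Proof.
split=> [[f [a ha] <-]|[a ->]].
  by exists a; congr (\pi_(H0 G) _); apply: val_inj; apply/funext => x; exact: ha.
by exists (wfun a) => //; exists a.
Qed.

Lemma wfun_decomposition (f : CcT (ipath B)) : exists a b, f = wfun a - wfun b.
Proof.
have [n hf] := iffLR (Cc_det _) (valP f).
(* [c p] copies of the cylinder of each p, so that the function of this word is [c p] on that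
   cylinder; f is then the difference of its positive and negative parts. *)
pose W (c : bpath B -> nat) : word (ipath B) :=
  flatten [seq nseq (c p) (copen_of (cyl p)) | p <- paths B n].
have WE c x : indw (W c) x = (c (initial x n))%:Z.
  rewrite /indw big_flatten big_map (bigD1_seq (initial x n)) ?in_paths_initial ?uniq_paths //=.
  rewrite [X in _ + X]big1_seq ?addr0; last first.
    move=> p /andP[px]; rewrite mem_paths => hp; rewrite big_nseq iter_addr_0.
    rewrite copen_ofE; last by exists n; exact: lc_cyl.
    rewrite /ind asboolF ?mul0rn // => /(starts_initial x hp) e.
    by rewrite e eqxx in px.
  rewrite big_nseq iter_addr_0 copen_ofE; last by exists n; exact: lc_cyl (in_E_initial x n).
  by rewrite /ind asboolT ?natz //; exact/starts_initial_agree.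
pose pos z : nat := if (0 <= z :> int) then `|z|%N else 0%N.
exists (W (fun p => pos (valp (\val f) p))), (W (fun p => pos (- valp (\val f) p))).
apply: val_inj; apply/funext => x.
change (\val f x = indw (W (fun p => pos (valp (\val f) p))) x -
  indw (W (fun p => pos (- valp (\val f) p))) x).
rewrite !WE (valp_initial x hf) /pos oppr_ge0 abszN.
case: (ltrgt0P (\val f x)) => h.
- by rewrite subr0 gtz0_abs.
- by rewrite sub0r ltz0_abs // opprK.
- by rewrite h.
Qed.

End WordFunctions.

(** * Tail moves and the tail relation *)

Definition edge (B : bratteli) (x : ipath B) n : blabel B * bvert B :=
  (ilab x n, ivtx x n.+1).

Lemma edge_outs (B : bratteli) (x : ipath B) n : edge x n \in outs n (ivtx x n).
Proof. by rewrite mem_outs /edge /=; have [_ ->] := ipathP x n; have [->] := ipathP x n.+1. Qed.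

Section TailMoves.
Variables (B : bratteli) (hB : has_successors B).
Implicit Types (p q : bpath B) (x y : ipath B) (K L : set (ipath B)).

Lemma starts_agree n p x y : in_E 0 n p -> starts p x -> starts p y -> agree n x y.
Proof.
by move=> hp /(starts_initial x hp) hx /(starts_initial y hp) hy; rewrite /agree hx hy.
Qed.

Lemma agree_starts n p x y : in_E 0 n p -> agree n x y -> starts p x -> starts p y.
Proof.
by move=> hp xy /(starts_initial x hp) hx; apply/(starts_initial y hp); rewrite -xy.
Qed.

Lemma starts_vtx n p x : in_E 0 n p -> starts p x -> ivtx x n = pend p.
Proof. by move=> hp /(starts_initial x hp) <-; rewrite pend_initial. Qed.

Lemma starts_trunc_eq n p x y : in_E 0 n p -> starts p x -> starts p y ->
  same_trunc n x y -> x = y.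
Proof. by move=> hp hx hy; apply: agree_trunc_eq; exact: starts_agree hx hy. Qed.

Lemma tail_total n p q x : in_E 0 n p -> in_E 0 n q -> pend p = pend q ->
  starts p x -> exists y, starts q y /\ same_trunc n x y.
Proof.
move=> hp hq e hx; have [y0 hy0] := in_E_starts hB hq.
have [y [y0y xy]] : exists y, agree n y0 y /\ same_trunc n x y.
  by apply: splice; rewrite (starts_vtx hq hy0) (starts_vtx hp hx).
by exists y; split=> //; exact: agree_starts y0y hy0.
Qed.

Lemma tail_agree n l x x' y y' : agree l y y' -> same_trunc l x y ->
  same_trunc l x' y' -> agree n x x' -> agree n y y'.
Proof.
move=> /agreeP[yv yl] xy x'y' /agreeP[xv xl]; apply/agreeP; split=> i hi.
  case: (leqP i l) => [/yv //|/ltnW li].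
  by have [<- _] := xy i li; have [<- _] := x'y' i li; exact: xv.
case: (ltnP i l) => [/yl //|li].
by have [_ <-] := xy i li; have [_ <-] := x'y' i li; exact: xl.
Qed.

Lemma tail_image_lc n N p q K : in_E 0 n p -> in_E 0 n q -> (n <= N)%N ->
  lc N K -> K `<=` cyl p -> lc N (im (Ubasic n p q) K).
Proof.
move=> hp hq nN hK Kp y y' yy' [x Kx [/= hx hy xy]].
have [x' [xx' y'x']] : exists x', agree n x x' /\ same_trunc n y' x'.
  apply: splice; have [-> _] := xy n (leqnn n).
  exact: agree_vtx yy'.
exists x'; last split=> /=.
- apply: hK Kx; exact: (tail_agree xx' (same_trunc_sym xy) y'x' yy').
- exact: agree_starts xx' hx.
- exact: agree_starts (agree_le nN yy') hy.
- exact: same_trunc_sym.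
Qed.

Lemma tail_image n p q K : in_E 0 n p -> in_E 0 n q ->
  lcs K -> K `<=` cyl p -> lcs (im (Ubasic n p q) K).
Proof.
move=> hp hq [N hK] Kp; exists (maxn n N).
by apply: tail_image_lc => //; [exact: leq_maxl|apply: lc_le hK; exact: leq_maxr].
Qed.

Variables (A : zmodType) (m : nat -> bvert B -> A).
Hypothesis hm : harmonic m.

Lemma lc_full_or_empty n p K : in_E 0 n p -> lc n K -> K `<=` cyl p ->
  K = set0 \/ K = cyl p.
Proof.
move=> hp hK Kp; have [[x Kx]|nK] := pselect (K !=set0); last first.
  by left; apply/seteqP; split=> // x Kx; case: nK; exists x.
right; apply/seteqP; split=> // y hy; apply: (hK x) => //.
exact: starts_agree (Kp _ Kx) hy.
Qed.

(** Both cylinders are refined along the same outgoing edges until K is all or nothing on each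
    piece; there the two measures are the weight of the common end vertex. *)
Lemma tail_mu n p q K : in_E 0 n p -> in_E 0 n q -> pend p = pend q ->
  lcs K -> K `<=` cyl p -> mu m K = mu m (im (Ubasic n p q) K).
Proof.
move=> hp hq e [N hK].
have {hK} : lc (n + N)%N K by apply: lc_le hK; exact: leq_addl.
elim: N n p q hp hq e K => [|N IH] n p q hp hq e K hK Kp.
  rewrite addn0 in hK; have [->|->] := lc_full_or_empty hp hK Kp.
    by congr mu; apply/seteqP; split=> // y [].
  rewrite (_ : im _ _ = cyl q); first by rewrite !(mu_cyl hB hm hp, mu_cyl hB hm hq) e.
  apply/seteqP; split=> [y [x _ [_]] //|y hy].
  have [x [hx xy]] := tail_total hq hp (esym e) hy.
  by exists x => //; split=> //; exact: same_trunc_sym.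
pose Ke eu := K `&` cyl (prcons p eu).
have hpe eu : eu \in outs n (pend p) -> in_E 0 n.+1 (prcons p eu).
  by move=> h; rewrite in_E_prcons hp.
have hqe eu : eu \in outs n (pend p) -> in_E 0 n.+1 (prcons q eu).
  by move=> h; rewrite in_E_prcons hq -e.
have lKe eu : eu \in outs n (pend p) -> lcs (Ke eu).
  move=> heu; apply: lcsI; first by eexists; exact: hK.
  by exists n.+1; apply: lc_cyl; exact: hpe.
rewrite (@mu_bigU _ hB _ m hm _ (outs n (pend p)) K Ke) ?uniq_outs //; first last.
- move=> x eu eu' _ _ [_ /(starts_prcons eu x hp)[_ <-]].
  by move=> [_ /(starts_prcons eu' x hp)[_ <-]].
- move=> x; split=> [Kx|[eu _ []]//].
  exists (ilab x n, ivtx x n.+1).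
    by rewrite -(starts_vtx hp (Kp x Kx)); exact: (edge_outs _ n).
  by split=> //; apply/(starts_prcons _ _ hp); split=> //; exact: Kp.
rewrite (@mu_bigU _ hB _ m hm _ (outs n (pend p)) _
  (fun eu => im (Ubasic n.+1 (prcons p eu) (prcons q eu)) (Ke eu))) ?uniq_outs //; first last.
- by move=> eu heu; apply: tail_image (hpe _ heu) (hqe _ heu) (lKe _ heu) _ => x [].
- move=> y eu eu' _ _ [x _ [_ /(starts_prcons eu y hq)[_ <-] _]].
  by move=> [x' _ [_ /(starts_prcons eu' y hq)[_ <-] _]].
- move=> y; split=> [[x Kx [/= hx hy xy]]|[eu heu [x [Kx _] [/= hx hy xy]]]].
    have [xyn xyl] := xy n (leqnn n); have [xyn1 _] := xy n.+1 (leqnSn n).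
    exists (ilab x n, ivtx x n.+1).
      by rewrite -(starts_vtx hp hx); exact: (edge_outs _ n).
    have hx' : starts (prcons p (ilab x n, ivtx x n.+1)) x.
      by apply/(starts_prcons _ _ hp).
    exists x => //; split=> //=; last exact: same_trunc_le xy.
    by apply/(starts_prcons _ _ hq); rewrite xyl xyn1.
  have [hx1 hx2] := iffLR (starts_prcons eu x hp) hx.
  have [hy1 hy2] := iffLR (starts_prcons eu y hq) hy.
  exists x => //; split=> //= i; rewrite leq_eqVlt => /orP[/eqP <-|]; last exact: xy.
  split; first by rewrite (starts_vtx hp hx1) (starts_vtx hq hy1).
  by rewrite -[ilab x n]/(ilab x n, ivtx x n.+1).1 hx2 -hy2.
apply: eq_big_seq => eu heu.
apply: IH (hpe _ heu) (hqe _ heu) _ _ _ _; first by rewrite !pend_prcons.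
  move=> x x' xx' [Kx hx]; split; first by apply: hK Kx; rewrite addnS -addSn.
  apply: agree_starts (hpe _ heu) _ hx; apply: agree_le xx'; exact: leq_addr.
by move=> x [].
Qed.

End TailMoves.

Lemma etale_tail_rel (B : bratteli) : has_successors B -> etale_basis (tail_rel B).
Proof.
move=> hB; split.
- move=> _ x x' y [l [w [z [hw hz _ ->]]]] [/= hx _ xy] [/= hx' _ x'y].
  exact: (starts_trunc_eq hw hx hx' (same_trunc_trans xy (same_trunc_sym x'y))).
- move=> _ x y y' [l [w [z [hw hz _ ->]]]] [/= _ hy xy] [/= _ hy' xy'].
  exact: (starts_trunc_eq hz hy hy' (same_trunc_trans (same_trunc_sym xy) xy')).
- by move=> _ [x y] [l [w [z [hw hz _ ->]]]] [/= _ _ xy]; exists l.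
- move=> [x y] [l xy]; exists (Ubasic l (initial x l) (initial y l)).
    exists l, (initial x l), (initial y l); split=> //; try exact: in_E_initial.
    by rewrite !pend_initial; have [] := xy l (leqnn l).
  by split=> //; exact/starts_initial_agree.
- move=> _ _ x y [l [w [z [hw hz _ ->]]]] [l' [w' [z' [hw' hz' _ ->]]]].
  move=> [/= hx hy xy] [/= hx' hy' xy'].
  exists (maxn l l') => x1 y1 xx1 [/= hx1 hy1 xy1].
  have yy1 := tail_agree (starts_agree hz hy hy1) xy xy1 xx1.
  split=> /=.
  + by apply: agree_starts hw' _ hx'; exact: agree_maxr xx1.
  + by apply: agree_starts hz' _ hy'; exact: agree_maxr yy1.
  + move=> i hi; case: (leqP l i) => li; first exact: xy1.
    move/agreeP: xx1 => [xv xl]; move/agreeP: yy1 => [yv yl].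
    have hi1 : (i <= maxn l l')%N by rewrite (leq_trans (ltnW li)) ?leq_maxl.
    have hi2 : (i < maxn l l')%N by rewrite (leq_trans li) ?leq_maxl.
    by rewrite -xv // -yv // -xl // -yl //; exact: xy'.
- move=> _ x y n [l [w [z [hw hz _ ->]]]] [/= hx hy xy].
  pose N := maxn l n; have lN : (l <= N)%N := leq_maxl l n.
  exists (Ubasic N (initial x N) (initial y N)); split.
  + exists N, (initial x N), (initial y N); split=> //; try exact: in_E_initial.
    by rewrite !pend_initial; have [] := xy N lN.
  + by split=> /=; try exact/starts_initial_agree; exact: same_trunc_le xy.
  + move=> x' y' [/= /starts_initial_agree xx' /starts_initial_agree yy' xy'].
    have ar k : (k <= N)%N -> agree k x x' /\ agree k y y'.
      by move=> kN; split; exact: agree_le kN _.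
    have [xl yl] := ar l lN; have [xn yn] := ar n (leq_maxr l n); split=> //.
    split=> /=; [exact: agree_starts xl hx|exact: agree_starts yl hy|move=> i li].
    case: (leqP N i) => iN; first exact: xy'.
    move/agreeP: xx' => [xv xl']; move/agreeP: yy' => [yv yl'].
    by rewrite -xv ?(ltnW iN) // -yv ?(ltnW iN) // -xl' // -yl' //; exact: xy.
- move=> _ x y [l [w [z [hw hz e ->]]]] [/= hx hy xy]; exists l => x' xx'.
  have hx' := agree_starts hw xx' hx.
  by have [y' [hy' xy']] := tail_total hB hw hz e hx'; exists y'.
move=> _ x y [l [w [z [hw hz e ->]]]] [/= hx hy xy]; exists l => K lK hK.
by apply: tail_image => // x' /hK xx'; exact: agree_starts hw xx' hx.
Qed.

Lemma preserves_tail_rel (B : bratteli) (A : zmodType) (m : nat -> bvert B -> A) :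
  has_successors B -> harmonic m -> preserves m (tail_rel B).
Proof.
move=> hB hm _ x y [l [w [z [hw hz e ->]]]] [/= hx hy xy]; exists l => K lK hK.
by apply: tail_mu => // x' /hK xx'; exact: agree_starts hw xx' hx.
Qed.

Lemma Ubasic_bisection (B : bratteli) l (w z : bpath B) : has_successors B ->
  in_E 0 l w -> in_E 0 l z -> pend w = pend z ->
  exists W : set (gpd (tail_rel B)), co_bisection W /\
    @gpair _ (tail_rel B) @` W = Ubasic l w z.
Proof.
move=> hB hw hz e.
have bU : er_base (tail_rel B) (Ubasic l w z) by exists l, w, z.
have [|//|bW _ _] := co_bisection_base (etale_tail_rel hB) bU (O := cyl w).
- by exists l; exact: lc_cyl.
- by move=> x hx; have [y [hy xy]] := tail_total hB hw hz e hx; exists y.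
exists [set g : gpd (tail_rel B) | Ubasic l w z (gpair g) /\ cyl w (rg g)].
split=> //; apply/seteqP; split=> [_ [g [Ug _] <-] //|[x y] Uxy].
have [g hg] := gpd_of (etale_tail_rel hB) bU Uxy.
by exists g => //; split; rewrite /rg hg //=; case: Uxy.
Qed.

(** The set U_{p,q} is itself a compact open bisection, with range pX and source qX. *)
Lemma tail_cls_of_base (B : bratteli) (G : toprel (ipath B)) : has_successors B ->
  etale_basis G ->
  (forall l w z, in_E 0 l w -> in_E 0 l z -> pend w = pend z -> er_base G (Ubasic l w z)) ->
  forall l p q, in_E 0 l p -> in_E 0 l q -> pend p = pend q ->
    cls G (cyl p) = cls G (cyl q).
Proof.
move=> hB eG hG l p q hp hq e; have bU := hG _ _ _ hp hq e.
have lp : lcs (cyl p) by exists l; exact: lc_cyl.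
have lq : lcs (cyl q) by exists l; exact: lc_cyl.
have [x hx|bW rW sW] := co_bisection_base eG bU lp.
  by have [y [hy xy]] := tail_total hB hp hq e hx; exists y.
have [P eP] := lcs_copen lp; have [Q eQ] := lcs_copen lq; rewrite eP eQ !cls_copen.
apply/esym/ts_piP/(ts_bisection bW); last by rewrite rW.
rewrite sW -eQ; apply/seteqP; split=> [y hy|y [x _ []] //].
have [x [hx' yx]] := tail_total hB hq hp (esym e) hy.
by exists x => //; split=> //; exact: same_trunc_sym.
Qed.

(** * Zigzags *)

(* At level [n], [zr] edges [zL n i] leave [zLv n] on the left and as many edges
   [zR n i] leave [zRv n] on the right.  An entry ((i, e), (i', e')) of [zpairs n]
   is the matched pair made of [zL n i] followed by the edge e and of [zR n i']
   followed by the edge e'.  When i is not last and e is some [zL n.+1 j], nothing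
   is matched: [zL n i] corresponds to [zR n i] and the zigzag continues at level
   [n.+1]. *)
Record zigzag (B : bratteli) := Zigzag {
  zr : nat -> nat;
  zLv : nat -> bvert B;
  zRv : nat -> bvert B;
  zL : nat -> nat -> blabel B * bvert B;
  zR : nat -> nat -> blabel B * bvert B;
  zpairs : nat -> seq ((nat * (blabel B * bvert B)) * (nat * (blabel B * bvert B))) }.

Definition zswap (B : bratteli) (Z : zigzag B) : zigzag B :=
  Zigzag (zr Z) (zRv Z) (zLv Z) (zR Z) (zL Z)
    (fun n => [seq (wz.2, wz.1) | wz <- zpairs Z n]).

Lemma zswapK (B : bratteli) (Z : zigzag B) : zswap (zswap Z) = Z.
Proof.
case: Z => r Lv Rv L R P; congr Zigzag; apply/funext => n /=.
by rewrite -map_comp map_id_in // => -[].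
Qed.

(** Only one side is axiomatised: the right side is the left side of [zswap Z], so that each
    argument is made once. In [left_mem] the matched left paths are all paths of two edges except
    those along which the zigzag continues. *)
Record left_axioms (B : bratteli) (Z : zigzag B) : Prop := LeftAxioms {
  left_r : forall n, (1 < zr Z n)%N;
  left_vlev : forall n, zLv Z n \in vlev B n;
  left_out : forall n i, (i < zr Z n)%N -> zL Z n i \in outs n (zLv Z n);
  left_end : forall n i, (i < zr Z n)%N -> (zL Z n i).2 = zLv Z n.+1;
  left_inj : forall n i j, (i < zr Z n)%N -> (j < zr Z n)%N ->
    zL Z n i = zL Z n j -> i = j;
  left_uniq : forall n, uniq (unzip1 (zpairs Z n));
  left_mem : forall n i eu, (i, eu) \in unzip1 (zpairs Z n) <->
    [/\ (i < zr Z n)%N, eu \in outs n.+1 (zLv Z n.+1)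
      & ~ ((i.+1 < zr Z n)%N /\ exists2 j, (j < zr Z n.+1)%N & eu = zL Z n.+1 j)] }.

(** In [zz_neq] the levels start at 1, since at level 0 both sides may leave the same vertex. *)
Record zigzag_axioms (B : bratteli) (Z : zigzag B) : Prop := ZigzagAxioms {
  zz_left : left_axioms Z;
  zz_right : left_axioms (zswap Z);
  zz_neq : forall n, zLv Z n.+1 <> zRv Z n.+1;
  zz_pair_end : forall n w z, (w, z) \in zpairs Z n -> w.2.2 = z.2.2 }.

Lemma unzip1_inj (T U : eqType) (s : seq (T * U)) a b c : uniq (unzip1 s) ->
  (a, b) \in s -> (a, c) \in s -> b = c.
Proof.
elim: s => //= -[u v] s IH /andP[us] /IH{}IH; rewrite !in_cons.
have nu d : (u, d) \in s -> False.
  by move=> hd; move: us; rewrite (_ : u \in _) //; apply/mapP; exists (u, d).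
by move=> /orP[/eqP[-> ->]|hb] /orP[/eqP|hc]; [case=> ->|case: (nu c)|
  move=> [ea _]; rewrite ea in hb; case: (nu b)|exact: IH].
Qed.

Lemma left_pair_eq (B : bratteli) (Z : zigzag B) n w z w' z' : left_axioms Z ->
  (w, z) \in zpairs Z n -> (w', z') \in zpairs Z n ->
  zL Z n w.1 = zL Z n w'.1 -> w.2 = w'.2 -> (w, z) = (w', z').
Proof.
case: w w' => i eu [i' eu'] LA h h' /= eL e.
have hm v y : (v, y) \in zpairs Z n -> v \in unzip1 (zpairs Z n).
  by move=> hv; apply/mapP; exists (v, y).
have /(left_mem LA)[hi _ _] := hm _ _ h; have /(left_mem LA)[hi' _ _] := hm _ _ h'.
have ei := left_inj LA hi hi' eL; subst i' eu'.
by rewrite (unzip1_inj (left_uniq LA n) h h').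
Qed.

Lemma left_pair_sing (B : bratteli) (Z : zigzag B) n w z i : left_axioms Z ->
  (w, z) \in zpairs Z n -> (i.+1 < zr Z n)%N -> zL Z n w.1 = zL Z n i ->
  ~ exists2 j, (j < zr Z n.+1)%N & w.2 = zL Z n.+1 j.
Proof.
case: w => k eu LA h hi /= eL hj.
have /(left_mem LA)[hk _] : (k, eu) \in unzip1 (zpairs Z n).
  by apply/mapP; eexists; first exact: h.
by have -> := left_inj LA hk (ltnW hi) eL; case.
Qed.

Lemma zswap_axioms (B : bratteli) (Z : zigzag B) :
  zigzag_axioms Z -> zigzag_axioms (zswap Z).
Proof.
move=> [hL hR hn hp]; split=> //; first by rewrite zswapK.
- by move=> n /esym; exact: hn.
- by move=> n w z /mapP[[w' z'] h [ew ez]]; rewrite ew ez; exact: esym (hp _ _ _ h).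
Qed.

(* The partial homeomorphism of the tails at level [n]: it follows the left
   edges [zL] and right edges [zR] in parallel until, if ever, a matched pair of
   edges is met, after which both tails coincide. *)
CoInductive theta (B : bratteli) (Z : zigzag B) n (x y : ipath B) : Prop :=
| theta_pair i eu i' eu' of ((i, eu), (i', eu')) \in zpairs Z n &
    ivtx x n = zLv Z n & edge x n = zL Z n i & edge x n.+1 = eu &
    ivtx y n = zRv Z n & edge y n = zR Z n i' & edge y n.+1 = eu' &
    same_trunc n.+2 x y
| theta_sing i of (i.+1 < zr Z n)%N &
    ivtx x n = zLv Z n & edge x n = zL Z n i &
    ivtx y n = zRv Z n & edge y n = zR Z n i & theta Z n.+1 x y.

Lemma theta_swap (B : bratteli) (Z : zigzag B) n x y :
  theta (zswap Z) n y x <-> theta Z n x y.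
Proof.
split; move: n x y; cofix IH => n x y [i eu i' eu' h v1 e1 f1 v2 e2 f2 t|i h v1 e1 v2 e2 t].
- apply: (@theta_pair _ _ _ _ _ i' eu' i eu) => //; last exact: same_trunc_sym.
  by case/mapP: h => -[w z] h [-> ->].
- by apply: (@theta_sing _ _ _ _ _ i) => //; exact: IH.
- apply: (@theta_pair _ _ _ _ _ i' eu' i eu) => //; last exact: same_trunc_sym.
  by apply/mapP; eexists; first exact: h.
- by apply: (@theta_sing _ _ _ _ _ i) => //; exact: IH.
Qed.

Lemma same_trunc_edge (B : bratteli) n k (x y : ipath B) : (n <= k)%N ->
  same_trunc n x y -> edge x k = edge y k.
Proof.
move=> nk h; rewrite /edge; have [_ ->] := h k nk.
by have [-> _] := h k.+1 (leq_trans nk (leqnSn k)).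
Qed.

Lemma agree_edge (B : bratteli) n k (x y : ipath B) : (k < n)%N ->
  agree n x y -> edge x k = edge y k.
Proof. by move=> kn /agreeP[hv hl]; rewrite /edge hl // hv. Qed.

(** Coinduction with the guardedness condition met once and for all; later proofs only have to
    exhibit an invariant Q. *)
Lemma theta_coind (B : bratteli) (Z : zigzag B) (Q : nat -> ipath B -> ipath B -> Prop) :
  (forall n x y, Q n x y ->
     (exists i eu i' eu', [/\ ((i, eu), (i', eu')) \in zpairs Z n,
        ivtx x n = zLv Z n /\ ivtx y n = zRv Z n, edge x n = zL Z n i /\ edge y n = zR Z n i',
        edge x n.+1 = eu /\ edge y n.+1 = eu' & same_trunc n.+2 x y]) \/
     (exists i, [/\ (i.+1 < zr Z n)%N, ivtx x n = zLv Z n /\ ivtx y n = zRv Z n,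
        edge x n = zL Z n i /\ edge y n = zR Z n i & Q n.+1 x y])) ->
  forall n x y, Q n x y -> theta Z n x y.
Proof.
move=> hQ; cofix IH => n x y h.
case: (hQ n x y h) => [[i [eu [i' [eu' [hp [v1 v2] [e1 e2] [f1 f2] t]]]]]|[i [hi [v1 v2] [e1 e2] t]]].
  exact: (@theta_pair _ _ _ _ _ i eu i' eu').
by apply: (@theta_sing _ _ _ _ _ i) => //; exact: IH.
Qed.

Lemma theta_trunc (B : bratteli) (Z : zigzag B) n x y x' y' :
  theta Z n x y -> same_trunc n x x' -> same_trunc n y y' -> theta Z n x' y'.
Proof.
move=> h hx hy.
apply: (@theta_coind _ _ (fun n x' y' => exists x y,
  [/\ theta Z n x y, same_trunc n x x' & same_trunc n y y'])); last by exists x, y.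
move=> {h hx hy x y x' y'} k x' y' [x [y [h hx hy]]].
have [vx _] := hx k (leqnn k); have [vy _] := hy k (leqnn k).
have ex := same_trunc_edge (leqnn k) hx; have ey := same_trunc_edge (leqnn k) hy.
have ex1 := same_trunc_edge (leqnSn k) hx; have ey1 := same_trunc_edge (leqnSn k) hy.
case: h => [i eu i' eu' h v1 e1 f1 v2 e2 f2 t|i h v1 e1 v2 e2 t].
  left; exists i, eu, i', eu'; rewrite -vx -vy -ex -ey -ex1 -ey1; split=> //.
  have n2 : (k <= k.+2)%N by rewrite -addn2 leq_addr.
  apply: same_trunc_trans (same_trunc_sym (same_trunc_le n2 hx)) _.
  exact: same_trunc_trans t (same_trunc_le n2 hy).
right; exists i; rewrite -vx -vy -ex -ey; split=> //; exists x, y.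
by split=> //; [exact: same_trunc_le (leqnSn k) hx|exact: same_trunc_le (leqnSn k) hy].
Qed.

Section ZigzagMoves.
Variables (B : bratteli).
Implicit Types (Z : zigzag B) (x y : ipath B) (p q : bpath B).

Lemma theta_left Z n x y : zigzag_axioms Z -> theta Z n x y ->
  ivtx x n = zLv Z n /\ exists2 i, (i < zr Z n)%N & edge x n = zL Z n i.
Proof.
move=> ZA [i eu i' eu' h v1 e1 _ _ _ _ _|i h v1 e1 _ _ _].
  have /(left_mem (zz_left ZA))[hi _ _] : (i, eu) \in unzip1 (zpairs Z n).
    by apply/mapP; eexists; first exact: h.
  by split=> //; exists i.
by split=> //; exists i => //; exact: ltnW.
Qed.

Lemma theta_right Z n x y : zigzag_axioms Z -> theta Z n x y ->
  ivtx y n = zRv Z n /\ exists2 i, (i < zr Z n)%N & edge y n = zR Z n i.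
Proof. by move=> /zswap_axioms ZA /theta_swap h; exact: (theta_left ZA h). Qed.

Lemma theta_sing_inv Z n x y i : zigzag_axioms Z -> theta Z n x y ->
  (i.+1 < zr Z n)%N -> edge x n = zL Z n i ->
  (exists2 j, (j < zr Z n.+1)%N & edge x n.+1 = zL Z n.+1 j) ->
  edge y n = zR Z n i /\ theta Z n.+1 x y.
Proof.
move=> ZA h hi ex [j hj ej]; have ZL := zz_left ZA; have hi' := ltnW hi.
case: h => [k eu k' eu' h v1 e1 f1 v2 e2 f2 t|k hk v1 e1 v2 e2 t].
  have /(left_mem ZL)[hk _] : (k, eu) \in unzip1 (zpairs Z n).
    by apply/mapP; eexists; first exact: h.
  have -> : k = i by apply: (left_inj ZL hk hi'); rewrite -e1.
  by case; split=> //; exists j => //; rewrite -f1.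
have -> // : i = k by apply: (left_inj ZL hi' (ltnW hk)); rewrite -e1.
Qed.

Lemma theta_pair_inv Z n x y i eu i' eu' : zigzag_axioms Z -> theta Z n x y ->
  ((i, eu), (i', eu')) \in zpairs Z n -> edge x n = zL Z n i -> edge x n.+1 = eu ->
  [/\ edge y n = zR Z n i', edge y n.+1 = eu' & same_trunc n.+2 x y].
Proof.
move=> ZA h hp ex fx; have ZL := zz_left ZA.
have /(left_mem ZL)[hi _ ns] : (i, eu) \in unzip1 (zpairs Z n).
  by apply/mapP; eexists; first exact: hp.
case: h => [k fu k' fu' h v1 e1 f1 v2 e2 f2 t|k hk v1 e1 v2 e2 t].
  have /(left_mem ZL)[hk _ _] : (k, fu) \in unzip1 (zpairs Z n).
    by apply/mapP; eexists; first exact: h.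
  have ki : k = i by apply: (left_inj ZL hk hi); rewrite -e1.
  have fe : fu = eu by rewrite -f1.
  rewrite ki fe in h.
  have : (k', fu') = (i', eu'); last by case=> <- <-.
  exact: unzip1_inj (left_uniq ZL n) h hp.
have ki : k = i by apply: (left_inj ZL (ltnW hk) hi); rewrite -e1.
subst k; case: ns; split=> //.
by have [_ [j hj ej]] := theta_left ZA t; exists j => //; rewrite -fx.
Qed.

(** The conclusion is not coinductive, so the coordinates of y and y' at level n + d are compared by
    induction on d, one step of the zigzag at a time. *)
Lemma theta_fun Z n x y y' : zigzag_axioms Z -> theta Z n x y -> theta Z n x y' ->
  same_trunc n y y'.
Proof.
move=> ZA h h' k; move: n x y y' h h'.
suff H d : forall n x y y', theta Z n x y -> theta Z n x y' ->
    ivtx y (n + d)%N = ivtx y' (n + d)%N /\ ilab y (n + d)%N = ilab y' (n + d)%N.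
  by move=> n x y y' h h' /subnKC <-; exact: H h h'.
elim: d => [|d IH] n x y y' h h'; have [vy _] := theta_right ZA h; have [vy' _] := theta_right ZA h'.
  rewrite addn0 vy vy'; split=> //.
  case: h => [i eu i' eu' h v1 e1 f1 v2 e2 f2 t|i hi v1 e1 v2 e2 t].
    have [e2' _ _] := theta_pair_inv ZA h' h e1 f1.
    by rewrite -[LHS]/(edge y n).1 e2 -e2'.
  have [_ hs] := theta_left ZA t.
  have [e2' _] := theta_sing_inv ZA h' hi e1 hs.
  by rewrite -[LHS]/(edge y n).1 e2 -e2'.
case: h => [i eu i' eu' h v1 e1 f1 v2 e2 f2 t|i hi v1 e1 v2 e2 t].
  have [e2' f2' t'] := theta_pair_inv ZA h' h e1 f1.
  case: d {IH} => [|d].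
    rewrite addn1 -[ivtx y _]/(edge y n).2 e2 -e2'; split=> //.
    by rewrite -[LHS]/(edge y n.+1).1 f2 -f2'.
  have hd : (n.+2 <= n + d.+2)%N by rewrite !addnS !ltnS leq_addr.
  by have [<- <-] := t _ hd; exact: t'.
have [_ hs] := theta_left ZA t.
have [e2' t'] := theta_sing_inv ZA h' hi e1 hs.
by rewrite addnS -addSn; exact: IH t t'.
Qed.

Definition theta_total Z := forall n x i, ivtx x n = zLv Z n -> (i < zr Z n)%N ->
  edge x n = zL Z n i -> exists y, theta Z n x y.

Definition trel Z (c : option bool) n x y : Prop :=
  match c with
  | None => same_trunc n x y
  | Some true => theta Z n x y
  | Some false => theta Z n y x
  end.

Definition flip : option bool -> option bool := omap negb.

Lemma trel_flip Z c n x y : trel Z c n x y <-> trel Z (flip c) n y x.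
Proof. by case: c => [[]|] //=; split; exact: same_trunc_sym. Qed.

Lemma trel_swap Z c n x y : trel Z c n x y <-> trel (zswap Z) (flip c) n x y.
Proof.
case: c => [[]|] //=; first by split=> /theta_swap.
by split=> /theta_swap.
Qed.

End ZigzagMoves.

Record zigzag_system (B : bratteli) (Z : zigzag B) : Prop := ZigzagSystem {
  zs_axioms : zigzag_axioms Z;
  zs_total : theta_total Z;
  zs_total' : theta_total (zswap Z) }.

Lemma zswap_system (B : bratteli) (Z : zigzag B) :
  zigzag_system Z -> zigzag_system (zswap Z).
Proof. by move=> [h t t']; split; [exact: zswap_axioms|exact: t'|rewrite zswapK]. Qed.

(** * Germs of tail moves and zigzags *)

Section Germs.
Variables (B : bratteli).
Implicit Types (Z : zigzag B) (x y z : ipath B) (c : option bool).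

(* The germ at (x, y) of the level-n relation of kind c: c = None for a tail
   move, c = Some true for theta, c = Some false for its inverse. *)
Definition near Z c n x y x' y' : Prop :=
  [/\ agree n x x', agree n y y' & trel Z c n x' y'].

Lemma near_swap Z c n x y x' y' :
  near Z c n x y x' y' <-> near (zswap Z) (flip c) n x y x' y'.
Proof. split=> -[h1 h2 h3]; split=> //.
  exact: (iffLR (trel_swap Z c n x' y')).
exact: (iffRL (trel_swap Z c n x' y')). Qed.

Lemma trel_fun Z c n x y y' : zigzag_system Z ->
  trel Z c n x y -> trel Z c n x y' -> same_trunc n y y'.
Proof.
move=> ZS; case: c => [[]|] /= h h'.
- exact: (theta_fun (zs_axioms ZS) h h').
- by move/theta_swap: h; move/theta_swap: h'; move=> h' h;
    exact: (theta_fun (zs_axioms (zswap_system ZS)) h h').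
- exact: same_trunc_trans (same_trunc_sym h) h'.
Qed.

Lemma trel_inj Z c n x x' y : zigzag_system Z ->
  trel Z c n x y -> trel Z c n x' y -> same_trunc n x x'.
Proof. by move=> ZS /trel_flip h /trel_flip h'; exact: trel_fun ZS h h'. Qed.

Lemma agreeS n x x' : agree n x x' -> edge x n = edge x' n -> agree n.+1 x x'.
Proof. by rewrite /agree !initialS -/(edge x n) -/(edge x' n) => -> ->. Qed.

(** A matched pair at level n would give the next edges of x and y a common end vertex, whereas
    [theta] at level n.+1 makes them end on the two different sides. So the step at level n is a
    continuation, and then both levels impose the same conditions near (x, y). *)
Lemma near_raise_theta Z n x y : zigzag_axioms Z ->
  theta Z n x y -> theta Z n.+1 x y ->
  exists N, forall x', agree N x x' -> forall y',
    near Z (Some true) n x y x' y' <-> near Z (Some true) n.+1 x y x' y'.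
Proof.
move=> ZA h h1; exists n.+2 => x' xx' y'.
have [_ [j hj ej]] := theta_left ZA h1.
have ex : edge x n = edge x' n := agree_edge (leqnSn n.+1) xx'.
have ex1 : edge x n.+1 = edge x' n.+1 := agree_edge (leqnn _) xx'.
have vx : ivtx x n = ivtx x' n := agree_vtx (leqW (leqnSn n)) xx'.
have [i hi [v1 e1 v2 e2]] : exists2 i, (i.+1 < zr Z n)%N &
    [/\ ivtx x n = zLv Z n, edge x n = zL Z n i, ivtx y n = zRv Z n & edge y n = zR Z n i].
  case: (h) => [k eu k' eu' hp v1 e1 f1 v2 e2 f2 t|k hk v1 e1 v2 e2 t]; last by exists k.
  have [vy _] := theta_right ZA h1; have [vx1 _] := theta_left ZA h1.
  have [_ [jy hjy ejy]] := theta_right ZA h1.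
  have := zz_pair_end ZA hp; rewrite /= -f1 -f2 ej ejy.
  by rewrite (left_end (zz_left ZA) hj) (left_end (zz_right ZA) hjy) /= => /zz_neq.
split=> [[_ yy' h']|[_ yy' h']].
  have [e2' h1'] := theta_sing_inv ZA h' hi (etrans (esym ex) e1)
    (ex_intro2 _ _ j hj (etrans (esym ex1) ej)).
  split=> //=; first exact: agree_le xx'.
  by apply: agreeS yy' _; rewrite e2 e2'.
split; [by apply: agree_le xx'; exact: leqW|exact: agree_le yy'|].
apply: (@theta_sing _ _ _ _ _ i) => //; rewrite -?vx -?ex //.
  by rewrite -(agree_vtx (leqnSn n) yy').
by rewrite -(agree_edge (leqnn _) yy').
Qed.

Lemma near_raise Z c n x y : zigzag_axioms Z ->
  trel Z c n x y -> trel Z c n.+1 x y ->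
  exists N, forall x', agree N x x' -> forall y',
    near Z c n x y x' y' <-> near Z c n.+1 x y x' y'.
Proof.
move=> ZA; case: c => [[]|] h h1.
- exact: near_raise_theta.
- have [||N hN] := near_raise_theta (n := n) (x := x) (y := y) (zswap_axioms ZA).
  + exact/theta_swap.
  + exact/theta_swap.
  exists N => x' xx' y'; apply: (iff_trans (near_swap _ _ _ _ _ _ _)).
  exact: (iff_trans (hN x' xx' y') (iff_sym (near_swap Z (Some false) n.+1 x y x' y'))).
exists n.+1 => x' xx' y'; split=> [[_ yy' h']|[_ yy' h']].
  split=> //; last exact: same_trunc_le h'.
  exact: tail_agree yy' h h' xx'.
split; [exact: agree_le xx'|exact: agree_le yy'|move=> i].
rewrite leq_eqVlt => /orP[/eqP <-|]; last exact: h'.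
have [hv hl] := h n (leqnn n); split.
  by rewrite -(agree_vtx (leqnSn n) xx') -(agree_vtx (leqnSn n) yy').
move/agreeP: xx' => [_ xl]; move/agreeP: yy' => [_ yl].
by rewrite -xl // -yl.
Qed.

Lemma near_total Z c n x y : zigzag_system Z -> trel Z c n x y ->
  exists N, forall x', agree N x x' -> exists y', near Z c n x y x' y'.
Proof.
have main W : zigzag_system W -> theta W n x y ->
    forall x', agree n.+1 x x' -> exists y', near W (Some true) n x y x' y'.
  move=> WS h x' xx'; have [v1 [i hi e1]] := theta_left (zs_axioms WS) h.
  have v1' : ivtx x' n = zLv W n by rewrite -(agree_vtx (leqnSn n) xx').
  have [y1 h1] := zs_total WS v1' hi (etrans (esym (agree_edge (leqnn _) xx')) e1).
  have [vy _] := theta_right (zs_axioms WS) h.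
  have [vy1 _] := theta_right (zs_axioms WS) h1.
  have [y' [yy' y1y']] := splice (etrans vy (esym vy1)).
  exists y'; split=> //; first exact: agree_le xx'.
  exact: (theta_trunc h1 (same_trunc_refl _) y1y').
move=> ZS; case: c => [[]|] h.
- by exists n.+1; exact: main.
- exists n.+1 => x' xx'; have [|y' hy'] := main (zswap Z) (zswap_system ZS) _ x' xx'.
    exact/theta_swap.
  by exists y'; apply/near_swap.
exists n => x' xx'.
have [y' [yy' x'y']] := @splice _ n y x' (etrans (esym (proj1 (h n (leqnn n)))) (agree_vtx (leqnn n) xx')).
by exists y'; split.
Qed.

(** The relation is required at every level from n on: this is what permits raising n, hence
    comparing two germs at a common level, and what distinguishes a zigzag that stops later from one
    that never does. *)
Definition germ Z (P : set (ipath B * ipath B)) c n x y : Prop :=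
  (forall m, (n <= m)%N -> trel Z c m x y) /\
  exists N, forall x', agree N x x' -> forall y', P (x', y') <-> near Z c n x y x' y'.

Lemma germ_raise Z P c n m x y : zigzag_system Z -> (n <= m)%N ->
  germ Z P c n x y -> germ Z P c m x y.
Proof.
move=> ZS /subnKC <-; elim: (m - n)%N => [|k IH]; first by rewrite addn0.
move=> /IH [h [N hN]]; rewrite addnS; split=> [j hj|]; first by apply: h; exact: ltnW.
have [N' hN'] := near_raise (zs_axioms ZS) (h _ (leqnn _)) (h _ (leqnSn _)).
exists (maxn N N') => x' xx' y'; rewrite hN; last exact: agree_maxl xx'.
by apply: hN'; exact: agree_maxr xx'.
Qed.

Lemma germ_cont Z P c n x y M : zigzag_system Z -> germ Z P c n x y ->
  exists N, forall x' y', agree N x x' -> P (x', y') -> agree M y y'.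
Proof.
move=> ZS /(germ_raise ZS (leq_maxl n M))[_ [N hN]].
exists N => x' y' xx' /(hN _ xx')[_ yy' _]; exact: agree_maxr yy'.
Qed.

Lemma germ_total Z P c n x y : zigzag_system Z -> germ Z P c n x y ->
  exists N, forall x', agree N x x' -> exists y', P (x', y').
Proof.
move=> ZS [h [N hN]]; have [N' hN'] := near_total ZS (h n (leqnn n)).
exists (maxn N N') => x' xx'; have [|y' hy'] := hN' x'.
  exact: agree_maxr xx'.
by exists y'; apply/hN => //; exact: agree_maxl xx'.
Qed.

(** From level 1 on a zigzag has its two paths at two different vertices, its inverse has them
    exchanged, and a tail move has them equal; the vertices at one late level decide. *)
Lemma germ_kind Z P Q c c' n n' x y : zigzag_axioms Z ->
  germ Z P c n x y -> germ Z Q c' n' x y -> c = c'.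
Proof.
move=> ZA [h _] [h' _]; pose m := (maxn n n').+1.
have {}h : trel Z c m x y by apply: h; rewrite /m leqW // leq_maxl.
have {}h' : trel Z c' m x y by apply: h'; rewrite /m leqW // leq_maxr.
case: c c' h h' => [[]|] [[]|] //= h h'.
- have [v _] := theta_left ZA h; have [v' _] := theta_right ZA h'.
  by case: (@zz_neq _ _ ZA (maxn n n')); rewrite -v -v'.
- have [v _] := theta_left ZA h; have [v' _] := theta_right ZA h.
  by case: (@zz_neq _ _ ZA (maxn n n')); rewrite -v -v'; have [] := h' m (leqnn _).
- have [v _] := theta_left ZA h'; have [v' _] := theta_right ZA h.
  by case: (@zz_neq _ _ ZA (maxn n n')); rewrite -v -v'.
- have [v _] := theta_left ZA h; have [v' _] := theta_right ZA h.
  by case: (@zz_neq _ _ ZA (maxn n n')); rewrite -v -v'; have [] := h' m (leqnn _).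
- have [v _] := theta_left ZA h'; have [v' _] := theta_right ZA h'.
  by case: (@zz_neq _ _ ZA (maxn n n')); rewrite -v -v'; have [] := h m (leqnn _).
- have [v _] := theta_left ZA h'; have [v' _] := theta_right ZA h'.
  by case: (@zz_neq _ _ ZA (maxn n n')); rewrite -v -v'; have [] := h m (leqnn _).
Qed.

Lemma germ_eq Z P Q c c' n n' x y : zigzag_system Z ->
  germ Z P c n x y -> germ Z Q c' n' x y ->
  exists N, forall x' y', agree N x x' -> P (x', y') <-> Q (x', y').
Proof.
move=> ZS gP gQ; have e := germ_kind (zs_axioms ZS) gP gQ; subst c'.
have [_ [N hN]] := germ_raise ZS (leq_maxl n n') gP.
have [_ [N' hN']] := germ_raise ZS (leq_maxr n n') gQ.
exists (maxn N N') => x' y' xx'; rewrite hN; last exact: agree_maxl xx'.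
by rewrite hN' //; exact: agree_maxr xx'.
Qed.

(** At a common late level the nine combinations reduce to three facts: two zigzags of the same
    direction cannot be composed, because the middle path would be at both vertices; opposite ones
    cancel to a tail move by [trel_fun] and [trel_inj]; a tail move is absorbed by [theta_trunc]. *)
Lemma germ_comp Z P Q c c' n n' x y z : zigzag_system Z ->
  germ Z P c n x y -> germ Z Q c' n' y z ->
  exists c'' n'', germ Z (comp_rel P Q) c'' n'' x z.
Proof.
move=> ZS gP gQ.
have {gP}gP := germ_raise ZS (leq_trans (leq_maxl n n') (leqnSn _)) gP.
have {gQ}gQ := germ_raise ZS (leq_trans (leq_maxr n n') (leqnSn _)) gQ.
move: gP gQ; set m := (maxn n n').+1 => gP gQ.
have [hP _] := gP; have [hQ _] := gQ.
have ZA := zs_axioms ZS.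
suff [d hd] : exists d, forall k, (m <= k)%N -> forall x1 y1 z1 : ipath B,
    agree k x x1 -> agree k y y1 -> agree k z z1 ->
    trel Z c k x1 y1 -> (trel Z c' k y1 z1 <-> trel Z d k x1 z1).
  exists d, m; split=> [k mk|].
    by apply/(hd k mk x y z) => //; [exact: hP|exact: hQ].
  have [_ [NP hNP]] := gP; have [_ [NQ hNQ]] := gQ.
  have [NC hNC] := germ_cont NQ ZS gP.
  have [NT hNT] := germ_total ZS gP.
  exists (maxn (maxn NP NC) NT) => x' xx' z'.
  have xP : agree NP x x' by apply: agree_le xx'; rewrite !leq_max leqnn.
  have xC : agree NC x x' by apply: agree_le xx'; rewrite !leq_max leqnn !orbT.
  have xT : agree NT x x' by apply: agree_le xx'; rewrite !leq_max leqnn !orbT.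
  split=> [[y' [/= Pxy Qyz]]|[xx1 zz1 h]].
    have yQ := hNC _ _ xC Pxy.
    have [xx1 yy1 h1] := iffLR (hNP _ xP y') Pxy.
    have [_ zz1 h2] := iffLR (hNQ _ yQ z') Qyz.
    by split=> //; apply/(hd m (leqnn m) x' y' z').
  have [y' Pxy] := hNT _ xT; exists y'; split=> //=.
  have yQ := hNC _ _ xC Pxy.
  have [_ yy1 h1] := iffLR (hNP _ xP y') Pxy.
  apply/(hNQ _ yQ); split=> //.
  by apply/(hd m (leqnn m) x' y' z').
case: c c' {gP gQ} hP hQ => [[]|] [[]|] /= hP hQ.
- have [v _] := theta_left ZA (hQ m (leqnn m)); have [v' _] := theta_right ZA (hP m (leqnn m)).
  by case: (@zz_neq _ _ ZA (maxn n n')); rewrite -v -v'.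
- exists None => k mk x1 y1 z1 _ _ _ h1; split=> [h2|h2].
    exact: (@trel_inj Z (Some true) k x1 z1 y1 ZS h1 h2).
  exact: (theta_trunc h1 h2 (same_trunc_refl _)).
- exists (Some true) => k mk x1 y1 z1 _ _ _ h1; split=> [h2|h2].
    exact: (theta_trunc h1 (same_trunc_refl _) h2).
  exact: (@trel_fun Z (Some true) k x1 y1 z1 ZS h1 h2).
- exists None => k mk x1 y1 z1 _ _ _ h1; split=> [h2|h2].
    exact: (@trel_inj Z (Some false) k x1 z1 y1 ZS h1).
  exact: (theta_trunc h1 (same_trunc_refl _) h2).
- have [v _] := theta_left ZA (hP m (leqnn m)); have [v' _] := theta_right ZA (hQ m (leqnn m)).
  by case: (@zz_neq _ _ ZA (maxn n n')); rewrite -v -v'.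
- exists (Some false) => k mk x1 y1 z1 _ _ _ h1; split=> [h2|h2].
    exact: (theta_trunc h1 h2 (same_trunc_refl _)).
  exact: (@trel_fun Z (Some false) k x1 y1 z1 ZS h1 h2).
- exists (Some true) => k mk x1 y1 z1 _ _ _ h1; split=> [h2|h2].
    exact: (theta_trunc h2 (same_trunc_sym h1) (same_trunc_refl _)).
  exact: (theta_trunc h2 h1 (same_trunc_refl _)).
- exists (Some false) => k mk x1 y1 z1 _ _ _ h1; split=> [h2|h2].
    exact: (theta_trunc h2 (same_trunc_refl _) (same_trunc_sym h1)).
  exact: (theta_trunc h2 (same_trunc_refl _) h1).
exists None => k mk x1 y1 z1 _ _ _ h1; split=> h2; first exact: same_trunc_trans h1 h2.
exact: same_trunc_trans (same_trunc_sym h1) h2.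
Qed.

Lemma germ_restrict_l Z P c n x y (O : set (ipath B)) : germ Z P c n x y -> lcs O ->
  O x -> germ Z [set xy | P xy /\ O xy.1] c n x y.
Proof.
move=> [h [N hN]] [k hk] Ox; split=> //; exists (maxn N k) => x' xx' y'.
rewrite -hN; last exact: agree_maxl xx'.
split=> [[]//|]; split=> //=; apply: hk Ox; exact: agree_maxr xx'.
Qed.

Lemma germ_restrict_r Z P c n x y (O : set (ipath B)) : zigzag_system Z ->
  germ Z P c n x y -> lcs O -> O y -> germ Z [set xy | P xy /\ O xy.2] c n x y.
Proof.
move=> ZS gP [k hk] Oy; have [h [N hN]] := gP; split=> //.
have [N' hN'] := germ_cont k ZS gP.
exists (maxn N N') => x' xx' y'.
rewrite -hN; last exact: agree_maxl xx'.
split=> [[]//|Pxy]; split=> //=; apply: hk Oy; apply: hN' Pxy.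
exact: agree_maxr xx'.
Qed.

(** If [theta] holds at every level, the germ is of zigzag kind. Otherwise let m be the level after
    which it first fails: the step at m can only be a matched pair, the tails coincide from m.+2 on,
    and the germ is that of a tail move. *)
Lemma germ_theta0 Z x y : zigzag_system Z -> theta Z 0 x y ->
  exists c n, germ Z [set xy | theta Z 0 xy.1 xy.2] c n x y.
Proof.
move=> ZS h0; have ZA := zs_axioms ZS; pose P := [set xy : ipath B * ipath B | theta Z 0 xy.1 xy.2].
have start : exists N, forall x', agree N x x' -> forall y',
    P (x', y') <-> near Z (Some true) 0 x y x' y'.
  exists 0%N => x' xx' y'; split=> [h|[]//]; split=> //.
  rewrite /agree /initial /=; have [-> _] := theta_right ZA h0.
  by have [-> _] := theta_right ZA h.
have [hall|] := pselect (forall m, theta Z m x y).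
  by exists (Some true), 0%N; split=> [m _|]; [exact: hall|exact: start].
move=> /existsNP[m0 hm0].
have [m hm hm1] : exists2 m, (forall k, (k <= m)%N -> theta Z k x y) & ~ theta Z m.+1 x y.
  have [h|[m [h hm]]] : (forall k, (k <= m0)%N -> theta Z k x y) \/
      exists m, (forall k, (k <= m)%N -> theta Z k x y) /\ ~ theta Z m.+1 x y.
  - elim: m0 {hm0} => [|m0 [h|]]; [by left=> k; rewrite leqn0 => /eqP ->| |by right].
    have [h1|h1] := pselect (theta Z m0.+1 x y); last by right; exists m0.
    by left=> k; rewrite leq_eqVlt => /orP[/eqP -> //|]; exact: h.
  - by case: hm0; exact: h.
  by exists m.
have [N hN] : exists N, forall x', agree N x x' -> forall y',
    P (x', y') <-> near Z (Some true) m x y x' y'.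
  elim: m hm {hm1} => [//|m IH] hm.
  have [k km|N hN] := IH; first by apply: hm; exact: leqW.
  have [N' hN'] := near_raise_theta ZA (hm m (leqnSn m)) (hm m.+1 (leqnn _)).
  exists (maxn N N') => x' xx' y'; rewrite hN; last exact: agree_maxl xx'.
  by apply: hN'; exact: agree_maxr xx'.
have mm : (m <= m.+2)%N by exact: leqW.
case: (hm m (leqnn m)) => [i eu i' eu' hp v1 e1 f1 v2 e2 f2 t|i hi _ _ _ _ /hm1//].
exists None, m.+2; split=> [k mk|]; first exact: same_trunc_le t.
exists (maxn N m.+2) => x' xx' y'.
have xm : agree m.+2 x x' := agree_maxr xx'.
have ex : edge x' m = zL Z m i by rewrite -(agree_edge (leqnSn _) xm).
have fx : edge x' m.+1 = eu by rewrite -(agree_edge (leqnn _) xm).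
rewrite -/P hN; last exact: agree_maxl xx'.
split=> [[_ yy' h]|[_ yy' h]].
  have [ey fy t'] := theta_pair_inv ZA h hp ex fx.
  split=> //; apply: agreeS; last by rewrite f2 fy.
  by apply: agreeS yy' _; rewrite e2 ey.
split; [exact: agree_le xm|exact: agree_le yy'|].
apply: (@theta_pair _ _ _ _ _ i eu i' eu') => //.
- by rewrite -(agree_vtx mm xm).
- by rewrite -(agree_vtx mm yy').
- by rewrite -(agree_edge (leqnSn _) yy').
- by rewrite -(agree_edge (leqnn _) yy').
Qed.

End Germs.

(** * Images of clopen sets under a zigzag *)

Section Fans.
Variables (B : bratteli) (Z : zigzag B) (n : nat) (a : bpath B).
Hypotheses (ZL : left_axioms Z) (ha : in_E 0 n a) (ea : pend a = zLv Z n).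
Implicit Types (x : ipath B).

(** The part of aX on which the zigzag of level n is defined. *)
Definition fan : set (ipath B) :=
  [set x | starts a x /\ exists2 i, (i < zr Z n)%N & edge x n = zL Z n i].

Lemma fanE x : fan x <-> exists2 i, i \in iota 0 (zr Z n) & cyl (prcons a (zL Z n i)) x.
Proof.
split=> [[hx [i hi ex]]|[i]].
  by exists i; [rewrite mem_iota|apply/(starts_prcons _ _ ha)].
by rewrite mem_iota => hi /(starts_prcons _ _ ha)[hx ex]; split=> //; exists i.
Qed.

Lemma in_E_fan i : (i < zr Z n)%N -> in_E 0 n.+1 (prcons a (zL Z n i)).
Proof. by move=> hi; rewrite in_E_prcons ha ea; exact: (left_out ZL). Qed.

Lemma pend_fan i : (i < zr Z n)%N -> pend (prcons a (zL Z n i)) = zLv Z n.+1.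
Proof. by move=> hi; rewrite pend_prcons; exact: left_end. Qed.

Lemma fan_disjoint x i j : i \in iota 0 (zr Z n) -> j \in iota 0 (zr Z n) ->
  cyl (prcons a (zL Z n i)) x -> cyl (prcons a (zL Z n j)) x -> i = j.
Proof.
rewrite !mem_iota => hi hj /(starts_prcons _ _ ha)[_ e] /(starts_prcons _ _ ha)[_ e'].
by apply: (left_inj ZL hi hj); rewrite -e.
Qed.

Lemma lcs_fan_cyl i : i \in iota 0 (zr Z n) -> lcs (cyl (prcons a (zL Z n i))).
Proof. by rewrite mem_iota => hi; exists n.+1; apply: lc_cyl; exact: in_E_fan. Qed.

Lemma lcs_fan : lcs fan.
Proof. exact: lcs_bigU fanE lcs_fan_cyl. Qed.

Lemma mu_fan (hB : has_successors B) (A : zmodType) (m : nat -> bvert B -> A) :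
  harmonic m -> mu m fan = m n.+1 (zLv Z n.+1) *+ zr Z n.
Proof.
move=> hm; rewrite (mu_bigU hB hm (iota_uniq 0 _) fanE fan_disjoint lcs_fan_cyl).
rewrite (eq_big_seq (fun=> m n.+1 (zLv Z n.+1))) => [|i]; last first.
  by rewrite mem_iota => hi; rewrite (mu_cyl hB hm (in_E_fan hi)) pend_fan.
by rewrite big_const_seq count_predT size_iota iter_addr addr0.
Qed.

End Fans.

Section ThetaImages.
Variables (B : bratteli) (hB : has_successors B) (Z : zigzag B).
Hypothesis ZS : zigzag_system Z.
Variables (A : zmodType) (m : nat -> bvert B -> A).
Hypothesis hm : harmonic m.
Hypothesis hbal : forall n, m n.+1 (zLv Z n.+1) *+ zr Z n = m n.+1 (zRv Z n.+1) *+ zr Z n.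
Implicit Types (p q a b : bpath B) (x y : ipath B) (K L : set (ipath B)).

Let ZA := zs_axioms ZS.
Let ZL := zz_left ZA.
Let ZR := zz_right ZA.

Definition tim n a b K : set (ipath B) :=
  [set y | exists x, [/\ K x, starts a x, starts b y & theta Z n x y]].

Lemma pair_mem n i eu i' eu' : ((i, eu), (i', eu')) \in zpairs Z n ->
  (i, eu) \in unzip1 (zpairs Z n) /\ (i', eu') \in unzip1 (zpairs (zswap Z) n).
Proof.
move=> h; split; first by apply/mapP; eexists; first exact: h.
by apply/mapP; exists ((i', eu'), (i, eu)) => //; apply/mapP; eexists; first exact: h.
Qed.

(** Induction on the number d of levels beyond n on which K depends. Cutting along matched pairs
    alone might never end, since zigzags can be infinite; once K is decided it need not be cut any
    further. *)
Lemma theta_image_aux d n a b K : in_E 0 n a -> in_E 0 n b ->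
  pend a = zLv Z n -> pend b = zRv Z n -> lc (n + d)%N K ->
  lcs (tim n a b K) /\ mu m (K `&` fan Z n a) = mu m (tim n a b K).
Proof.
elim: d n a b => [|d IH] n a b ha hb ea eb hK.
  (* Now K is all or nothing on aX. In the first case the image is the whole right fan, and [hbal]
     says that the two fans have the same measure. *)
  rewrite addn0 in hK; have [[x0 [Kx0 ax0]]|nK] := pselect (exists x, K x /\ starts a x); last first.
    have e1 : K `&` fan Z n a = set0.
      by apply/seteqP; split=> // x [Kx [ax _]]; case: nK; exists x.
    have e2 : tim n a b K = set0.
      by apply/seteqP; split=> // y [x [Kx ax _ _]]; case: nK; exists x.
    by rewrite e1 e2; split=> //; exact: lcs0.
  have Ka x : starts a x -> K x.
    by move=> ax; apply: hK Kx0; exact: starts_agree ha ax0 ax.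
  have -> : K `&` fan Z n a = fan Z n a.
    by rewrite setIidr // => x [ax _]; exact: Ka.
  have -> : tim n a b K = fan (zswap Z) n b.
    apply/seteqP; split=> [y [x [_ _ hy /(theta_right ZA)[_ h]]]//|y [hy [i hi ey]]].
    have vy : ivtx y n = zRv Z n by rewrite (starts_vtx hb hy).
    have [x1 /theta_swap h1] := zs_total' ZS vy hi ey.
    have [v1 _] := theta_left ZA h1.
    have [x0' hx0'] := in_E_starts hB ha.
    have [x [x0x x1x]] := splice (etrans (starts_vtx ha hx0') (etrans ea (esym v1))).
    have ax : starts a x by exact: agree_starts ha x0x hx0'.
    exists x; split=> //; first exact: Ka.
    exact: (theta_trunc h1 x1x (same_trunc_refl _)).
  split; first exact: (lcs_fan ZR hb eb).
  by rewrite (mu_fan ZL ha ea hB hm) (mu_fan ZR hb eb hB hm); exact: hbal.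
(* The fan splits into the matched pairs, where [theta] is a tail move, and the non-last indices i
   along which the zigzag continues, where the induction hypothesis applies one level further. *)
pose J := ((nat * (blabel B * bvert B)) * (nat * (blabel B * bvert B)) + nat)%type.
pose KJ (j : J) := match j with
  | inl (w, _) => K `&` cyl (prcons (prcons a (zL Z n w.1)) w.2)
  | inr i => K `&` fan Z n.+1 (prcons a (zL Z n i))
  end.
pose LJ (j : J) := match j with
  | inl (w, z) => im (Ubasic n.+2 (prcons (prcons a (zL Z n w.1)) w.2)
      (prcons (prcons b (zR Z n z.1)) z.2)) (KJ j)
  | inr i => tim n.+1 (prcons a (zL Z n i)) (prcons b (zR Z n i)) K
  end.
pose s : seq J := [seq inl wz | wz <- zpairs Z n] ++ [seq inr i | i <- iota 0 (zr Z n).-1].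
have us : uniq s.
  rewrite cat_uniq !map_inj_uniq ?iota_uniq //; last first.
  - by move=> ? ? [].
  - by move=> ? ? [].
  rewrite (map_uniq (left_uniq ZL n)) andbT /=; apply/hasPn => _ /mapP[i _ ->].
  by apply/mapP => -[].
have sP (P : J -> Prop) : (forall w z, (w, z) \in zpairs Z n -> P (inl (w, z))) ->
    (forall i, (i.+1 < zr Z n)%N -> P (inr i)) -> forall j, j \in s -> P j.
  move=> h1 h2 j; rewrite mem_cat => /orP[/mapP[[w z] h ->]|/mapP[i hi ->]]; first exact: h1.
  by apply: h2; move: hi; rewrite mem_iota /= add0n; case: (zr Z n).
have sl w z : (w, z) \in zpairs Z n -> inl (w, z) \in s.
  by move=> h; rewrite mem_cat map_f.
have sr i : (i.+1 < zr Z n)%N -> inr i \in s.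
  by move=> h; rewrite mem_cat map_f ?orbT // mem_iota add0n; case: (zr Z n) h.
have [hL1 hR1] := (in_E_fan ZL ha ea, in_E_fan ZR hb eb).
have [eL1 eR1] := (pend_fan a ZL (n := n), pend_fan b ZR (n := n)).
have hp w z : (w, z) \in zpairs Z n ->
    [/\ in_E 0 n.+2 (prcons (prcons a (zL Z n w.1)) w.2),
        in_E 0 n.+2 (prcons (prcons b (zR Z n z.1)) z.2),
        (w.1 < zr Z n)%N, (z.1 < zr Z n)%N & w.2.2 = z.2.2].
  case: w z => i eu [i' eu'] h; have [/(left_mem ZL)[hi oi _] /(left_mem ZR)[hi' oi' _]] := pair_mem h.
  split=> //=; last exact: (zz_pair_end ZA h).
    by rewrite in_E_prcons hL1 // eL1.
  by rewrite in_E_prcons hR1 // eR1.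
have lK : lcs K by exists (n + d.+1)%N.
have lKJ j : j \in s -> lcs (KJ j).
  move: j; apply: sP => [w z /hp[h _ _ _ _]|i hi] /=.
    by apply: lcsI => //; exists n.+2; exact: lc_cyl.
  by apply: lcsI => //; apply: lcs_fan ZL (hL1 _ (ltnW hi)) (eL1 _ (ltnW hi)).
have IHr i : (i.+1 < zr Z n)%N -> lcs (LJ (inr i)) /\ mu m (KJ (inr i)) = mu m (LJ (inr i)).
  move=> hi; apply: IH; [exact: hL1 (ltnW hi)|exact: hR1 (ltnW hi)|
    exact: eL1 (ltnW hi)|exact: eR1 (ltnW hi)|by rewrite addSnnS].
have IHl w z : (w, z) \in zpairs Z n -> lcs (LJ (inl (w, z))) /\
    mu m (KJ (inl (w, z))) = mu m (LJ (inl (w, z))).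
  move=> h; have [h1 h2 _ _ e] := hp w z h.
  have l1 := lKJ _ (sl _ _ h); split; first by apply: tail_image => // x [].
  by apply: tail_mu => //; [rewrite !pend_prcons|move=> x []].
have lLJ j : j \in s -> lcs (LJ j).
  by move: j; apply: sP => [w z /IHl[]|i /IHr[]].
have cL w x : (w.1 < zr Z n)%N -> cyl (prcons (prcons a (zL Z n w.1)) w.2) x <->
    [/\ starts a x, edge x n = zL Z n w.1 & edge x n.+1 = w.2].
  move=> hw; split=> [/(starts_prcons _ _ (hL1 _ hw))[/(starts_prcons _ _ ha)[]] //|[h1 h2 h3]].
  by apply/(starts_prcons _ _ (hL1 _ hw)); split=> //; apply/(starts_prcons _ _ ha).
have cR w x : (w.1 < zr Z n)%N -> cyl (prcons (prcons b (zR Z n w.1)) w.2) x <->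
    [/\ starts b x, edge x n = zR Z n w.1 & edge x n.+1 = w.2].
  move=> hw; split=> [/(starts_prcons _ _ (hR1 _ hw))[/(starts_prcons _ _ hb)[]] //|[h1 h2 h3]].
  by apply/(starts_prcons _ _ (hR1 _ hw)); split=> //; apply/(starts_prcons _ _ hb).
have KE x : (K `&` fan Z n a) x <-> exists2 j, j \in s & KJ j x.
  split=> [[Kx [ax [i hi ei]]]|[j]].
    have [[hi1 hj]|ns] := pselect ((i.+1 < zr Z n)%N /\
        exists2 j, (j < zr Z n.+1)%N & edge x n.+1 = zL Z n.+1 j).
      by exists (inr i); [exact: sr|split=> //; split=> //; apply/(starts_prcons _ _ ha)].
    have /mapP[[w z] h ew] : (i, edge x n.+1) \in unzip1 (zpairs Z n).
      apply/(left_mem ZL); split=> //; rewrite -(left_end ZL hi) -ei; exact: edge_outs.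
    exists (inl (w, z)); first exact: sl.
    by split=> //; rewrite -[w]/(w, z).1 -ew; apply/(cL (i, edge x n.+1)).
  move: j; apply: sP => [w z h [Kx]|i hi [Kx [/(starts_prcons _ _ ha)[ax ex] _]]].
    have [_ _ hw _ _] := hp _ _ h; move=> /(cL w x hw)[ax ex _].
    by split=> //; split=> //; exists w.1.
  by split=> //; split=> //; exists i => //; exact: ltnW.
have LE y : tim n a b K y <-> exists2 j, j \in s & LJ j y.
  split=> [[x [Kx ax byy h]]|[j]].
    case: h => [i eu i' eu' h v1 e1 f1 v2 e2 f2 t|i h v1 e1 v2 e2 t].
      have [_ _ hw hz _] := hp _ _ h.
      exists (inl ((i, eu), (i', eu'))); first exact: sl.
      exists x; first by split=> //; apply/(cL (i, eu) x hw).
      by split=> //=; [apply/(cL (i, eu) x hw)|apply/(cR (i', eu') y hz)].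
    exists (inr i); first exact: sr.
    by exists x; split=> //; [apply/(starts_prcons _ _ ha)|apply/(starts_prcons _ _ hb)].
  move: j; apply: sP => [w z h|i hi].
    have [_ _ hw hz _] := hp _ _ h.
    move=> [x [Kx /(cL w x hw)[ax ex fx]] [_ /(cR z y hz)[byy ey fy] t]].
    exists x; split=> //.
    apply: (@theta_pair _ _ _ _ _ w.1 w.2 z.1 z.2) => //.
    - by rewrite -!surjective_pairing.
    - by rewrite (starts_vtx ha ax).
    - by rewrite (starts_vtx hb byy).
  move=> [x [Kx /(starts_prcons _ _ ha)[ax ex] /(starts_prcons _ _ hb)[byy ey] t]].
  exists x; split=> //; apply: (@theta_sing _ _ _ _ _ i) => //.
    by rewrite (starts_vtx ha ax).
  by rewrite (starts_vtx hb byy).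
have pswap w z : (w, z) \in zpairs Z n -> (z, w) \in zpairs (zswap Z) n.
  by move=> h; apply/mapP; exists (w, z).
split; first exact: lcs_bigU LE lLJ.
rewrite (mu_bigU hB hm us KE _ lKJ); last first.
  move=> x i j si sj; move: i si j sj; apply: (sP) => [w z h|i hi]; apply: (sP) => [w' z' h'|i' hi'].
  - have [[_ _ hw _ _] [_ _ hw' _ _]] := (hp _ _ h, hp _ _ h').
    move=> [_ /(cL w x hw)[_ e1 f1]] [_ /(cL w' x hw')[_ e2 f2]].
    by rewrite (left_pair_eq ZL h h') // -?e1 -?f1.
  - have [_ _ hw _ _] := hp _ _ h.
    move=> [_ /(cL w x hw)[_ e1 f1]] [_ [/(starts_prcons _ _ ha)[_ e2] hj]].
    by case: (left_pair_sing ZL h hi'); rewrite -?e1 -?f1.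
  - have [_ _ hw _ _] := hp _ _ h'.
    move=> [_ [/(starts_prcons _ _ ha)[_ e2] hj]] [_ /(cL w' x hw)[_ e1 f1]].
    by case: (left_pair_sing ZL h' hi); rewrite -?e1 -?f1.
  - move=> [_ [/(starts_prcons _ _ ha)[_ e1] _]] [_ [/(starts_prcons _ _ ha)[_ e2] _]].
    by congr inr; apply: (left_inj ZL (ltnW hi) (ltnW hi')); rewrite -e1.
rewrite (mu_bigU hB hm us LE _ lLJ); last first.
  move=> y i j si sj; move: i si j sj; apply: (sP) => [w z h|i hi]; apply: (sP) => [w' z' h'|i' hi'].
  - have [[_ _ _ hz _] [_ _ _ hz' _]] := (hp _ _ h, hp _ _ h').
    move=> [_ _ [_ /(cR z y hz)[_ e1 f1] _]] [_ _ [_ /(cR z' y hz')[_ e2 f2] _]].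
    have e3 : (z, w) = (z', w').
      by apply: (left_pair_eq ZR (pswap _ _ h) (pswap _ _ h')); rewrite /= -?e1 -?f1.
    by case: e3 => -> ->.
  - have [_ _ _ hz _] := hp _ _ h.
    move=> [_ _ [_ /(cR z y hz)[_ e1 f1] _]] [x [_ _ /(starts_prcons _ _ hb)[_ e2] /(theta_right ZA)[_ hj]]].
    by case: (left_pair_sing ZR (pswap _ _ h) hi'); rewrite /= -?e1 -?f1.
  - have [_ _ _ hz _] := hp _ _ h'.
    move=> [x [_ _ /(starts_prcons _ _ hb)[_ e2] /(theta_right ZA)[_ hj]]] [_ _ [_ /(cR z' y hz)[_ e1 f1] _]].
    by case: (left_pair_sing ZR (pswap _ _ h') hi); rewrite /= -?e1 -?f1.
  - move=> [x [_ _ /(starts_prcons _ _ hb)[_ e1] _]] [x' [_ _ /(starts_prcons _ _ hb)[_ e2] _]].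
    by congr inr; apply: (left_inj ZR (ltnW hi) (ltnW hi')); rewrite /= -e1.
by apply: eq_big_seq => j; move: j; apply: sP => [w z /IHl[]//|i /IHr[]//].
Qed.

End ThetaImages.

Lemma near_image (B : bratteli) (hB : has_successors B) (Z : zigzag B) (A : zmodType)
    (m : nat -> bvert B -> A) c n x y : zigzag_system Z -> harmonic m ->
  (forall n, m n.+1 (zLv Z n.+1) *+ zr Z n = m n.+1 (zRv Z n.+1) *+ zr Z n) ->
  trel Z c n x y ->
  exists N, forall K, lcs K -> (forall x', K x' -> agree N x x') ->
    lcs [set y' | exists2 x', K x' & near Z c n x y x' y'] /\
    mu m K = mu m [set y' | exists2 x', K x' & near Z c n x y x' y'].
Proof.
have main W : zigzag_system W -> harmonic m ->
    (forall n, m n.+1 (zLv W n.+1) *+ zr W n = m n.+1 (zRv W n.+1) *+ zr W n) ->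
    theta W n x y -> forall K, lcs K -> (forall x', K x' -> agree n.+1 x x') ->
    lcs [set y' | exists2 x', K x' & near W (Some true) n x y x' y'] /\
    mu m K = mu m [set y' | exists2 x', K x' & near W (Some true) n x y x' y'].
  move=> WS hm hbal h K [k hK] Kx.
  have [vx [i hi ei]] := theta_left (zs_axioms WS) h.
  have [vy _] := theta_right (zs_axioms WS) h.
  have hK' : lc (n + k)%N K by apply: lc_le hK; exact: leq_addl.
  have [l e] := theta_image_aux hB WS hm hbal (in_E_initial x n) (in_E_initial y n)
    (etrans (pend_initial x n) vx) (etrans (pend_initial y n) vy) hK'.
  have e1 : K `&` fan W n (initial x n) = K.
    rewrite setIidl // => x' Kx'; have xx' := Kx x' Kx'; split.
      by apply/starts_initial_agree; exact: agree_le xx'.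
    by exists i => //; rewrite -(agree_edge (leqnn _) xx').
  have e2 : tim W n (initial x n) (initial y n) K =
      [set y' | exists2 x', K x' & near W (Some true) n x y x' y'].
    apply/seteqP; split=> [y' [x' [Kx' ax yy t]]|y' [x' Kx' [xx' yy' t]]].
      by exists x' => //; split=> //; exact/starts_initial_agree.
    by exists x'; split=> //; exact/starts_initial_agree.
  by rewrite -e2 -e; split=> //; rewrite e1.
move=> ZS hm hbal; case: c => [[]|] h.
- by exists n.+1; exact: main.
- exists n.+1 => K lK hK.
  rewrite (_ : [set y' | _] = [set y' | exists2 x', K x' & near (zswap Z) (Some true) n x y x' y']).
    apply: (main _ (zswap_system ZS)) => //; last exact/theta_swap.
  apply/seteqP; split=> y' [x' Kx' h']; exists x' => //.
    exact: (iffLR (near_swap Z (Some false) n x y x' y')).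
  exact: (iffRL (near_swap Z (Some false) n x y x' y')).
exists n => K lK hK.
rewrite (_ : [set y' | _] = im (Ubasic n (initial x n) (initial y n)) K).
  have hKc : K `<=` cyl (initial x n) by move=> x' /hK/starts_initial_agree.
  split; first exact: tail_image (in_E_initial x n) (in_E_initial y n) lK hKc.
  apply: tail_mu (in_E_initial x n) (in_E_initial y n) _ lK hKc => //.
  by rewrite !pend_initial; have [] := h n (leqnn n).
apply/seteqP; split=> y' [x' Kx'].
  by move=> [xx' yy' t]; exists x' => //; split=> //; exact/starts_initial_agree.
by move=> [/= /starts_initial_agree xx' /starts_initial_agree yy' t]; exists x'.
Qed.

Lemma germ_image (B : bratteli) (hB : has_successors B) (Z : zigzag B) (A : zmodType)
    (m : nat -> bvert B -> A) P c n x y : zigzag_system Z -> harmonic m ->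
  (forall n, m n.+1 (zLv Z n.+1) *+ zr Z n = m n.+1 (zRv Z n.+1) *+ zr Z n) ->
  germ Z P c n x y ->
  exists N, forall K, lcs K -> (forall x', K x' -> agree N x x') ->
    lcs (im P K) /\ mu m K = mu m (im P K).
Proof.
move=> ZS hm hbal [h [N hN]].
have [N' hN'] := near_image hB ZS hm hbal (h n (leqnn n)).
exists (maxn N N') => K lK hK.
have [|l e] := hN' K lK.
  by move=> x' /hK; apply: agree_le; exact: leq_maxr.
rewrite (_ : im P K = [set y' | exists2 x', K x' & near Z c n x y x' y']) //.
apply/seteqP; split=> y' [x' Kx' h']; exists x' => //; move: h'; apply: (hN x' _ y').1 || apply: (hN x' _ y').2;
  by apply: agree_le (hK x' Kx'); exact: leq_maxl.
Qed.

(** * The relation generated by tail moves and the zigzag *)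

Section GeneratedRelation.
Variables (B : bratteli) (hB : has_successors B) (Z : zigzag B).
Hypothesis ZS : zigzag_system Z.
Variables (A : set (ipath B)) (phi : ipath B -> ipath B).
Hypothesis hA : forall x, A x <->
  ivtx x 0 = zLv Z 0 /\ exists2 i, (i < zr Z 0)%N & edge x 0 = zL Z 0 i.
Hypothesis hphi : forall x, A x -> theta Z 0 x (phi x).
Implicit Types (p q : bpath B) (x y z : ipath B) (K O : set (ipath B)).
Implicit Types (P U : set (ipath B * ipath B)).
Local Notation G := (generated_rel A phi).

Let ZA := zs_axioms ZS.

Lemma theta0_graph x y : theta Z 0 x y <-> A x /\ y = phi x.
Proof.
split=> [h|[Ax ->]]; last exact: hphi.
have Ax : A x by apply/hA; exact: (theta_left ZA h).
split=> //; apply: same_trunc0; exact: (theta_fun ZA h (hphi Ax)).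
Qed.

Lemma theta0_inj x x' y : theta Z 0 x y -> theta Z 0 x' y -> x = x'.
Proof.
move=> h h'; apply: same_trunc0; exact: (@trel_inj _ Z (Some true) 0 x x' y ZS h h').
Qed.

Lemma lcs_A : lcs A.
Proof.
exists 1%N => x y xy /hA[vx [i hi ex]]; apply/hA; split.
  by rewrite -(agree_vtx (leqnSn 0) xy).
by exists i => //; rewrite -(agree_edge (leqnn _) xy).
Qed.

Lemma germ_swap P c n x y : germ (zswap Z) P c n x y -> germ Z P (flip c) n x y.
Proof.
move=> [h [N hN]]; split=> [m /h|].
  by move/(trel_swap (zswap Z) c m x y); rewrite zswapK.
exists N => x' /hN hN' y'; apply: (iff_trans (hN' y')).
by have := near_swap (zswap Z) c n x y x' y'; rewrite zswapK.
Qed.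

Lemma germ_factor U x y : factors A phi U -> U (x, y) -> exists c n, germ Z U c n x y.
Proof.
case=> [[W [cW oW ir is_] ->]|[K /clopen_lc[k hK] ->]|[O [/clopen_lc lO OA ->]]|[O [/clopen_lc lO OA ->]]].
(* Near x the bisection W is a basic set U_{w,z} contained in it: the arrow of W with range x' must
   be the one from U_{w,z}, the range map being injective on W. *)
- move=> [g Wg eg]; have [P [bP Pg hP]] := open_gpdP (etale_tail_rel hB) oW Wg.
  case: bP => l [w [z [hw hz e eP]]]; subst P; rewrite eg in Pg; case: Pg => /= hx hy xy.
  have sub x' y' : Ubasic l w z (x', y') -> (@gpair _ (tail_rel B) @` W) (x', y').
    move=> Uxy; have bU : er_base (tail_rel B) (Ubasic l w z) by exists l, w, z.
    have [h eh] := gpd_of (etale_tail_rel hB) bU Uxy.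
    by exists h => //; apply: hP; rewrite eh.
  exists None, l; split=> [m lm|]; first exact: same_trunc_le xy.
  exists l => x' xx' y'; split=> [[h Wh eh]|[_ yy' t]]; last first.
    by apply: sub; split=> //=; [exact: agree_starts xx' hx|exact: agree_starts yy' hy].
  have hx' := agree_starts hw xx' hx.
  have [y1 [hy1 t1]] := tail_total hB hw hz e hx'.
  have [h1 Wh1 eh1] := sub x' y1 (And3 hx' hy1 t1).
  have hh : h = h1 by apply: ir; rewrite ?inE // /rg eh eh1.
  have -> : y' = y1 by move: eh1; rewrite -hh eh => -[].
  by split=> //; exact: starts_agree hz hy hy1.
- move=> [x0 Kx [<- <-]]; exists None, 0%N; split=> // ; exists k => x' xx' y'.
  split=> [[x1 Kx1 [e1 e2]]|[h0 _ /same_trunc0 <-]].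
    by rewrite -e2 e1; split=> //; apply: agree_le xx'; exact: leq0n.
  by exists x' => //; exact: hK xx' Kx.
- move=> [x0 Ox [<- <-]]; have [c [n g]] := germ_theta0 ZS (hphi (OA _ Ox)).
  exists c, n; rewrite (_ : [set _ | _ in O] = [set xy | theta Z 0 xy.1 xy.2 /\ O xy.1]).
    exact: (germ_restrict_l g).
  apply/seteqP; split=> [_ [x1 Ox1 <-]|[x1 y1] [/= /theta0_graph[_ ->] Ox1]].
    by split=> //=; exact/hphi/OA.
  by exists x1.
move=> [x0 Ox [<- <-]].
have h0 : theta (zswap Z) 0 (phi x0) x0 by apply/theta_swap/hphi/OA.
have [c [n g]] := germ_theta0 (zswap_system ZS) h0.
exists (flip c), n.
rewrite (_ : [set _ | _ in O] = [set xy | theta (zswap Z) 0 xy.1 xy.2 /\ O xy.2]).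
  exact: (germ_restrict_r ZS (germ_swap g)).
apply/seteqP; split=> [_ [x1 Ox1 <-]|[x1 y1] [/= /theta_swap/theta0_graph[_ ->] Ox1]].
  by split=> //=; exact/theta_swap/hphi/OA.
by exists y1.
Qed.

Lemma germ_product P x y : finite_product (factors A phi) P -> P (x, y) ->
  exists c n, germ Z P c n x y.
Proof.
move=> hP; elim: hP x y => [U hU|U W hU _ IH] x y; first exact: germ_factor.
move=> [z [/= Uxz Wzy]].
have [c [n g]] := germ_factor hU Uxz; have [c' [n' g']] := IH _ _ Wzy.
exact: germ_comp ZS g g'.
Qed.

Lemma factor_inj U x x' y : factors A phi U -> U (x, y) -> U (x', y) -> x = x'.
Proof.
case=> [[W [cW oW ir is_] ->]|[K _ ->]|[O [_ OA ->]]|[O [_ OA ->]]].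
- move=> [g Wg eg] [g' Wg' eg']; have e : g = g' by apply: is_; rewrite ?inE // /sc eg eg'.
  by move: eg'; rewrite -e eg => -[].
- by move=> [a _ [<- <-]] [b _ [<- <-]].
- move=> [a Oa [<- <-]] [b Ob [<- e]].
  by apply: (theta0_inj (hphi (OA _ Oa))); rewrite -e; exact/hphi/OA.
- by move=> [a _ [<- <-]] [b _ [<- <-]].
Qed.

Lemma product_inj P x x' y : finite_product (factors A phi) P ->
  P (x, y) -> P (x', y) -> x = x'.
Proof.
move=> hP; elim: hP x x' y => [U hU|U W hU _ IH] x x' y; first exact: factor_inj.
move=> [z [/= Uxz Wzy]] [z' [/= Uxz' Wzy']].
by have e := IH _ _ _ Wzy Wzy'; rewrite -e in Uxz'; exact: factor_inj hU Uxz Uxz'.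
Qed.

Lemma factor_sub U x y : factors A phi U -> U (x, y) -> er G (x, y).
Proof.
case=> [[W _ ->]|[K _ ->]|[O [_ OA ->]]|[O [_ OA ->]]].
- by move=> [g _ eg]; apply: rst_step; left; rewrite -eg; exact: gpairP.
- by move=> [a _ [<- <-]]; exact: rst_refl.
- by move=> [a Oa [<- <-]]; apply: rst_step; right; split=> //; exact: OA.
- by move=> [a Oa [<- <-]]; apply/rst_sym/rst_step; right; split=> //; exact: OA.
Qed.

Lemma product_sub P x y : finite_product (factors A phi) P -> P (x, y) -> er G (x, y).
Proof.
move=> hP; elim: hP x y => [U hU|U W hU _ IH] x y; first exact: factor_sub.
move=> [z [/= Uxz Wzy]]; apply: rst_trans (IH _ _ Wzy).
exact: factor_sub hU Uxz.
Qed.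

Lemma Ubasic_factor l (w z : bpath B) : in_E 0 l w -> in_E 0 l z -> pend w = pend z ->
  factors A phi (Ubasic l w z).
Proof.
move=> hw hz e; have [W [cW eW]] := Ubasic_bisection hB hw hz e.
by apply: Or41; exists W.
Qed.

Lemma tail_factor x y : er (tail_rel B) (x, y) -> exists2 U, factors A phi U & U (x, y).
Proof.
move=> /(eb_cov (etale_tail_rel hB))[_ [l [w [z [hw hz e ->]]]] Uxy].
by exists (Ubasic l w z) => //; exact: Ubasic_factor.
Qed.

Lemma product_trans P x y z Q : finite_product (factors A phi) P ->
  finite_product (factors A phi) Q -> P (x, y) -> Q (y, z) ->
  exists2 R, finite_product (factors A phi) R & R (x, z).
Proof.
move=> hP; elim: hP x y => [U hU|U W hU _ IH] x y hQ.
  by move=> Uxy Qyz; exists (comp_rel U Q); [exact: prod_cons|exists y].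
move=> [t [/= Uxt Wty]] Qyz; have [R hR Rtz] := IH _ _ hQ Wty Qyz.
by exists (comp_rel U R); [exact: prod_cons|exists t].
Qed.

Lemma factor_inv U x y : factors A phi U -> U (x, y) ->
  exists2 V, factors A phi V & V (y, x).
Proof.
case=> [[W _ ->]|[K cK ->]|[O [cO OA ->]]|[O [cO OA ->]]].
- move=> [g _ eg]; apply: tail_factor; have [l] := gpairP g; rewrite eg => h.
  by exists l; exact: same_trunc_sym.
- by move=> [a Ka [<- <-]]; exists [set (x, x) | x in K]; [apply: Or42; exists K|exists a].
- by move=> [a Ka [<- <-]]; exists [set (phi x, x) | x in O]; [apply: Or44; exists O|exists a].
- by move=> [a Ka [<- <-]]; exists [set (x, phi x) | x in O]; [apply: Or43; exists O|exists a].
Qed.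

Lemma product_inv P x y : finite_product (factors A phi) P -> P (x, y) ->
  exists2 Q, finite_product (factors A phi) Q & Q (y, x).
Proof.
move=> hP; elim: hP x y => [U hU|U W hU _ IH] x y.
  by move=> /(factor_inv hU)[V hV Vyx]; exists V => //; exact: prod_one.
move=> [z [/= Uxz Wzy]]; have [R hR Ryz] := IH _ _ Wzy.
have [V hV Vzx] := factor_inv hU Uxz.
exact: product_trans hR (prod_one hV) Ryz Vzx.
Qed.

Lemma product_cov x y : er G (x, y) -> exists2 P, finite_product (factors A phi) P & P (x, y).
Proof.
rewrite /=; elim=> {x y} [x y [/tail_factor[U hU Uxy]|[Ax ->]]|x|x y _ [P hP Pxy]|x y z _ [P hP Pxy] _ [Q hQ Qyz]].
- by exists U => //; exact: prod_one.
- exists [set (x, phi x) | x in A]; last by exists x.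
  by apply/prod_one/Or43; exists A; split=> //; apply/clopen_lc; exact: lcs_A.
- exists [set (x, x) | x in setT]; last by exists x.
  by apply/prod_one/Or42; exists setT => //; split; [exact: openT|exact: closedT].
- exact: product_inv hP Pxy.
exact: product_trans hP hQ Pxy Qyz.
Qed.

Lemma etale_generated_rel : etale_basis G.
Proof.
split.
- by move=> P x x' y hP; exact: product_inj.
- move=> P x y y' hP Pxy Pxy'; have [c [n [h [N hN]]]] := germ_product hP Pxy.
  have [_ yy' t'] := iffLR (hN x (agree_refl N x) y') Pxy'.
  exact: agree_trunc_eq yy' (trel_fun ZS (h n (leqnn n)) t').
- by move=> P [x y] hP; exact: product_sub.
- by move=> [x y]; exact: product_cov.
- move=> P P' x y hP hP' Pxy P'xy.
  have [c [n g]] := germ_product hP Pxy; have [c' [n' g']] := germ_product hP' P'xy.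
  have [N hN] := germ_eq ZS g g'.
  by exists N => x' y' xx' Px'; exact: (iffLR (hN x' y' xx') Px').
- move=> P x y n hP Pxy; have [c [k g]] := germ_product hP Pxy.
  have [N hN] := germ_cont n ZS g.
  (* Multiplying P from the left by the identity of a small cylinder restricts it without leaving
     the basis. *)
  pose K := cyl (initial x (maxn n N)).
  have cK : clopen K by apply/clopen_lc; exists (maxn n N); exact: lc_cyl (in_E_initial x _).
  exists (comp_rel [set (x, x) | x in K] P); split.
  + by apply: prod_cons hP; apply: Or42; exists K.
  + by exists x; split=> //; exists x => //; exact/starts_initial_agree.
  move=> x' y' [z [/= [u /starts_initial_agree xx' [e1 e2]] Pz]].
  rewrite -e2 e1 in Pz; rewrite e1 in xx'; split=> //.
    exact: agree_maxl xx'.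
  by apply: hN Pz; exact: agree_maxr xx'.
- move=> P x y hP Pxy; have [c [k g]] := germ_product hP Pxy.
  exact: germ_total ZS g.
move=> P x y hP Pxy; have [c [k g]] := germ_product hP Pxy.
(* The zero weight is harmonic and balanced; it gives access to the topological half of
   [germ_image]. *)
have hm : @harmonic B int (fun _ _ => 0).
  by move=> l v _; rewrite big1 // => u _; rewrite mul0rn.
have [|N hN] := germ_image hB ZS hm _ g; first by [].
by exists N => K lK /(hN K lK)[].
Qed.

Lemma preserves_generated_rel (T : zmodType) (m : nat -> bvert B -> T) : harmonic m ->
  (forall n, m n.+1 (zLv Z n.+1) *+ zr Z n = m n.+1 (zRv Z n.+1) *+ zr Z n) ->
  preserves m G.
Proof.
move=> hm hbal P x y hP Pxy; have [c [k g]] := germ_product hP Pxy.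
have [N hN] := germ_image hB ZS hm hbal g.
by exists N => K lK /(hN K lK)[].
Qed.

Lemma generated_tail_cls l p q : in_E 0 l p -> in_E 0 l q -> pend p = pend q ->
  cls G (cyl p) = cls G (cyl q).
Proof.
apply: (tail_cls_of_base hB etale_generated_rel) => {}l w z hw hz e.
by apply: prod_one; exact: Ubasic_factor.
Qed.

(** As every [zr] exceeds 1, the index 0 is never the last one; the zigzag therefore continues along
    this path at each level and carries it to the corresponding path of the other side. *)
Fixpoint zpath (Y : zigzag B) n : bpath B :=
  if n is n'.+1 then prcons (zpath Y n') (zL Y n' 0) else (zLv Y 0, [::]).

Lemma in_E_zpath Y n : left_axioms Y -> in_E 0 n (zpath Y n) /\ pend (zpath Y n) = zLv Y n.
Proof.
move=> YL; elim: n => [|n [IH1 IH2]] /=.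
  by rewrite /in_E /= (left_vlev YL).
have r0 : (0 < zr Y n)%N by apply: ltnW; exact: (left_r YL).
rewrite in_E_prcons IH1 IH2 pend_prcons; split; first exact: (left_out YL).
exact: (left_end YL).
Qed.

Lemma phi_zpath n x i : starts (zpath Z n) x -> (i < zr Z n)%N -> edge x n = zL Z n i ->
  [/\ A x, starts (zpath (zswap Z) n) (phi x) & theta Z n x (phi x)].
Proof.
have ZL := zz_left ZA; have ZR := zz_right ZA.
elim: n i => [|n IH] i hx hi ex.
  have Ax : A x.
    apply/hA; split; last by exists i.
    by have [h _] := in_E_zpath 0 ZL; rewrite (starts_vtx h hx).
  split=> //; last exact: hphi.
  have [vy _] := theta_right ZA (hphi Ax).
  by rewrite /starts /initial /= vy.
have [hE _] := in_E_zpath n ZL.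
have [hx1 ex1] := iffLR (starts_prcons _ _ hE) hx.
have r1 : (1 < zr Z n)%N := left_r ZL n.
have [Ax hy t] := IH 0%N hx1 (ltnW r1) ex1.
have [ey t1] := theta_sing_inv ZA t r1 ex1 (ex_intro2 _ _ i hi ex).
split=> //=; have [hE' _] := in_E_zpath n ZR.
exact/(starts_prcons _ _ hE').
Qed.

Lemma cls_fan Y n : left_axioms Y ->
  cls G (fan Y n (zpath Y n)) = vcls G n.+1 (zLv Y n.+1) *+ zr Y n.
Proof.
move=> YL; have [hE eE] := in_E_zpath n YL.
rewrite (cls_bigU G (iota_uniq 0 _) (fanE Y hE) (fan_disjoint YL hE) (lcs_fan_cyl YL hE eE)).
rewrite (eq_big_seq (fun=> vcls G n.+1 (zLv Y n.+1))) => [|i]; last first.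
  rewrite mem_iota => hi; rewrite (vclsE generated_tail_cls (in_E_fan YL hE eE hi)).
  by rewrite (pend_fan _ YL).
by rewrite big_const_seq count_predT size_iota iter_addr addr0.
Qed.

(** [phi] maps the fan at the end of the left [zpath] onto the fan at the end of the right one, and
    each fan is a disjoint union of [zr Z n] cylinders of one class. In the main construction this
    number is r_{n+1}. *)
Lemma cls_fan_balance n :
  vcls G n.+1 (zLv Z n.+1) *+ zr Z n = vcls G n.+1 (zRv Z n.+1) *+ zr Z n.
Proof.
have ZL := zz_left ZA; have ZR := zz_right ZA.
rewrite -(cls_fan n ZL) -[RHS](cls_fan n ZR).
have [[hL eL] [hR eR]] := (in_E_zpath n ZL, in_E_zpath n ZR).
have [lL lR] := (lcs_fan ZL hL eL, lcs_fan ZR hR eR).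
pose P := [set (x, phi x) | x in fan Z n (zpath Z n)].
have fanA : fan Z n (zpath Z n) `<=` A by move=> x [hx [i hi ex]]; have [] := phi_zpath hx hi ex.
have bP : er_base G P.
  by apply/prod_one/Or43; exists (fan Z n (zpath Z n)); split=> //; apply/clopen_lc.
have [x Kx|bW rW sW] := co_bisection_base etale_generated_rel bP lL.
  by exists (phi x), x.
have [K eK] := lcs_copen lL; have [L eL'] := lcs_copen lR.
rewrite eK eL' !cls_copen; apply/esym/ts_piP/(ts_bisection bW); last by rewrite rW.
rewrite sW -eL'; apply/seteqP; split=> [y [hy [i hi ey]]|y [x Kx [x' [hx [i hi ex]] [_ <-]]]]; last first.
  have [_ hy t] := phi_zpath hx hi ex; split=> //.
  by have [_ [j hj ej]] := theta_right ZA t; exists j.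
have vy : ivtx y n = zRv Z n by rewrite (starts_vtx hR hy).
(* To reach y, a path x1 related to it from level n on is taken, its beginning is exchanged for
   [zpath Z n], and [theta_fun] forces the image under [phi] to be y. *)
have [x1 /theta_swap h1] := zs_total' ZS vy hi ey.
have [v1 [j hj ej]] := theta_left ZA h1.
have [x0 hx0] := in_E_starts hB hL.
have [x [x0x x1x]] := splice (etrans (starts_vtx hL hx0) (etrans eL (esym v1))).
have hx : starts (zpath Z n) x := agree_starts hL x0x hx0.
have ex : edge x n = zL Z n j by rewrite -(same_trunc_edge (leqnn n) x1x).
have [Ax hy' t] := phi_zpath hx hj ex.
exists x; first by split=> //; exists j.
exists x; first by split=> //; exists j.
congr pair; apply/esym/(starts_trunc_eq hR hy hy').
exact: (theta_fun ZA (theta_trunc h1 x1x (same_trunc_refl _)) t).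
Qed.

End GeneratedRelation.

(** * The zigzag of the main construction *)

Section Recipes.
Variable B : bratteli.
Implicit Types (rho : recipe B) (a b p : bpath B).

Lemma imfset_pcat a b (A : {fset bpath B}) :
  [fset pcat a p | p in [fset pcat b p | p in A]]%fset = [fset pcat (pcat a b) p | p in A]%fset.
Proof.
apply/fsetP => p; apply/imfsetP/imfsetP => /= [[q /imfsetP[/= s hs ->] ->]|[s hs ->]].
  by exists s => //; rewrite pcatA.
by exists (pcat b s); rewrite ?pcatA //; apply/imfsetP; exists s.
Qed.

Lemma pullback_pullback a a' b b' rho :
  pullback a b (pullback a' b' rho) = pullback (pcat a a') (pcat b b') rho.
Proof.
apply/funext => s; rewrite /pullback /= !imfset_pcat -map_comp.
by congr RNode; apply: eq_map => -[w z] /=; rewrite !pcatA.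
Qed.

Lemma rev_pullback a b rho : rev_recipe (pullback a b rho) = pullback b a (rev_recipe rho).
Proof.
by apply/funext => s; rewrite /pullback /rev_recipe /= -!map_comp.
Qed.

Lemma rev_recipeK rho : rev_recipe (rev_recipe rho) = rho.
Proof.
apply/funext => s; rewrite /rev_recipe /= -map_comp.
by case: (rho s) => A C P n /=; congr RNode; rewrite map_id_in // => -[].
Qed.

End Recipes.

Section MainZigzag.
Variables (D : zmodType) (Dp : set D) (E : zmodClosed rat) (M : main_data Dp E).
Local Notation C := (Cdiag M).
Implicit Types (x y : ipath C) (p q a b : bpath C) (rho : recipe C).

Lemma r_gt1 n : (1 < r_ M n.+1)%N.
Proof.
elim: n => [|n IH]; first exact: (r_1 M).
exact: leq_trans IH (dvdn_leq (r_gt0 M _) (r_dvd M _)).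
Qed.

Lemma Tvert_lev l u : u \in vlev C l -> Tvert l u \in vlev (BD M) l.
Proof. by case: u => [u|] /=; rewrite ?C_lev_Some // => _; exact: wa_lev. Qed.

Lemma r_div_gt0 l : (0 < r_ M l.+1 %/ r_ M l)%N.
Proof. by rewrite divn_gt0 ?r_gt0 // dvdn_leq ?r_gt0 ?r_dvd. Qed.

Lemma card_F_le l u : u \in vlev C l -> (#|` F_ M l u| <= r_ M l.+1)%N.
Proof.
case: u => [u|] /=; rewrite ?C_lev_Some ?C_lev_None => hu; last first.
  by rewrite F_wb_card // leq_div.
have [->|nu] := eqVneq u (wa M l); first by rewrite F_wa_card.
by rewrite F_other // cardfs0.
Qed.

Lemma BD_successors : has_successors (BD M).
Proof.
move=> l u hu; have h := BD_edges hu (wa_lev M l.+1).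
have : (0 < #|` elab l u (wa M l.+1)|)%N by apply: leq_trans h; rewrite addn_gt0 r_gt0.
rewrite cardfs_gt0 => /fset0Pn[e he]; exists (e, wa M l.+1).
by rewrite mem_outs /= wa_lev he.
Qed.

(** F(u) has at most r_{l+1} labels, and the extra d_{l+1} in [BD_edges] leaves an edge from u to
    w_a^{l+1}. *)
Lemma C_successors : has_successors C.
Proof.
move=> l u hu; have h := BD_edges (Tvert_lev hu) (wa_lev M l.+1).
have [h0|/fset0Pn[e he]] := eqVneq (elab l (Tvert l u) (wa M l.+1) `\` F_ M l u)%fset fset0.
  have /fsubset_leq_card h1 : (elab l (Tvert l u) (wa M l.+1) `<=` F_ M l u)%fset.
    by rewrite -fsetD_eq0 h0.
  have := leq_trans h (leq_trans h1 (card_F_le hu)).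
  by rewrite -[X in (_ <= X)%N]addn0 leq_add2l leqNgt r_div_gt0.
exists (e, Some (wa M l.+1)); rewrite mem_outs; apply/andP; split.
  by change (is_true (Some (wa M l.+1) \in C_lev M l.+1)); rewrite C_lev_Some wa_lev.
by rewrite /= eqxx.
Qed.

(* [main_recipe] is a proposition, so the recipes at all levels have to be
   chosen: [stages] below is such a choice. *)
Record stage n := Stage {
  stA : 'I_(r_ M n.+1) -> bpath C;
  stB : 'I_(r_ M n.+1) -> bpath C;
  strec : recipe C;
  stP : main_recipe (l := n.+1) n stA stB strec }.

(** The construction recurs on (M_B, M_A): hence M_A is [stB t] and M_B is [stA t], and the recipe
    of t enters reversed. *)
Record stage_step n (s : stage n) (t : stage n.+1) : Prop := StageStep {
  ss_A : admissible n (Some (wa M n.+1)) (stA s);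
  ss_B : admissible n None (stB s);
  ss_MA : forall j, in_E n.+1 n.+2 (stB t j) /\ (stB t j).1 = Some (wa M n.+1);
  ss_MB : forall j, in_E n.+1 n.+2 (stA t j) /\ (stA t j).1 = None;
  ss_rA : rA (strec s) = [fset stA s i | i in 'I_(r_ M n.+1)]%fset;
  ss_rB : rB (strec s) = [fset stB s i | i in 'I_(r_ M n.+1)]%fset;
  ss_sub : rsub (strec s) = (r_ M n.+1).-1;
  ss_rec : forall i : 'I_(r_ M n.+1), (i.+1 < r_ M n.+1)%N ->
    subrecipe (strec s) i = pullback (stA s i) (stB s i) (rev_recipe (strec t));
  ss_remA : lists_remaining n (stA s) (stB t) (unzip1 (rpairs (strec s)));
  ss_remB : lists_remaining n (stB s) (stA t) (unzip2 (rpairs (strec s)));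
  ss_end : forall w z, (w, z) \in rpairs (strec s) -> pend w = pend z }.

Lemma stage_next n (s : stage n) : exists t : stage n.+1, stage_step s t.
Proof.
case: s => zA zB rho h; move: (h) => h0; case: h0 => MA MB rho' hkl aA aB iMA hMA iMB hMB h' eA eB es er lA lB he.
exists (Stage h'); split=> //= j.
  by have [h1 h2 _] := iffLR (hMA (MA j)) (ex_intro _ j erefl).
by have [h1 h2 _] := hMB j.
Qed.

Section Stages.
Variable s0 : stage 0.

Definition stages n : stage n :=
  nat_rect stage s0 (fun n s => projT1 (cid (stage_next s))) n.

Lemma stagesP n : stage_step (stages n) (stages n.+1).
Proof. exact: projT2 (cid (stage_next (stages n))). Qed.

Definition side (c : bool) n : 'I_(r_ M n.+1) -> bpath C :=
  if c then stA (stages n) else stB (stages n).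

Arguments side : clear implicits.

(** Every stage works at level n.+1 of Trunc_n(C), so its paths are single edges, and coinciding up
    to level n just means having the same initial vertex. *)
Lemma admissible_shape n e (z : 'I_(r_ M n.+1) -> bpath C) : admissible n e z ->
  exists (v : bvert C) (f : nat -> blabel C * bvert C),
  [/\ forall i, z i = (v, [:: f i]), v \in vlev C n,
      forall i, (i < r_ M n.+1)%N -> f i \in outs n v /\ (f i).2 = e
    & forall i j, (i < r_ M n.+1)%N -> (j < r_ M n.+1)%N -> f i = f j -> i = j].
Proof.
move=> [zi zE zc]; pose o : 'I_(r_ M n.+1) := Ordinal (r_gt0 M n.+1); pose v := (z o).1.
have shape i : exists eu, z i = (v, [:: eu]).
  have [/size_in_E + _] := zE i; have /(congr1 fst) /= := zc i o.
  rewrite /v; case: (z i) => u [|eu [|eu' s]] //= <-; rewrite ?addn0 ?addn1 ?addnS => hs.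
  - by move/eqP: hs; rewrite ltn_eqF.
  - by exists eu.
  - by move/eqP: hs; rewrite gtn_eqF // !ltnS leq_addr.
have [f0 hf0] := choice shape.
exists v, (fun k => f0 (odflt o (insub k))).
have fE i (hi : (i < r_ M n.+1)%N) : odflt o (insub i) = Ordinal hi by rewrite insubT.
split=> [i|||i j hi hj]; first by rewrite valK.
- by have [/and3P[]] := zE o.
- move=> i hi; rewrite fE; have [h1 h2] := zE (Ordinal hi); rewrite hf0 in h1 h2.
  move: h1; rewrite -[(v, _)]/(prcons (v, [::]) _) in_E_prcons => /andP[_ h1].
  by split.
by rewrite !fE => e'; have /zi[] : z (Ordinal hi) = z (Ordinal hj) by rewrite !hf0 e'.
Qed.

Lemma side_data : exists (v : bool -> nat -> bvert C)
    (f : bool -> nat -> nat -> blabel C * bvert C), forall c n,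
  [/\ forall i, side c n i = (v c n, [:: f c n i]), v c n \in vlev C n,
      forall i, (i < r_ M n.+1)%N -> f c n i \in outs n (v c n) /\
        (f c n i).2 = if c then Some (wa M n.+1) else None
    & forall i j, (i < r_ M n.+1)%N -> (j < r_ M n.+1)%N -> f c n i = f c n j -> i = j].
Proof.
have h (cn : bool * nat) : exists vf : bvert C * (nat -> blabel C * bvert C),
  [/\ forall i, side cn.1 cn.2 i = (vf.1, [:: vf.2 i]) :> bpath C, vf.1 \in vlev C cn.2,
      forall i, (i < r_ M cn.2.+1)%N -> vf.2 i \in outs cn.2 vf.1 /\
        (vf.2 i).2 = if cn.1 then Some (wa M cn.2.+1) else None
    & forall i j, (i < r_ M cn.2.+1)%N -> (j < r_ M cn.2.+1)%N -> vf.2 i = vf.2 j -> i = j].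
  case: cn => -[] n.
    by have [v [f hf]] := admissible_shape (ss_A (stagesP n)); exists (v, f).
  by have [v [f hf]] := admissible_shape (ss_B (stagesP n)); exists (v, f).
have [F hF] := choice h.
by exists (fun c n => (F (c, n)).1), (fun c n => (F (c, n)).2) => c n; exact: (hF (c, n)).
Qed.

Variables (v : bool -> nat -> bvert C) (f : bool -> nat -> nat -> blabel C * bvert C).
Hypothesis hvf : forall c n,
  [/\ forall i, side c n i = (v c n, [:: f c n i]), v c n \in vlev C n,
      forall i, (i < r_ M n.+1)%N -> f c n i \in outs n (v c n) /\
        (f c n i).2 = if c then Some (wa M n.+1) else None
    & forall i j, (i < r_ M n.+1)%N -> (j < r_ M n.+1)%N -> f c n i = f c n j -> i = j].

Lemma v_succ c n : v c n.+1 = if c then None else Some (wa M n.+1).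
Proof.
have [h1 _ _ _] := hvf c n.+1; pose o : 'I_(r_ M n.+2) := Ordinal (r_gt0 M n.+2).
have := h1 o; rewrite /side; case: c {h1} => /= e.
  by have [_] := ss_MB (stagesP n) o; rewrite e.
by have [_] := ss_MA (stagesP n) o; rewrite e.
Qed.

Lemma f_end c n i : (i < r_ M n.+1)%N -> (f c n i).2 = v (~~ c) n.+1.
Proof. by move=> hi; have [_ _ h _] := hvf c n; have [_ ->] := h i hi; rewrite v_succ; case: c {h}. Qed.

Definition sided (c : bool) (wz : bpath C * bpath C) := if c then wz.1 else wz.2.

Lemma remaining c n p : p \in map (sided c) (rpairs (strec (stages n))) <->
  exists i eu, [/\ p = (v c n, [:: f c n i; eu]), (i < r_ M n.+1)%N,
    eu \in outs n.+1 (v (~~ c) n.+1) &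
    ~ ((i.+1 < r_ M n.+1)%N /\ exists2 j, (j < r_ M n.+2)%N & eu = f (~~ c) n.+1 j)].
Proof.
have [hs hv hf hinj] := hvf c n; have [hs' _ _ _] := hvf (~~ c) n.+1.
have [_ hrem] : lists_remaining n (side c n) (side (~~ c) n.+1)
    (map (sided c) (rpairs (strec (stages n)))).
  by rewrite /side; case: c {hs hv hf hinj hs'} => /=; [exact: (ss_remA (stagesP n))|exact: (ss_remB (stagesP n))].
have inE i eu : (i < r_ M n.+1)%N ->
    in_E n n.+2 (v c n, [:: f c n i; eu]) = (eu \in outs n.+1 (v (~~ c) n.+1)).
  move=> hi; have [ho _] := hf i hi.
  rewrite -[(v c n, _)]/(prcons (prcons (v c n, [::]) (f c n i)) eu) !in_E_prcons.
  by rewrite pend_prcons (f_end _ hi) ho /in_E /= hv addn0 eqxx.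
apply: (iff_trans (hrem p)); split=> [[hE [i hi] ns]|[i [eu [-> hi ho ns]]]].
  have := hi; rewrite hs /pstarts /= => /andP[/eqP e1].
  case: p e1 hE ns {hi} => u [|e1 [|eu [|eu' s]]] //= <- hE ns; rewrite ?andbF ?andbT //.
  - by have := size_in_E hE; rewrite addn1 => /eqP; rewrite ltn_eqF.
  - move=> /eqP ei; subst e1; exists (val i), eu; split; [by []|exact: ltn_ord|by rewrite -(inE i eu (ltn_ord i))|].
    move=> [hi1 [j hj ej]]; apply: ns; exists i, (Ordinal hj); split=> //.
    by rewrite hs hs' /pcat /= ej.
  - by have := size_in_E hE; rewrite !addnS => -[] /eqP; rewrite gtn_eqF // ltnS leq_addr.
split; first by rewrite inE.
  by exists (Ordinal hi); rewrite hs /pstarts /= !eqxx.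
move=> [i' [j [hi1]]]; rewrite hs hs' /pcat /= => -[/hinj ei ej].
apply: ns; rewrite ei //; split=> //; exists j => //.
Qed.

(* [g c n] reads off i and eu from the path made of the i-th edge and of eu. *)
Lemma code : exists g : bool -> nat -> bpath C -> nat * (blabel C * bvert C),
  forall c n i eu, (i < r_ M n.+1)%N -> g c n (v c n, [:: f c n i; eu]) = (i, eu).
Proof.
have h (cnp : bool * nat * bpath C) : exists ie : nat * (blabel C * bvert C),
    forall i eu, (i < r_ M cnp.1.2.+1)%N ->
      cnp.2 = (v cnp.1.1 cnp.1.2, [:: f cnp.1.1 cnp.1.2 i; eu]) -> ie = (i, eu).
  case: cnp => -[c n] p /=; have [_ _ _ hinj] := hvf c n.
  have [[i [eu [hi ep]]]|no] := pselect (exists i eu, (i < r_ M n.+1)%N /\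
      p = (v c n, [:: f c n i; eu])); last first.
    exists (0%N, f c n 0) => i eu hi ep; case: no; exists i, eu; by split.
  exists (i, eu) => j fu hj; rewrite ep => -[/hinj ei ->].
  by rewrite ei.
have [g hg] := choice h.
by exists (fun c n p => g (c, n, p)) => c n i eu hi; exact: (hg (c, n, _) i eu hi).
Qed.

Variable g : bool -> nat -> bpath C -> nat * (blabel C * bvert C).
Hypothesis hg : forall c n i eu, (i < r_ M n.+1)%N ->
  g c n (v c n, [:: f c n i; eu]) = (i, eu).

Lemma code_mem c n i eu :
  (i, eu) \in [seq g c n (sided c wz) | wz <- rpairs (strec (stages n))] <->
  [/\ (i < r_ M n.+1)%N, eu \in outs n.+1 (v (~~ c) n.+1) &
    ~ ((i.+1 < r_ M n.+1)%N /\ exists2 j, (j < r_ M n.+2)%N & eu = f (~~ c) n.+1 j)].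
Proof.
rewrite (map_comp (g c n)); split=> [/mapP[p /remaining[k [fu [-> hk ho ns]]]]|[hi ho ns]].
  by rewrite hg // => -[-> ->].
apply/mapP; exists (v c n, [:: f c n i; eu]); last by rewrite hg.
by apply/remaining; exists i, eu.
Qed.

(* Each recursive step reverses the recipe, so that the two sides of the recipe
   chosen at level n are interchanged for odd n. *)
Definition zz (c : bool) : zigzag C :=
  Zigzag (fun n => r_ M n.+1)
    (fun n => v (c (+) odd n) n) (fun n => v (~~ c (+) odd n) n)
    (fun n => f (c (+) odd n) n) (fun n => f (~~ c (+) odd n) n)
    (fun n => [seq (g (c (+) odd n) n (sided (c (+) odd n) wz),
                    g (~~ c (+) odd n) n (sided (~~ c (+) odd n) wz)) |
               wz <- rpairs (strec (stages n))]).

Lemma zswap_zz c : zswap (zz c) = zz (~~ c).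
Proof.
rewrite /zswap /zz /= negbK; congr Zigzag; apply/funext => n.
by rewrite -map_comp.
Qed.

Lemma zz_left_axioms c : left_axioms (zz c).
Proof.
split=> [n|n|n i hi|n i hi|n i j|n|n i eu] /=.
- exact: r_gt1.
- by have [_ h _ _] := hvf (c (+) odd n) n.
- by have [_ _ h _] := hvf (c (+) odd n) n; have [] := h i hi.
- by rewrite f_end // -addbN.
- by have [_ _ _ h] := hvf (c (+) odd n) n; exact: h.
- rewrite /unzip1 -map_comp; set d := c (+) odd n.
  rewrite (eq_map (g := g d n \o sided d)) // map_comp map_inj_in_uniq; last first.
    move=> p q /remaining[i [eu [-> hi _ _]]] /remaining[j [fu [-> hj _ _]]].
    by rewrite !hg // => -[-> ->].
  rewrite /sided; case: d; first by have [] := ss_remA (stagesP n).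
  by have [] := ss_remB (stagesP n).
- by rewrite /unzip1 -map_comp addbN; exact: code_mem.
Qed.

Lemma zz_axioms c : zigzag_axioms (zz c).
Proof.
split; [exact: zz_left_axioms|by rewrite zswap_zz; exact: zz_left_axioms| |].
  by move=> n /=; rewrite !v_succ; case: c; case: (odd n).
move=> n w z /mapP[[p q] /= hpq [-> ->]].
have := ss_end (stagesP n) hpq.
have /remaining[i [eu [ep hi _ _]]] : p \in map (sided true) (rpairs (strec (stages n))).
  by apply/mapP; exists (p, q).
have /remaining[j [fu [eq hj _ _]]] : q \in map (sided false) (rpairs (strec (stages n))).
  by apply/mapP; exists (p, q).
rewrite ep eq /pend /= => e.
by case: c; case: (odd n); rewrite /sided /= !hg //= e.
Qed.

Local Notation Z := (zz true).

Definition revn n rho : recipe C := if odd n then rev_recipe rho else rho.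

Lemma pcat_edge a (u : bvert C) e : pcat a (u, [:: e]) = prcons a e.
Proof. by rewrite /pcat /prcons /= cats1. Qed.

Lemma pcat_edge2 a (u : bvert C) e e' : pcat a (u, [:: e; e']) = prcons (prcons a e) e'.
Proof. by rewrite /pcat /prcons /= -!cats1 -catA. Qed.

Definition edgeL n i : bpath C := (zLv Z n, [:: zL Z n i]).
Definition edgeR n i : bpath C := (zRv Z n, [:: zR Z n i]).

Lemma sub_stage n j : (j.+1 < r_ M n.+1)%N ->
  subrecipe (revn n (strec (stages n))) j =
  pullback (edgeL n j) (edgeR n j) (revn n.+1 (strec (stages n.+1))).
Proof.
move=> hj; pose o : 'I_(r_ M n.+1) := Ordinal (ltnW hj).
have e := ss_rec (stagesP n) (i := o) hj.
have eA : stA (stages n) o = (v true n, [:: f true n j]) by have [h _ _ _] := hvf true n; exact: (h o).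
have eB : stB (stages n) o = (v false n, [:: f false n j]) by have [h _ _ _] := hvf false n; exact: (h o).
rewrite /revn /edgeL /edgeR /=; case: (odd n) => /=.
  rewrite -[subrecipe _ _]/(rev_recipe (subrecipe (strec (stages n)) o)) e rev_pullback.
  by rewrite rev_recipeK eA eB.
by rewrite -[j]/(val o) e eA eB.
Qed.

Lemma descendant_sub rho tau i : descendant rho tau -> (i < rsub tau)%N ->
  descendant rho (subrecipe tau i).
Proof.
move=> h; elim: h => [rho' hi|rho' k tau' hk _ IH hi].
  by apply: desc_sub hi _; exact: desc_self.
by apply: desc_sub hk _; exact: IH.
Qed.

Lemma rsub_revn n rho : rsub (revn n rho) = rsub rho.
Proof. by rewrite /revn; case: odd. Qed.

Lemma rsub_stage n : rsub (strec (stages n)) = (r_ M n.+1).-1.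
Proof. exact: ss_sub (stagesP n). Qed.

(** A descendant that looks like the pull-back under (a, b) of the recipe chosen at level n. Only
    its visible data are recorded: an equality of recipes would also compare the meaningless values
    at addresses with too large indices, and may fail at the root. *)
Definition node n a b := exists tau,
  [/\ descendant (strec s0) tau,
      rpairs tau = [seq (pcat a wz.1, pcat b wz.2) |
        wz <- rpairs (revn n (strec (stages n)))],
      rsub tau = (r_ M n.+1).-1
    & forall i, (i.+1 < r_ M n.+1)%N -> subrecipe tau i =
        pullback (prcons a (zL Z n i)) (prcons b (zR Z n i))
          (revn n.+1 (strec (stages n.+1)))].

Lemma node_root : node 0 (v true 0, [::]) (v false 0, [::]).
Proof.
exists (strec s0); split; first exact: desc_self.
- rewrite map_id_in // => -[p q] hpq /=.
  have /remaining[i [eu [-> _ _ _]]] : p \in map (sided true) (rpairs (strec (stages 0))).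
    by apply/mapP; exists (p, q).
  have /remaining[j [fu [-> _ _ _]]] // : q \in map (sided false) (rpairs (strec (stages 0))).
  by apply/mapP; exists (p, q).
- exact: rsub_stage 0.
- by move=> i hi; have := sub_stage (n := 0) hi.
Qed.

Lemma node_succ n a b i : node n a b -> (i.+1 < r_ M n.+1)%N ->
  node n.+1 (prcons a (zL Z n i)) (prcons b (zR Z n i)).
Proof.
move=> [tau [ht _ rt st]] hi; exists (subrecipe tau i); split.
- apply: descendant_sub ht _; rewrite rt; move: hi; case: (r_ M n.+1) => //.
- by rewrite st.
- by rewrite st // -[LHS]/(rsub (revn n.+1 (strec (stages n.+1)))) rsub_revn rsub_stage.
move=> j hj; rewrite st //.
rewrite -[LHS]/(pullback (prcons a (zL Z n i)) (prcons b (zR Z n i))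
  (subrecipe (revn n.+1 (strec (stages n.+1))) j)).
by rewrite sub_stage // pullback_pullback !pcat_edge.
Qed.

Lemma cyls_rA n a b x :
  cyls (rA (pullback a b (revn n (strec (stages n))))) x <->
  exists2 j, (j < r_ M n.+1)%N & starts (prcons a (zL Z n j)) x.
Proof.
have sE c (i : 'I_(r_ M n.+1)) : side c n i = (v c n, [:: f c n i]).
  by have [h _ _ _] := hvf c n.
rewrite /rA /pullback /revn /=.
have -> : nodeA ((if odd n then rev_recipe (strec (stages n)) else strec (stages n)) [::]) =
    [fset side (true (+) odd n) n i | i in 'I_(r_ M n.+1)]%fset.
  case: (odd n) => /=; first exact: (ss_rB (stagesP n)).
  exact: (ss_rA (stagesP n)).
split=> [[w /imfsetP[/= p /imfsetP[/= i _ ->] ->] hx]|[j hj hx]].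
  by rewrite sE pcat_edge in hx; exists (val i); [exact: ltn_ord|exact: hx].
exists (prcons a (zL Z n j)) => //; apply/imfsetP; exists (side (true (+) odd n) n (Ordinal hj)).
  by apply/imfsetP; exists (Ordinal hj).
by rewrite sE pcat_edge.
Qed.

Lemma cyls_rB n a b x :
  cyls (rB (pullback a b (revn n (strec (stages n))))) x <->
  exists2 j, (j < r_ M n.+1)%N & starts (prcons b (zR Z n j)) x.
Proof.
have sE c (i : 'I_(r_ M n.+1)) : side c n i = (v c n, [:: f c n i]).
  by have [h _ _ _] := hvf c n.
rewrite /rB /pullback /revn /=.
have -> : nodeB ((if odd n then rev_recipe (strec (stages n)) else strec (stages n)) [::]) =
    [fset side (odd n) n i | i in 'I_(r_ M n.+1)]%fset.
  case: (odd n) => /=; first exact: (ss_rA (stagesP n)).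
  exact: (ss_rB (stagesP n)).
split=> [[w /imfsetP[/= p /imfsetP[/= i _ ->] ->] hx]|[j hj hx]].
  by rewrite sE pcat_edge in hx; exists (val i); [exact: ltn_ord|exact: hx].
exists (prcons b (zR Z n j)) => //; apply/imfsetP; exists (side (odd n) n (Ordinal hj)).
  by apply/imfsetP; exists (Ordinal hj).
by rewrite sE pcat_edge.
Qed.

Variable phi : ipath C -> ipath C.
Hypothesis hphi : fits phi (strec s0).

Lemma node_image n a b i y : node n a b -> (i.+1 < r_ M n.+1)%N ->
  (exists2 j, (j < r_ M n.+2)%N & starts (prcons (prcons b (zR Z n i)) (zR Z n.+1 j)) y) <->
  exists x, phi x = y /\ exists2 j, (j < r_ M n.+2)%N &
    starts (prcons (prcons a (zL Z n i)) (zL Z n.+1 j)) x.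
Proof.
move=> [tau [ht _ rt st]] hi; have [_ hf] := hphi; have [_ him] := hf tau ht.
have hi' : (i < rsub tau)%N by rewrite rt; move: hi; case: (r_ M n.+1).
have := him i hi'; rewrite st // => e.
apply: (iff_trans (iff_sym (cyls_rB n.+1 (prcons a (zL Z n i)) (prcons b (zR Z n i)) y))).
rewrite -e; split=> [[x /cyls_rA hx <-]|[x [<- hx]]]; first by exists x.
by exists x => //; apply/cyls_rA.
Qed.

Lemma node_pair n a b i eu i' eu' x : node n a b -> in_E 0 n a -> in_E 0 n b ->
  ((i, eu), (i', eu')) \in zpairs Z n ->
  starts (prcons (prcons a (zL Z n i)) eu) x ->
  starts (prcons (prcons b (zR Z n i')) eu') (phi x) /\ same_trunc n.+2 x (phi x).
Proof.
move=> [tau [ht pt _ _]] ha hb hp hx; have [_ hf] := hphi; have [hpair _] := hf tau ht.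
have /mapP[[p q] hpq [e1 e2]] := hp.
have /remaining[k [fu [ep hk _ _]]] : p \in map (sided true) (rpairs (strec (stages n))).
  by apply/mapP; exists (p, q).
have /remaining[l [gu [eq hl _ _]]] : q \in map (sided false) (rpairs (strec (stages n))).
  by apply/mapP; exists (p, q).
have : (prcons (prcons a (zL Z n i)) eu, prcons (prcons b (zR Z n i')) eu') \in rpairs tau.
  rewrite pt; apply/mapP; rewrite /revn.
  move: e1 e2; rewrite /=; case: (odd n); rewrite /sided /= ep eq !hg //= => -[-> ->] [-> ->].
    exists (q, p); last by rewrite ep eq !pcat_edge2.
    by rewrite /rpairs /rev_recipe /=; apply/mapP; exists (p, q).
  by exists (p, q) => //; rewrite ep eq !pcat_edge2.
move=> /hpair/(_ hx)[h1 h2]; split=> //; move: h2.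
by rewrite /= !size_rcons; have := size_in_E ha; rewrite add0n => ->.
Qed.

Lemma phi_theta_node n a b x i : node n a b -> in_E 0 n a -> in_E 0 n b ->
  pend a = zLv Z n -> pend b = zRv Z n -> starts a x -> starts b (phi x) ->
  (i < r_ M n.+1)%N -> edge x n = zL Z n i -> theta Z n x (phi x).
Proof.
move=> hn ha hb ea eb hx hy hi ex.
have ZA := zz_axioms true; have ZL := zz_left ZA; have ZR := zz_right ZA.
apply: (@theta_coind _ _ (fun n x y => y = phi x /\ exists a b, [/\ node n a b,
    in_E 0 n a /\ in_E 0 n b, pend a = zLv Z n /\ pend b = zRv Z n,
    starts a x /\ starts b (phi x) & exists2 i, (i < r_ M n.+1)%N & edge x n = zL Z n i]));
  last by split=> //; exists a, b; split=> //; exists i.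
move=> {hn ha hb ea eb hx hy hi ex n a b x i} n x y [-> [a [b [hn [ha hb] [ea eb] [hx hy] [i hi ex]]]]].
have vx : ivtx x n = zLv Z n by rewrite (starts_vtx ha hx).
have vy : ivtx (phi x) n = zRv Z n by rewrite (starts_vtx hb hy).
have hEa : in_E 0 n.+1 (prcons a (zL Z n i)) by rewrite in_E_prcons ha ea; exact: (left_out ZL).
have [[hi1 [j hj ej]]|ns] := pselect ((i.+1 < r_ M n.+1)%N /\
    exists2 j, (j < r_ M n.+2)%N & edge x n.+1 = zL Z n.+1 j).
  right; exists i.
  have hEb : in_E 0 n.+1 (prcons b (zR Z n i)) by rewrite in_E_prcons hb eb; exact: (left_out ZR).
  have hx1 : starts (prcons a (zL Z n i)) x by apply/(starts_prcons _ _ ha).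
  (* [phi] maps A_iX into B_iX; so [phi x] follows the right edge with the same index i, then some
     right edge of the next level, and the invariant passes to the subrecipe. *)
  have [|j' hj' hy'] := iffRL (node_image (phi x) hn hi1).
    exists x; split=> //; exists j => //; exact/(starts_prcons _ _ hEa).
  have [hy1 _] := iffLR (starts_prcons _ _ hEb) hy'.
  have [_ ey] := iffLR (starts_prcons _ _ hb) hy1.
  split=> //; split=> //; exists (prcons a (zL Z n i)), (prcons b (zR Z n i)); split=> //.
  - exact: node_succ.
  - by rewrite !pend_prcons (left_end ZL) // (left_end ZR).
  - by exists j.
left; have /mapP[[w [i' eu']] h ew] : (i, edge x n.+1) \in unzip1 (zpairs Z n).
  by apply/(left_mem ZL); split=> //; rewrite -(left_end ZL hi) -ex; exact: edge_outs.
rewrite /= in ew; subst w; exists i, (edge x n.+1), i', eu'.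
have hx2 : starts (prcons (prcons a (zL Z n i)) (edge x n.+1)) x.
  by apply/(starts_prcons _ _ hEa); split=> //; apply/(starts_prcons _ _ ha).
have [hy2 t] := node_pair hn ha hb h hx2.
have [hi' _ _] := iffLR (left_mem ZR n i' eu') (pair_mem h).2.
have hEb : in_E 0 n.+1 (prcons b (zR Z n i')) by rewrite in_E_prcons hb eb; exact: (left_out ZR).
have [hy1 fy] := iffLR (starts_prcons _ _ hEb) hy2.
have [_ ey] := iffLR (starts_prcons _ _ hb) hy1.
by split.
Qed.

Lemma rA_root x : cyls (rA (strec s0)) x <->
  ivtx x 0 = zLv Z 0 /\ exists2 i, (i < zr Z 0)%N & edge x 0 = zL Z 0 i.
Proof.
have [hs _ _ _] := hvf true 0.
rewrite /cyls (ss_rA (stagesP 0)); split=> [[w /imfsetP[/= i _ ->]]|[vx [i hi ex]]].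
  rewrite -[stA s0 i]/(side true 0 i) hs /starts /initial /= => -[-> e1].
  by split=> //; exists (val i); [exact: ltn_ord|exact: e1].
exists (side true 0 (Ordinal hi)); first by apply/imfsetP; exists (Ordinal hi).
rewrite /= in vx ex; by rewrite hs /starts /initial /= vx -[(ilab x 0, _)]/(edge x 0) ex.
Qed.

Lemma rB_root x : cyls (rB (strec s0)) x <->
  ivtx x 0 = zRv Z 0 /\ exists2 i, (i < zr Z 0)%N & edge x 0 = zR Z 0 i.
Proof.
have [hs _ _ _] := hvf false 0.
rewrite /cyls (ss_rB (stagesP 0)); split=> [[w /imfsetP[/= i _ ->]]|[vx [i hi ex]]].
  rewrite -[stB s0 i]/(side false 0 i) hs /starts /initial /= => -[-> e1].
  by split=> //; exists (val i); [exact: ltn_ord|exact: e1].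
exists (side false 0 (Ordinal hi)); first by apply/imfsetP; exists (Ordinal hi).
rewrite /= in vx ex; by rewrite hs /starts /initial /= vx -[(ilab x 0, _)]/(edge x 0) ex.
Qed.

Lemma phi_theta x : cyls (rA (strec s0)) x -> theta Z 0 x (phi x).
Proof.
move=> hx; have [vx [i hi ex]] := iffLR (rA_root x) hx.
have [vy _] := iffLR (rB_root _) (proj1 hphi x hx).
have hv c : in_E 0 0 (v c 0, [::]) by have [_ h _ _] := hvf c 0; rewrite /in_E /= h.
apply: (phi_theta_node node_root) hi ex => //; first by rewrite /starts /initial /= vx.
by rewrite /starts /initial /= vy.
Qed.

Lemma node_zpath n : node n (zpath Z n) (zpath (zswap Z) n).
Proof.
elim: n => [|n IH]; first exact: node_root.
apply: (node_succ IH); exact: r_gt1.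
Qed.

Lemma zpath_left n : in_E 0 n (zpath Z n) /\ pend (zpath Z n) = zLv Z n.
Proof. exact: in_E_zpath (zz_left (zz_axioms true)). Qed.

Lemma zpath_right n : in_E 0 n (zpath (zswap Z) n) /\ pend (zpath (zswap Z) n) = zRv Z n.
Proof. exact: in_E_zpath (zz_right (zz_axioms true)). Qed.

Lemma zpath_image n y :
  (exists2 j, (j < r_ M n.+2)%N & starts (prcons (zpath (zswap Z) n.+1) (zR Z n.+1 j)) y) <->
  exists x, phi x = y /\ exists2 j, (j < r_ M n.+2)%N &
    starts (prcons (zpath Z n.+1) (zL Z n.+1 j)) x.
Proof. exact: node_image (node_zpath n) (r_gt1 n). Qed.

Lemma phi_theta_zpath n x i : starts (zpath Z n) x -> (i < r_ M n.+1)%N ->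
  edge x n = zL Z n i -> theta Z n x (phi x).
Proof.
move=> hx hi ex; have [hE eE] := zpath_left n; have [hE' eE'] := zpath_right n.
apply: (phi_theta_node (node_zpath n) hE hE' eE eE' hx _ hi ex).
case: n i hx hi ex hE eE hE' eE' => [|n] i hx hi ex hE eE hE' eE'.
  have /(proj1 hphi)/rB_root[vy _] : cyls (rA (strec s0)) x.
    by apply/rA_root; split; [rewrite (starts_vtx hE hx)|exists i].
  by rewrite /starts /initial /= vy.
have [|j hj hy] := iffRL (zpath_image n (phi x)).
  by exists x; split=> //; exists i => //; apply/(starts_prcons _ _ hE).
by have [] := iffLR (starts_prcons _ _ hE') hy.
Qed.

(** [theta] depends only on tails, so the beginning of x may be exchanged for [zpath Z n], after
    which [phi] provides the partner. *)
Lemma theta_total_zz : theta_total Z.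
Proof.
move=> n x i vx hi ex; have [hE eE] := zpath_left n.
have [x0 hx0] := in_E_starts C_successors hE.
have [x' [x0x' xx']] := splice (etrans (starts_vtx hE hx0) (etrans eE (esym vx))).
have hx' := agree_starts hE x0x' hx0.
have ex' : edge x' n = zL Z n i by rewrite -(same_trunc_edge (leqnn n) xx').
exists (phi x'); apply: (theta_trunc (phi_theta_zpath hx' hi ex') (same_trunc_sym xx')).
by move=> k _.
Qed.

Lemma theta_total_zswap : theta_total (zswap Z).
Proof.
have ZA := zz_axioms true; have ZR := zz_right ZA.
move=> n y i vy hi ey; suff [x h] : exists x, theta Z n x y by exists x; exact/theta_swap.
case: n i vy hi ey => [|n] i vy hi ey; last first.
  have [hE eE] := zpath_right n.+1; have [hE' _] := zpath_left n.+1.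
  have [y0 hy0] := in_E_starts C_successors hE.
  have [y' [y0y' yy']] := splice (etrans (starts_vtx hE hy0) (etrans eE (esym vy))).
  have hy' := agree_starts hE y0y' hy0.
  have [|x [ex [j hj hx]]] := iffLR (zpath_image n y').
    exists i => //; apply/(starts_prcons _ _ hE); split=> //.
    by rewrite -[LHS]/(edge y' n.+1) -(same_trunc_edge (leqnn _) yy').
  have [hx1 ex1] := iffLR (starts_prcons _ _ hE') hx.
  exists x; apply: (theta_trunc (phi_theta_zpath hx1 hj ex1)) => //.
  by rewrite ex; exact: same_trunc_sym.
(* At the root, [fits] only says that [phi] maps AX into BX. A partner of y therefore comes from the
   image of a subrecipe if the zigzag continues, and is otherwise built from the matched pair and
   the tail of y. *)
have [[hi1 [j hj ej]]|ns] := pselect ((i.+1 < r_ M 1)%N /\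
    exists2 j, (j < r_ M 2)%N & edge y 1 = zR Z 1 j).
  have [hv _] := zpath_right 0; have [hv' _] := zpath_left 0.
  have hEb : in_E 0 1 (prcons (v false 0, [::]) (zR Z 0 i)).
    by rewrite in_E_prcons [in_E _ _ _]hv; exact: (left_out ZR).
  have hEa : in_E 0 1 (prcons (v true 0, [::]) (zL Z 0 i)).
    by rewrite in_E_prcons [in_E _ _ _]hv'; exact: (left_out (zz_left ZA)).
  have [|x [ex [j' hj' hx]]] := iffLR (node_image y node_root hi1).
    exists j => //; apply/(starts_prcons _ _ hEb); split=> //.
    apply/(starts_prcons _ _ hv); split=> //; by rewrite /starts /initial /= vy.
  have [hx1 _] := iffLR (starts_prcons _ _ hEa) hx.
  have [hx0 ex0] := iffLR (starts_prcons _ _ hv') hx1.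
  by exists x; rewrite -ex; exact: phi_theta_zpath hx0 hi ex0.
have /mapP[[w [k eu]] h ew] : (i, edge y 1) \in unzip1 (zpairs (zswap Z) 0).
  by apply/(left_mem ZR); split=> //; rewrite -(left_end ZR hi) -ey; exact: edge_outs.
rewrite /= in ew; subst w; move/mapP: h => [[w z] h [ez ew]]; subst w z.
have [/(left_mem (zz_left ZA))[hk ho _] _] := pair_mem h.
have hEa : in_E 0 2 (prcons (prcons (zpath Z 0) (zL Z 0 k)) eu).
  have [hv ev] := zpath_left 0.
  rewrite in_E_prcons pend_prcons (left_end (zz_left ZA) hk) ho andbT in_E_prcons hv ev.
  exact: (left_out (zz_left ZA)).
have [x0 hx0] := in_E_starts C_successors hEa.
have e2 : ivtx x0 2 = ivtx y 2.
  rewrite (starts_vtx hEa hx0) pend_prcons (zz_pair_end ZA h) /=.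
  by [].
have [x [x0x yx]] := splice e2.
have hx := agree_starts hEa x0x hx0.
have [hv ev] := zpath_left 0.
have hEa1 : in_E 0 1 (prcons (zpath Z 0) (zL Z 0 k)) by have := hEa; rewrite in_E_prcons => /andP[].
have [hx1 ex1] := iffLR (starts_prcons _ _ hEa1) hx.
have [hx00 ex0] := iffLR (starts_prcons _ _ hv) hx1.
exists x; apply: (@theta_pair _ _ _ _ _ k eu i (edge y 1)) => //.
  by rewrite (starts_vtx hv hx00).
exact: same_trunc_sym.
Qed.

Lemma zz_system : zigzag_system Z.
Proof. by split; [exact: zz_axioms|exact: theta_total_zz|exact: theta_total_zswap]. Qed.

End Stages.
End MainZigzag.

(** * Dimension groups *)

Section NatVectors.
Variable B : bratteli.
Implicit Types (Y : bvert B -> nat).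

Definition push l Y (w : bvert B) : nat := (\sum_(v <- vlev B l) Y v * #|` elab l v w|)%N.

Fixpoint pushn l n Y : bvert B -> nat :=
  if n is n'.+1 then push (n' + l) (pushn l n' Y) else Y.

Lemma push_ext l Y Y' : {in vlev B l, Y =1 Y'} -> push l Y =1 push l Y'.
Proof. by move=> h w; apply: eq_big_seq => v hv; rewrite h. Qed.

Lemma push_sum (A : zmodType) (m : nat -> bvert B -> A) l Y : harmonic m ->
  \sum_(v <- vlev B l) m l v *+ Y v = \sum_(w <- vlev B l.+1) m l.+1 w *+ push l Y w.
Proof.
move=> hm; rewrite (eq_big_seq (fun v => \sum_(w <- vlev B l.+1)
    m l.+1 w *+ (Y v * #|` elab l v w|)%N)) => [|v hv].
  by rewrite exchange_big /=; apply: eq_bigr => w _; rewrite -sumrMnr.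
by rewrite (hm l v hv) -sumrMnl; apply: eq_bigr => w _; rewrite -mulrnA mulnC.
Qed.

Lemma pushn_sum (A : zmodType) (m : nat -> bvert B -> A) l n Y : harmonic m ->
  \sum_(v <- vlev B l) m l v *+ Y v =
  \sum_(w <- vlev B (n + l)) m (n + l)%N w *+ pushn l n Y w.
Proof. by move=> hm; elim: n => // n ->; exact: push_sum. Qed.

Lemma pushn_cnt (hB : has_successors B) N n (a : word (ipath B)) : lc_word N a ->
  {in vlev B (n + N), cnt (n + N) a =1 pushn N n (cnt N a)}.
Proof.
move=> ha; elim: n => // n IH w hw /=.
rewrite -(push_ext IH) /push -(cnt_refine hB) //.
by apply: lc_word_le ha; exact: leq_addl.
Qed.

Lemma pushn_le l n Y w v : v \in vlev B (n + l) ->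
  (pushn l n Y v * #|` elab (n + l) v w| <= pushn l n.+1 Y w)%N.
Proof. by move=> hv /=; rewrite /push (big_rem v) //= leq_addr. Qed.

Variables (D : zmodType) (Dp : set D)
  (iota : forall l, {additive {ffun vlev B l -> int} -> D}).
Hypothesis hD : is_dimension_group_of Dp iota.

Definition mD l v : D := iota l (basis_vec l v).

Definition vecn l Y : {ffun vlev B l -> int} := [ffun v => (Y (\val v))%:Z].

Lemma vecn_basis l Y : vecn l Y = \sum_(v <- vlev B l) basis_vec l v *+ Y v.
Proof.
apply/ffunP => w; rewrite sum_ffunE ffunE (bigD1_seq (\val w)) ?fset_uniq ?fsvalP //=.
rewrite big1_seq ?addr0 => [|v /andP[vw _]]; last first.
  by rewrite ffunMnE ffunE eq_sym (negPf vw) mul0rn.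
by rewrite ffunMnE ffunE eqxx natz.
Qed.

Lemma iota_vecn l Y : iota l (vecn l Y) = \sum_(v <- vlev B l) mD l v *+ Y v.
Proof. by rewrite vecn_basis raddf_sum; apply: eq_bigr => v _; rewrite raddfMn. Qed.

Lemma connecting_vecn l Y :
  connecting (fun l (w : vlev B l.+1) (v : vlev B l) => #|` elab l (\val v) (\val w)|)
    (vecn l Y) = vecn l.+1 (push l Y).
Proof.
apply/ffunP => w; rewrite !ffunE /push big_seq_fsetE.
rewrite (big_morph Posz PoszD (erefl _)); apply: eq_bigr => v _.
by rewrite ffunE mulnC PoszM.
Qed.

Local Notation conn := (fun l (w : vlev B l.+1) (v : vlev B l) =>
  #|` elab l (\val v) (\val w)|).

Lemma connectingB l (x y : {ffun vlev B l -> int}) :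
  connecting conn (x - y) = connecting conn x - connecting conn y.
Proof.
apply/ffunP => w; rewrite !ffunE -sumrB; apply: eq_bigr => v _.
by rewrite !ffunE mulrBr.
Qed.

Lemma connecting_iterB l n (x y : {ffun vlev B l -> int}) :
  connecting_iter conn n (x - y) = connecting_iter conn n x - connecting_iter conn n y.
Proof. by elim: n => //= n ->; exact: connectingB. Qed.

Lemma connecting_iter_vecn l n Y :
  connecting_iter conn n (vecn l Y) = vecn (n + l) (pushn l n Y).
Proof. by elim: n => //= n ->; exact: connecting_vecn. Qed.

Lemma harmonic_mD : harmonic mD.
Proof.
move=> l v hv; rewrite /mD -(limit_compat hD).
have -> : basis_vec l v = vecn l (fun u => (u == v)%N) by [].
rewrite connecting_vecn iota_vecn; apply: eq_big_seq => w hw.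
rewrite /push (big_rem v) //= eqxx mul1n big1_seq ?addn0 // => u.
by rewrite mem_rem_uniq ?fset_uniq // !inE => /andP[_ /andP[/negPf -> _]].
Qed.

(** An element of the limit vanishes only if it does so at a later stage. The formulation with
    natural vectors fits the multiplicities [cnt] of words. *)
Lemma limit_eq l Y Y' :
  \sum_(v <- vlev B l) mD l v *+ Y v = \sum_(v <- vlev B l) mD l v *+ Y' v ->
  exists n, {in vlev B (n + l), pushn l n Y =1 pushn l n Y'}.
Proof.
rewrite -!iota_vecn => /eqP; rewrite -subr_eq0 -raddfB => /eqP/(limit_ker hD)[n].
rewrite connecting_iterB !connecting_iter_vecn => /eqP; rewrite subr_eq0 => /eqP e.
exists n => v hv; have /ffunP/(_ [` hv]%fset) := e.
by rewrite !ffunE => -[].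
Qed.

Lemma limit_posP d : Dp d <-> exists l Y, d = \sum_(v <- vlev B l) mD l v *+ Y v.
Proof.
apply: (iff_trans (limit_pos hD d)); split=> [[l [x [x0 <-]]]|[l [Y ->]]].
  exists l, (fun v => if insub v is Some v' then `|x v'|%N else 0%N).
  rewrite -iota_vecn; congr (iota l _); apply/ffunP => v.
  by rewrite ffunE valK gez0_abs.
by exists l, (vecn l Y); rewrite iota_vecn; split=> // v; rewrite ffunE.
Qed.

Lemma pushn_gt0 (hB : has_successors B) l n Y v : v \in vlev B l -> (0 < Y v)%N ->
  exists2 w, w \in vlev B (n + l) & (0 < pushn l n Y w)%N.
Proof.
move=> hv Yv; elim: n => [|n [w hw pw]]; first by exists v.
have [eu] := hB _ _ hw; rewrite mem_outs => /andP[hu he]; exists eu.2 => //.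
apply: (leq_trans _ (pushn_le Y eu.2 hw)); rewrite muln_gt0 pw cardfs_gt0.
by apply/fset0Pn; exists eu.1.
Qed.

(** Every vertex has a successor, so a nonzero natural vector stays nonzero at all later stages. *)
Lemma limit_neq0 (hB : has_successors B) l Y v : v \in vlev B l -> (0 < Y v)%N ->
  \sum_(u <- vlev B l) mD l u *+ Y u <> 0.
Proof.
move=> hv Yv e; have [|n hn] := @limit_eq l Y (fun=> 0%N).
  by rewrite e big1 // => u _; rewrite mulr0n.
have [w hw] := pushn_gt0 hB n hv Yv; rewrite hn //.
suff -> : pushn l n (fun=> 0%N) w = 0%N by [].
elim: n w {hn hw} => //= n IH w; rewrite /push big1 // => u _.
by rewrite IH mul0n.
Qed.

Lemma vcls_harmonic (G : toprel (ipath B)) (A : zmodType) (m : nat -> bvert B -> A)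
    (theta : {additive tsemi G -> A}) l Y :
  (forall l v, v \in vlev B l -> exists p, in_E 0 l p /\ pend p = v) ->
  (forall l p q, in_E 0 l p -> in_E 0 l q -> pend p = pend q -> cls G (cyl p) = cls G (cyl q)) ->
  (forall l p, in_E 0 l p -> theta (cls G (cyl p)) = m l (pend p)) ->
  theta (\sum_(v <- vlev B l) vcls G l v *+ Y v) = \sum_(v <- vlev B l) m l v *+ Y v.
Proof.
move=> hr ht hm; rewrite raddf_sum; apply: eq_big_seq => v hv.
by rewrite raddfMn; have [p [hp <-]] := hr l v hv; rewrite -(vclsE ht hp) (hm l p hp).
Qed.

Lemma theta_cyl (hB : has_successors B) (G : toprel (ipath B)) (A : zmodType)
    (m : nat -> bvert B -> A) (theta : {additive tsemi G -> A}) l p : harmonic m ->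
  (forall a, theta (\pi_(tsemi G) a)%qT = wmu m a) -> in_E 0 l p ->
  theta (cls G (cyl p)) = m l (pend p).
Proof.
move=> hm ht hp; have [K eK] : exists K : copen (ipath B), cyl p = K.
  by apply: lcs_copen; exists l; exact: lc_cyl.
rewrite eK cls_copen ht /wmu big_seq1 -eK.
exact: mu_cyl.
Qed.

(** Two words with the same value in D have, at a late level, the same multiplicities, and by
    [pi_cnt] these determine the class. *)
Lemma exists_dim_iso (hB : has_successors B) :
  (forall l v, v \in vlev B l -> exists p, in_E 0 l p /\ pend p = v) ->
  exists kappa : {additive tsemi (tail_rel B) -> D},
    [/\ forall l w, in_E 0 l w -> kappa (cls (tail_rel B) (cyl w)) = mD l (pend w),
        injective kappa & range kappa = Dp].
Proof.
move=> hr; have hm := harmonic_mD; have eT := etale_tail_rel hB.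
have [kappa hk] := lift_tsemi eT hB hm (preserves_tail_rel hB hm).
have kcyl l w (hw : in_E 0 l w) := theta_cyl hB hm hk hw.
have tc : forall l p q, in_E 0 l p -> in_E 0 l q -> pend p = pend q ->
    cls (tail_rel B) (cyl p) = cls (tail_rel B) (cyl q).
  by apply: tail_cls_of_base => // l w z hw hz e; exists l, w, z.
exists kappa; split=> //.
- move=> s t; rewrite -[s]reprK -[t]reprK; set a := repr s; set b := repr t.
  rewrite !hk => e.
  have [na ha] := lc_wordP a; have [nb hb] := lc_wordP b.
  pose N := maxn na nb.
  have {}ha : lc_word N a by apply: lc_word_le ha; exact: leq_maxl.
  have {}hb : lc_word N b by apply: lc_word_le hb; exact: leq_maxr.
  move: e; rewrite (wmu_cnt hB hm ha) (wmu_cnt hB hm hb) => /limit_eq[n hn].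
  rewrite (pi_cnt tc (lc_word_le (leq_addl n N) ha)) (pi_cnt tc (lc_word_le (leq_addl n N) hb)).
  apply: eq_big_seq => v hv; rewrite (pushn_cnt hB ha) // (pushn_cnt hB hb) //.
  by rewrite hn.
apply/seteqP; split=> [d [s _ <-]|d /limit_posP[l [Y ->]]]; apply/limit_posP || idtac.
  rewrite -[s]reprK; have [n hn] := lc_wordP (repr s).
  by exists n, (cnt n (repr s)); rewrite hk (wmu_cnt hB hm hn).
exists (\sum_(v <- vlev B l) vcls (tail_rel B) l v *+ Y v) => //.
exact: vcls_harmonic hr tc kcyl.
Qed.

End NatVectors.

(** * The two weights on C *)

Section FractionClasses.
Variable E : zmodClosed rat.
Implicit Types (p q : rat).

Lemma modZ_classMn q n : q \in E -> modZ_class E q *+ n = modZ_class E (q *+ n).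
Proof.
move=> hq; rewrite -raddfMn; congr (\pi_(modZ E) _)%qT.
apply: val_inj; rewrite raddfMn [RHS]insubdK; last exact: (rpredMn n hq).
by congr (_ *+ n); exact: insubdK.
Qed.

Lemma modZ_classMz q (z : int) : q \in E -> modZ_class E q *~ z = modZ_class E (q *~ z).
Proof.
move=> hq; rewrite -raddfMz; congr (\pi_(modZ E) _)%qT.
apply: val_inj; rewrite raddfMz [RHS]insubdK; last exact: (rpredMz z hq).
by congr (_ *~ z); exact: insubdK.
Qed.

Lemma modZ_class_eq0 q : q \in E -> modZ_class E q = 0 <-> q \is a Num.int.
Proof.
move=> hq; rewrite -[X in _ = X](raddf0 (\pi_(modZ E))%qT).
have -> : (q \is a Num.int) = (insubd (0 : subrat E) q - 0 \in @intsub E).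
  by rewrite subr0 inE insubdK.
by rewrite Quotient.idealrBE; split=> /eqP.
Qed.

End FractionClasses.

Section Weights.
Variables (D : zmodType) (Dp : set D) (E : zmodClosed rat) (M : main_data Dp E).
Local Notation C := (Cdiag M).

Definition er l : modZ E := modZ_class E (r_ M l)%:R^-1.

Lemma r_neq0 l : (r_ M l)%:R != 0 :> rat.
Proof. by rewrite pnatr_eq0 -lt0n r_gt0. Qed.

Lemma r_inv_E l : (r_ M l)%:R^-1 \in E.
Proof. by apply/(r_E M); exists l, 1; rewrite div1r. Qed.

Lemma er_eq0 l n : er l *+ n = 0 <-> (r_ M l %| n)%N.
Proof.
rewrite modZ_classMn ?r_inv_E //; apply: (iff_trans (modZ_class_eq0 _)).
  by rewrite rpredMn ?r_inv_E.
split=> [/intrP[z]|/dvdnP[k ->]].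
  rewrite -[_^-1 *+ _]mulr_natl => /(congr1 ( *%R^~ (r_ M l)%:R)); rewrite mulfVK ?r_neq0 // => e.
  have e' : n%:Z = z * (r_ M l)%:Z by apply: (@intr_inj rat); rewrite intrM.
  by have : ((r_ M l)%:Z %| n%:Z)%Z by rewrite e' dvdz_mull.
by rewrite -[_^-1 *+ _]mulr_natl natrM mulfK ?r_neq0 // rpred_nat.
Qed.

Lemma er_r l : er l *+ r_ M l = 0.
Proof. exact/er_eq0. Qed.

Lemma er_inj l a b : (a <= b)%N -> er l *+ a = er l *+ b -> (r_ M l %| b - a)%N.
Proof. by move=> ab e; apply/er_eq0; rewrite mulrnBr // e subrr. Qed.

Lemma er_succ l : er l.+1 *+ (r_ M l.+1 %/ r_ M l)%N = er l.
Proof.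
rewrite modZ_classMn ?r_inv_E //; congr modZ_class.
apply: (mulfI (r_neq0 l)); rewrite mulfV ?r_neq0 // -[_^-1 *+ _]mulr_natl mulrA -natrM.
by rewrite mulnC divnK ?r_dvd // mulfV ?r_neq0.
Qed.

(** If t is the class of z/r_j, then c is z modulo r_j at level j. Going one level up multiplies
    both c and the bound by r_{l+1}/r_l, so c stays below r_l. *)
Lemma er_surj t : exists j, forall l, (j <= l)%N -> exists2 c, (c < r_ M l)%N & t = er l *+ c.
Proof.
have [q hq ->] : exists2 q, q \in E & t = modZ_class E q.
  exists (\val (repr t)); first exact: valP.
  by rewrite -[LHS]reprK /modZ_class valKd.
have [j [z ez]] := iffLR (r_E M q) hq; exists j => l /subnKC <-.
elim: (l - j)%N => [|n [c hc ->]]; rewrite ?addn0 ?addnS.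
  have r0 : (r_ M j)%:Z != 0 by rewrite -lt0n r_gt0.
  have := ltz_pmod z (d := (r_ M j)%:Z); have := modz_ge0 z r0.
  have := divz_eq z (r_ M j)%:Z; case: (z %% _)%Z => // c ec _ hc; exists c.
    by apply: hc; rewrite lt_def r0.
  rewrite ez mulrzl -modZ_classMz ?r_inv_E // -/(er j) ec mulrzDr.
  by rewrite mulrC mulrzA -pmulrn er_r mul0rz add0r.
exists ((r_ M (j + n).+1 %/ r_ M (j + n)) * c)%N; last by rewrite mulrnA er_succ.
by rewrite -[X in (_ < X)%N](divnK (r_dvd M (j + n))) ltn_pmul2l ?r_div_gt0.
Qed.

Lemma sum_C_lev (A : nmodType) l (F : bvert C -> A) :
  \sum_(v <- vlev C l.+1) F v = F None + \sum_(u <- vlev (BD M) l.+1) F (Some u).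
Proof.
rewrite /= big_fsetU1 /=; last by apply/imfsetP => -[].
by congr (_ + _); rewrite big_imfset //= => u u' _ _ [].
Qed.

(** The push-forward of a vector along the graph homomorphism T. *)
Definition fiber l (Y : bvert C -> nat) (u : bvert (BD M)) : nat :=
  (\sum_(v <- vlev C l | Tvert l v == u) Y v)%N.

Lemma fiber_succ l Y u : u \in vlev (BD M) l.+1 ->
  fiber l.+1 Y u = (Y (Some u) + (u == wa M l.+1) * Y None)%N.
Proof.
move=> hu; rewrite /fiber big_mkcond.
rewrite (sum_C_lev l (fun v => if Tvert l.+1 v == u then Y v else 0%N)) /= addrC.
rewrite (big_rem u) //= eqxx big1_seq ?addn0 => [|w /andP[_]].
  by rewrite addr0 eq_sym; case: eqP; rewrite ?mul1n ?mul0n.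
by rewrite mem_rem_uniq ?fset_uniq // !inE => /andP[/negPf -> _].
Qed.

Lemma sum_fiber (A : nmodType) l (F : bvert (BD M) -> A) Y :
  \sum_(v <- vlev C l) F (Tvert l v) *+ Y v = \sum_(u <- vlev (BD M) l) F u *+ fiber l Y u.
Proof.
transitivity (\sum_(v <- vlev C l) \sum_(u <- vlev (BD M) l | Tvert l v == u) F u *+ Y v).
  apply: eq_big_seq => v /Tvert_lev hv; rewrite (big_rem _ hv) /= eqxx big1_seq ?addr0 //.
  by move=> u /andP[/eqP <-]; rewrite mem_rem_uniq ?fset_uniq // !inE eqxx.
rewrite (exchange_big_dep predT) //=; apply: eq_bigr => u _.
by rewrite -sumrMnr.
Qed.

Lemma F_sub l v : v \in vlev C l -> (F_ M l v `<=` elab l (Tvert l v) (wa M l.+1))%fset.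
Proof.
case: v => [v|] /=; rewrite ?C_lev_Some ?C_lev_None => hv; last exact: F_wb_sub.
have [->|nv] := eqVneq v (wa M l); first exact: F_wa_sub.
by rewrite F_other // fsub0set.
Qed.

(** Over w_a^{l+1} the edges of C from v go to w_b with label set F(v) and to w_a with the
    complement, which together exhaust the labels in B_D; over other vertices nothing changes. *)
Lemma fiber_labels l v u : v \in vlev C l -> u \in vlev (BD M) l.+1 ->
  fiber l.+1 (fun w => #|` elab (b := C) l v w|) u = #|` elab l (Tvert l v) u|.
Proof.
move=> hv hu; rewrite fiber_succ //=; case: eqVneq => [->|_]; last by rewrite addn0.
by rewrite mul1n cardfsD (fsetIidPr (F_sub hv)) subnK // fsubset_leq_card // F_sub.
Qed.

Lemma nat_mulrn (x n : nat) : x *+ n = (n * x)%N.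
Proof. by rewrite -mulr_natl natn. Qed.

Lemma fiber_push l Y u : u \in vlev (BD M) l.+1 ->
  fiber l.+1 (push (B := C) l Y) u = push (B := BD M) l (fiber l Y) u.
Proof.
move=> hu; transitivity (\sum_(v <- vlev C l) Y v * #|` elab l (Tvert l v) u|)%N; last first.
  pose F v := #|` elab l v u|; apply: (etrans (etrans _ (sum_fiber (A := nat) l F Y))).
    by apply: eq_bigr => v _; rewrite nat_mulrn.
  by apply: eq_bigr => v _; rewrite nat_mulrn.
rewrite /fiber (exchange_big_dep predT) //=; apply: eq_big_seq => v hv.
rewrite -(fiber_labels hv hu) /fiber big_distrr /=.
by apply: eq_bigl => w; rewrite andbT.
Qed.

Lemma fiber_pushn l n Y u : u \in vlev (BD M) (n + l) ->
  fiber (n + l) (pushn (B := C) l n Y) u = pushn (B := BD M) l n (fiber l Y) u.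
Proof.
elim: n u => // n IH u hu /=.
by rewrite fiber_push //; apply: push_ext => v; exact: IH.
Qed.

Definition wD l (v : bvert C) : D := mD (BD_iota M) l (Tvert l v).

Definition wE l (v : bvert C) : modZ E := if v is Some _ then 0 else er l.

Lemma harmonic_wD : harmonic wD.
Proof.
move=> l v hv; rewrite /wD (harmonic_mD (BD_dim M) (Tvert_lev hv)).
rewrite (sum_fiber l.+1 (mD (BD_iota M) l.+1) (fun w => #|` elab (b := C) l v w|)).
by apply: eq_big_seq => u hu; rewrite fiber_labels.
Qed.

Lemma harmonic_wE : harmonic wE.
Proof.
move=> l v hv; rewrite sum_C_lev /= big1 ?addr0 => [|u _]; last by rewrite mul0rn.
case: v hv => [v|]; rewrite ?C_lev_Some ?C_lev_None => hv.
  have [->|nv] := eqVneq v (wa M l); first by rewrite F_wa_card er_r.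
  by rewrite F_other // cardfs0.
by rewrite F_wb_card // er_succ.
Qed.

Lemma sum_wE l Y : \sum_(v <- vlev C l.+1) wE l.+1 v *+ Y v = er l.+1 *+ Y None.
Proof. by rewrite sum_C_lev /= big1 ?addr0 // => u _; rewrite mul0rn. Qed.

Lemma BD_reach l v : v \in vlev (BD M) l -> exists p, in_E 0 l p /\ pend p = v.
Proof.
elim: l v => [|l IH] v hv; first by exists (v, [::]); rewrite /in_E /= hv.
have [p [hp ep]] := IH _ (wa_lev M l).
have : (0 < #|` elab l (wa M l) v|)%N.
  by apply: leq_trans (BD_edges (wa_lev M l) hv); rewrite addn_gt0 r_gt0.
rewrite cardfs_gt0 => /fset0Pn[e he]; exists (prcons p (e, v)).
by rewrite in_E_prcons hp ep pend_prcons mem_outs /= hv he.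
Qed.

Lemma C_reach l (v : bvert C) : v \in vlev C l -> exists p, in_E 0 l p /\ pend p = v.
Proof.
elim: l v => [|l IH] v hv; first by exists (v, [::]); rewrite /in_E /= hv.
have hw : Some (wa M l) \in vlev C l by rewrite C_lev_Some wa_lev.
have [p [hp ep]] := IH _ hw.
suff : (0 < #|` elab (b := C) l (Some (wa M l)) v|)%N.
  rewrite cardfs_gt0 => /fset0Pn[e he]; exists (prcons p (e, v)).
  by rewrite in_E_prcons hp ep pend_prcons mem_outs hv /= he.
case: v hv => [u|]; rewrite ?C_lev_Some => hu /=; last by rewrite F_wa_card r_gt0.
(* If u is w_a^{l+1}, then r_{l+1} labels have been withdrawn; the surplus d_{l+1} > 0 leaves at
   least one edge. *)
have h := BD_edges (wa_lev M l) hu.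
have := fiber_labels hw hu; rewrite fiber_succ //= F_wa_card => e; rewrite -e in h.
have := leq_trans h (leq_add (leqnn _) (leq_mul (leq_b1 _) (leqnn _))).
rewrite mul1n addnC leq_add2r; apply: leq_trans; exact: r_div_gt0.
Qed.

End Weights.

(** * The shadow map and the measures of shadows *)

Section Shadow.
Variables (D : zmodType) (Dp : set D) (E : zmodClosed rat) (M : main_data Dp E).
Local Notation C := (Cdiag M).
Local Notation sX := (@sX D Dp E M).
Implicit Types (x y z : ipath C) (p : bpath C).
Let hC : has_successors C := @C_successors D Dp E M.
Let hBD : has_successors (BD M) := @BD_successors D Dp E M.

(** T identifies only w_a and w_b, and the label tells which of them the edge enters: labels in F(v)
    lead to w_b, the others to w_a. This gives injectivity of the shadow map. *)
Lemma Tvert_edge_inj l (v : bvert C) eu fu : eu \in outs l v -> fu \in outs l v ->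
  eu.1 = fu.1 -> Tvert l.+1 eu.2 = Tvert l.+1 fu.2 -> eu = fu.
Proof.
case: eu fu => [e [u|]] [e' [u'|]]; rewrite !mem_outs /= => /andP[_ +] /andP[_ +] ee; rewrite -{}ee //.
- by move=> _ _ ->.
- by move=> he he' eu; move: he; rewrite eu eqxx in_fsetD he'.
- by move=> he he' eu; move: he'; rewrite -eu eqxx in_fsetD he.
Qed.

Lemma agree_succ (B : bratteli) n (x y : ipath B) :
  agree n.+1 x y <-> agree n x y /\ edge x n = edge y n.
Proof.
split=> [|[h e]]; last exact: agreeS.
by rewrite /agree !initialS => /prcons_inj.
Qed.

Lemma edge_sX x n : edge (sX x) n = ((edge x n).1, Tvert n.+1 (edge x n).2).
Proof. by []. Qed.

Lemma agree_sX n x y : agree n (sX x) (sX y) <-> agree n x y.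
Proof.
elim: n => [|n IH].
  have h z : ivtx z 0 = Some (Tvert 0 (ivtx z 0)).
    by have [] := ipathP z 0; case: (ivtx z 0) => //; rewrite C_lev_None.
  rewrite /agree /initial /= h [in X in _ <-> X](h y).
  by split=> [[->]|[->]].
split=> /agree_succ[h]; rewrite ?edge_sX => e; apply/agree_succ; last first.
  by rewrite !edge_sX e; split=> //; exact/IH.
move: h e => /IH h [e1 e2]; split=> //; apply: (@Tvert_edge_inj n (ivtx x n)) => //.
  exact: edge_outs.
by rewrite (agree_vtx (leqnn n) h); exact: edge_outs.
Qed.

Lemma outs_lift l (v : bvert C) (eu : blabel (BD M) * bvert (BD M)) : v \in vlev C l ->
  eu \in outs l (Tvert l v) ->
  exists2 fu, fu \in outs l v & eu = (fu.1, Tvert l.+1 fu.2).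
Proof.
case: eu => e u hv; rewrite mem_outs /= => /andP[hu he].
have [eF|neF] := boolP ((u == wa M l.+1) && (e \in F_ M l v)).
  case/andP: eF => /eqP -> eF; exists ((e, None) : blabel C * bvert C) => //.
  by apply: (etrans (mem_outs (B := C) l v (e, None))); rewrite C_lev_None.
exists ((e, Some u) : blabel C * bvert C) => //.
apply: (etrans (mem_outs (B := C) l v (e, Some u))); rewrite C_lev_Some hu /=.
by case: eqP neF => //= _ neF; rewrite in_fsetD neF.
Qed.

Lemma sX_lift n x (y : ipath (BD M)) : agree n (sX x) y ->
  exists2 x', agree n x x' & sX x' = y.
Proof.
move=> h.
(* The lift is grown edge by edge; the invariant is that the path built so far begins some path
   whose shadow agrees with y to that length. *)
pose Q q := exists2 z, starts q z & agree (size q.2) (sX z) y.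
have [m q hq [z qz zy]||x' [hx' hQ]] := @grow C Q n (initial x n) _ (in_E_initial x n) _.
- have /and3P[_ _ /eqP eq_m] := hq; rewrite add0n in eq_m; rewrite eq_m in zy.
  have hv : ivtx z m \in vlev C m by have [] := ipathP z m.
  have : edge y m \in outs m (Tvert m (ivtx z m)).
    by rewrite -[Tvert _ _]/(ivtx (sX z) m) (agree_vtx (leqnn m) zy); exact: edge_outs.
  case/(outs_lift hv) => fu hfu efu; rewrite (starts_vtx hq qz) in hfu.
  exists fu => //; have hqf : in_E 0 m.+1 (prcons q fu) by rewrite in_E_prcons hq.
  have [z' qz'] := in_E_starts hC hqf; exists z' => //.
  have [qz1 ez'] := iffLR (starts_prcons _ _ hq) qz'.
  have /and3P[_ _ /eqP] := hqf; rewrite add0n => ->; apply/agree_succ; split.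
    by apply: agree_trans zy; apply/agree_sX; exact: starts_agree hq qz1 qz.
  by rewrite edge_sX [edge z' m]ez' -efu.
- exists x; first exact/starts_initial_agree.
  by rewrite size_map size_iota.
exists x'; first exact/starts_initial_agree.
apply: agree_all => m; apply: (@agree_le (BD M) m (maxn n m)); first exact: leq_maxr.
have [z hz zy] := hQ (maxn n m) (leq_maxl n m).
rewrite size_map size_iota in zy; apply: agree_trans zy.
by apply/agree_sX/starts_initial_agree.
Qed.

Lemma sX_cyl n p : in_E 0 n p -> exists2 q : bpath (BD M), in_E 0 n q &
  pend q = Tvert n (pend p) /\ sX @` cyl p = cyl q.
Proof.
move=> hp; have [x px] := in_E_starts hC hp.
exists (initial (sX x) n); first exact: in_E_initial.
split; first by rewrite pend_initial -(starts_vtx hp px).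
apply/seteqP; split=> [_ [x' px' <-]|y /starts_initial_agree/sX_lift[x' xx' <-]].
  by apply/starts_initial_agree/agree_sX; exact: starts_agree hp px px'.
by exists x' => //; exact: agree_starts hp xx' px.
Qed.

Lemma mu_sX n (K : set (ipath C)) : lc n K ->
  lcs (sX @` K) /\ mu (mD (BD_iota M)) (sX @` K) = mu (wD (M := M)) K.
Proof.
move=> hK; have hm := harmonic_mD (BD_dim M).
pose s := [seq p <- paths C n | meets K p].
have sE p : p \in s -> in_E 0 n p by rewrite mem_filter mem_paths => /andP[].
have hsK (y : ipath (BD M)) : (sX @` K) y <-> exists2 p, p \in s & (sX @` cyl p) y.
  split=> [[x /(lc_cyls hK)[p hp px] <-]|[p hp [x px <-]]]; first by exists p => //; exists x.
  by exists x => //; apply/(lc_cyls hK); exists p.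
have lcL p : p \in s -> exists n, lc n (sX @` cyl p).
  by move=> /sE/sX_cyl[q hq [_ ->]]; exists n; exact: lc_cyl.
have dis (y : ipath (BD M)) p q : p \in s -> q \in s -> (sX @` cyl p) y -> (sX @` cyl q) y -> p = q.
  move=> /sE hp /sE hq [x px <-] [x' qx' e]; move/(starts_initial x hp): px => <-.
  move/(starts_initial x' hq): qx' => <-; apply/esym/agree_sX.
  by rewrite e; exact: agree_refl.
split; first exact: (lcs_bigU hsK).
rewrite (mu_bigU hBD hm (filter_uniq _ (uniq_paths C n)) hsK dis lcL).
rewrite (mu_lc hC (@harmonic_wD D Dp E M) hK) -[RHS]big_filter.
apply: eq_big_seq => p /sE/sX_cyl[q hq [eq ->]].
by rewrite (mu_cyl hBD hm hq) eq.
Qed.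

End Shadow.

(** The difference c' - c is traded in blocks of n copies, each block of x being equal to a block of
    y. *)
Lemma mulrn_exchange (A : nmodType) (x y : A) n b b' c c' :
  x *+ n = y *+ n -> (b + c)%N = (b' + c')%N -> (c <= c')%N -> (n %| c' - c)%N ->
  x *+ b + y *+ c = x *+ b' + y *+ c'.
Proof.
move=> xy e cc /dvdnP[k ek]; have -> : c' = (c + k * n)%N by rewrite -ek subnKC.
have -> : b = (b' + k * n)%N.
  by apply/eqP; rewrite -(eqn_add2r c) e -addnA [(k * n + c)%N]addnC -ek subnKC.
by rewrite !mulrnDr [(k * n)%N]mulnC !mulrnA xy addrAC addrA.
Qed.

(** * The pair of weights on S(R) and on H_0(R) *)

Section ConeIsomorphism.
Local Open Scope quotient_scope.
Variables (D : zmodType) (Dp : set D) (E : zmodClosed rat) (M : main_data Dp E).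
Local Notation C := (Cdiag M).
Local Notation wD := (wD (M := M)).
Local Notation wE := (wE (M := M)).
Variable G : toprel (ipath C).
Local Notation S := (tsemi G).
Hypotheses (eG : etale_basis G) (pD : preserves wD G) (pE : preserves wE G).
Hypothesis tc : forall l p q, in_E 0 l p -> in_E 0 l q -> pend p = pend q ->
  cls G (cyl p) = cls G (cyl q).
Hypothesis bal : forall l,
  vcls G l.+1 (Some (wa M l.+1)) *+ r_ M l.+1 = vcls G l.+1 None *+ r_ M l.+1.
Implicit Types (a b : word (ipath C)) (p q : bpath C).
Let hC : has_successors C := @C_successors D Dp E M.
Let hBD : has_successors (BD M) := @BD_successors D Dp E M.
Let hD : harmonic wD := @harmonic_wD D Dp E M.
Let hE : harmonic wE := @harmonic_wE D Dp E M.

Lemma wmu_wD N a : lc_word N a ->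
  wmu wD a = \sum_(u <- vlev (BD M) N) mD (BD_iota M) N u *+ fiber N (cnt N a) u.
Proof. by move=> ha; rewrite (wmu_cnt hC hD ha) -sum_fiber. Qed.

Lemma wmu_wE N a : lc_word N.+1 a -> wmu wE a = er M N.+1 *+ cnt N.+1 a None.
Proof. by move=> ha; rewrite (wmu_cnt hC hE ha) sum_wE. Qed.

Lemma sum_vcls l (Y : bvert C -> nat) :
  \sum_(v <- vlev C l.+1) vcls G l.+1 v *+ Y v =
  vcls G l.+1 (Some (wa M l.+1)) *+ Y (Some (wa M l.+1)) + vcls G l.+1 None *+ Y None +
  \sum_(u <- vlev (BD M) l.+1 | u != wa M l.+1) vcls G l.+1 (Some u) *+ Y (Some u).
Proof.
rewrite sum_C_lev (bigD1_seq (wa M l.+1)) ?wa_lev ?fset_uniq //=.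
by rewrite addrCA addrA.
Qed.

(** One inequality between the multiplicities at w_b is assumed, since [er_inj] subtracts natural
    numbers; [wmu_inj] settles the other case by symmetry. *)
Lemma wmu_inj_le a b N : lc_word N.+1 a -> lc_word N.+1 b ->
  {in vlev (BD M) N.+1, fiber N.+1 (cnt N.+1 a) =1 fiber N.+1 (cnt N.+1 b)} ->
  wmu wE a = wmu wE b -> (cnt N.+1 a None <= cnt N.+1 b None)%N ->
  \pi_S a = \pi_S b.
Proof.
move=> ha hb hf; rewrite (wmu_wE ha) (wmu_wE hb) => eE le.
rewrite (pi_cnt tc ha) (pi_cnt tc hb) !sum_vcls; congr (_ + _).
  apply: mulrn_exchange (bal N) _ le (er_inj le eE).
  have := hf _ (wa_lev M N.+1).
  by rewrite !fiber_succ ?wa_lev // eqxx !mul1n.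
rewrite big_seq_cond [RHS]big_seq_cond; apply: eq_bigr => u /andP[hu nu].
by have := hf _ hu; rewrite !fiber_succ // (negPf nu) !mul0n !addn0 => ->.
Qed.

Lemma wmu_inj a b : wmu wD a = wmu wD b -> wmu wE a = wmu wE b -> \pi_S a = \pi_S b.
Proof.
(* The successor ensures a level at which w_b exists. *)
have [na ha] := lc_wordP a; have [nb hb] := lc_wordP b; pose N := (maxn na nb).+1.
have {}ha : lc_word N a by apply: lc_word_le ha; rewrite leqW // leq_maxl.
have {}hb : lc_word N b by apply: lc_word_le hb; rewrite leqW // leq_maxr.
rewrite (wmu_wD ha) (wmu_wD hb) => /(limit_eq (BD_dim M))[n hn] eE.
have h (c : word (ipath C)) : lc_word N c -> lc_word (n + N) c by apply: lc_word_le; exact: leq_addl.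
have hf c u : lc_word N c -> u \in vlev (BD M) (n + N) ->
    fiber (n + N) (cnt (n + N) c) u = pushn N n (fiber N (cnt N c)) u.
  move=> hc hu; rewrite -fiber_pushn // /fiber big_seq_cond [RHS]big_seq_cond.
  by apply: eq_bigr => v /andP[hv _]; exact: pushn_cnt.
have {hn}hn : {in vlev (BD M) (n + N),
    fiber (n + N) (cnt (n + N) a) =1 fiber (n + N) (cnt (n + N) b)}.
  by move=> u hu; rewrite !hf // hn.
have {ha hb}[ha hb] := (h a ha, h b hb).
move: ha hb hn; rewrite /N addnS => ha hb hn.
have [le|/ltnW le] := leqP (cnt (n + maxn na nb).+1 a None) (cnt (n + maxn na nb).+1 b None).
  exact: wmu_inj_le eE le.
by apply/esym; apply: wmu_inj_le (esym eE) le => // u hu; rewrite hn.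
Qed.

Lemma wmu_range dt : target_cone Dp E dt <-> exists a, (wmu wD a, wmu wE a) = dt.
Proof.
have [tD htD] := lift_tsemi eG hC hD pD; have [tE htE] := lift_tsemi eG hC hE pE.
split=> [[->|]|[a <-]]; first by exists [::]; rewrite /wmu !big_nil.
  case: dt => d t /= [/(limit_posP (BD_dim M))[l [Y ed]] d0].
  have [v [hv Yv]] : exists v, v \in vlev (BD M) l /\ (0 < Y v)%N.
    apply: contrapT => h; apply: d0; rewrite ed big1_seq // => v /andP[_ hv].
    by case: (posnP (Y v)) => [->|Yv]; [rewrite mulr0n|case: h; exists v].
  have [j hj] := er_surj M t.
  have [w hw pw] := pushn_gt0 hBD j hv Yv.
  have [|c hc et] := hj (j + l).+1; first by rewrite leqW // leq_addr.
  pose L := (j + l).+1; pose Z := pushn l j.+1 Y.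
  (* c < r_L, which is at most the number of edges of B_D from w to w_a^L, and w has multiplicity at
     least 1. *)
  have Zc : (c <= Z (wa M L))%N.
    apply: leq_trans (pushn_le Y (wa M L) hw).
    apply: leq_trans (leq_trans (BD_edges hw (wa_lev M L)) (leq_pmull _ pw)).
    by rewrite ltnW // (leq_trans hc) // leq_addr.
  pose X (v : bvert C) := if v is Some u then (Z u - (u == wa M L) * c)%N else c.
  pose s := \sum_(v <- vlev C L) vcls G L v *+ X v.
  exists (repr s); rewrite -htD -htE reprK /s.
  have [cD cE] := ((fun l p => @theta_cyl _ hC G _ _ tD l p hD htD),
                   (fun l p => @theta_cyl _ hC G _ _ tE l p hE htE)).
  have re l' (v' : bvert C) := @C_reach D Dp E M l' v'.
  rewrite (@vcls_harmonic _ G _ wD tD L X re tc cD) (@vcls_harmonic _ G _ wE tE L X re tc cE) sum_wE -et; congr pair.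
  rewrite ed (@pushn_sum _ _ (mD (BD_iota M)) l j.+1 Y (harmonic_mD (BD_dim M))) -[(j.+1 + l)%N]/L.
  rewrite (sum_fiber L (mD (BD_iota M) L) X); apply: eq_big_seq => u hu.
  rewrite fiber_succ //= subnK //; case: eqP => [->|_]; last by rewrite mul0n.
  by rewrite mul1n.
have [n ha'] := lc_wordP a; have ha : lc_word n.+1 a by exact: lc_word_le ha'.
have hp : Dp (wmu wD a).
  by apply/(limit_posP (BD_dim M)); exists n.+1, (fiber n.+1 (cnt n.+1 a)); exact: wmu_wD.
have [a0|na0] := eqVneq (wmu wD a) 0; last by right; split=> //; exact/eqP.
(* A single w_b in the word would make the fibre over w_a positive and the value in D nonzero. So
   the value 0 in D forces the value 0 in E/Z. *)
left; rewrite /= a0 (wmu_wE ha); suff -> : cnt n.+1 a None = 0%N by rewrite mulr0n.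
apply/eqP; rewrite -leqn0 leqNgt; apply/negP => gt0.
apply: (@limit_neq0 _ _ _ _ (BD_dim M) hBD n.+1 (fiber n.+1 (cnt n.+1 a)) (wa M n.+1)).
- exact: wa_lev.
- by rewrite fiber_succ ?wa_lev // eqxx mul1n addn_gt0 gt0 orbT.
by rewrite -wmu_wD.
Qed.

(** The map is the lift of the weight [wD], whose values lie in D_+, followed by the inverse of
    [kappa]. In this way bisections of R need not be compared with bisections of the tail relation
    of B_D. *)
Lemma exists_alpha (kappa : {additive tsemi (tail_rel (BD M)) -> D}) :
  is_dim_iso (M := M) kappa ->
  exists alpha : {additive S -> tsemi (tail_rel (BD M))},
    forall K, clopen K -> alpha (cls G K) = cls _ (@sX D Dp E M @` K).
Proof.
move=> [kw ki kr]; have [tD htD] := lift_tsemi eG hC hD pD.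
have hm := harmonic_mD (BD_dim M).
have hex s : exists t, kappa t = tD s.
  suff h : (range kappa) (tD s) by have [t _ e] := h; exists t.
  rewrite kr -[s]reprK htD; have [n hn] := lc_wordP (repr s).
  by apply/(limit_posP (BD_dim M)); exists n, (fiber n (cnt n (repr s))); exact: wmu_wD.
have [f hf] := choice hex.
have fN : nmod_morphism f.
  by split=> [|s t]; apply: ki; rewrite ?raddfD !hf ?raddfD // !raddf0.
exists (HB.pack_for {additive S -> tsemi (tail_rel (BD M))} f
  (GRing.isNmodMorphism.Build _ _ f fN)) => K /clopen_lc[n hK] /=.
apply: ki; rewrite hf; have [lK eK] := mu_sX hK.
have [L eL] := lcs_copen lK; have [K' eK'] := lcs_copen (ex_intro _ n hK).
rewrite eL eK' !cls_copen htD /wmu big_seq1 -eK' -eK eL.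
rewrite (@additive_wmu _ _ hBD _ _ kappa _ hm kw) /wmu big_seq1; reflexivity.
Qed.

Lemma exists_beta : exists beta : {additive S -> modZ E},
  forall l p, in_E 0 l p -> beta (cls G (cyl p)) = wE l (pend p).
Proof.
have [tE htE] := lift_tsemi eG hC hE pE; exists tE => l p.
exact: (@theta_cyl _ hC G _ wE tE l p hE htE).
Qed.

Lemma alphabeta_iso (kappa : {additive tsemi (tail_rel (BD M)) -> D})
    (alpha : {additive S -> tsemi (tail_rel (BD M))}) (beta : {additive S -> modZ E}) :
  is_dim_iso (M := M) kappa ->
  (forall K, clopen K -> alpha (cls G K) = cls _ (@sX D Dp E M @` K)) ->
  (forall l p, in_E 0 l p -> beta (cls G (cyl p)) = wE l (pend p)) ->
  let alphabeta s := (kappa (alpha s), beta s) in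
  injective alphabeta /\ range alphabeta = target_cone Dp E.
Proof.
move=> [kw ki kr] ha hb f.
have fE a : f (\pi_S a) = (wmu wD a, wmu wE a).
  rewrite /f (@additive_wmu _ G hC _ wE beta a hE hb); congr pair.
  apply: (@additive_wmu _ G hC _ wD (kappa \o alpha) a hD) => n p hp /=.
  have lp := lc_cyl hp; rewrite ha; last by apply/clopen_lc; exists n.
  by have [q hq [eq ->]] := sX_cyl hp; rewrite (kw n q hq) eq.
split=> [s t|].
  by rewrite -[s]reprK -[t]reprK !fE => -[/wmu_inj h /h].
apply/seteqP; split=> [_ [s _ <-]|dt /wmu_range[a <-]].
  by rewrite -[s]reprK fE; apply/wmu_range; exists (repr s).
by exists (\pi_S a); rewrite ?fE.
Qed.

Lemma H0_iso : exists h : {additive H0 G -> D * modZ E},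
  bijective h /\ h @` H0pos G = target_cone Dp E.
Proof.
have [h1 e1] := lift_H0 eG hC hD pD; have [h2 e2] := lift_H0 eG hC hE pE.
pose f x := (h1 x, h2 x).
have fM : zmod_morphism f by move=> x y; rewrite /f !raddfB.
pose h := HB.pack_for {additive H0 G -> D * modZ E} f (GRing.isZmodMorphism.Build _ _ f fM).
have hw a : h (\pi_(H0 G) (wfun a)) = (wmu wD a, wmu wE a).
  by rewrite /h /= /f e1 e2 /= (Int_indw hC a hD) (Int_indw hC a hE).
exists h; split; last first.
  apply/seteqP; split=> [_ [s /H0posE[a ->] <-]|dt /wmu_range[a <-]].
    by apply/wmu_range; exists a; rewrite hw.
  by exists (\pi_(H0 G) (wfun a)); rewrite ?hw //; apply/H0posE; exists a.
have hinj : injective h.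
  move=> s t; rewrite -[s]reprK -[t]reprK => /eqP; rewrite -subr_eq0 -!raddfB.
  have [a [b eab]] := wfun_decomposition (repr s - repr t).
  rewrite eab !raddfB !hw subr_eq0 => /eqP[/wmu_inj e /e eS].
  apply/eqP; rewrite -Quotient.idealrBE eab; apply: ts_eq_coboundary eG _ _ _.
  by apply/asboolP; rewrite -/(ts_eqb _ _ _) -(eqquotE S) eS.
(* Adding 1 to every coordinate makes the value in D nonzero, so that by [wmu_range] it occurs
   together with every t. *)
have hcone l (Y : bvert (BD M) -> nat) t : exists s,
    h s = (BD_iota M l (vecn l (fun v => (Y v).+1)), t).
  rewrite iota_vecn.
  have [|a ea] := iffLR (wmu_range
    (\sum_(v <- vlev (BD M) l) mD (BD_iota M) l v *+ (Y v).+1, t)).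
    right; split=> /=; last exact: (limit_neq0 (BD_dim M) hBD (wa_lev M l)).
    by apply/(limit_posP (BD_dim M)); exists l, (fun v => (Y v).+1).
  by exists (\pi_(H0 G) (wfun a)); rewrite hw.
have hsurj dt : exists s, h s = dt.
  case: dt => d t; have [l [x <-]] := limit_surj (BD_dim M) d.
  (* The vector x is the difference of |x| + 1 and |x| - x + 1, both of which are strictly
     positive. *)
  have [s hs] := hcone l (fun v => if insub v is Some v' then `|x v'|%N else 0%N) t.
  have [s' hs'] := hcone l
    (fun v => if insub v is Some v' then absz (absz (x v') - x v') else 0%N) 0.
  exists (s - s'); rewrite raddfB hs hs'; congr pair; last exact: subr0.
  rewrite /= -raddfB.
  congr (BD_iota M l _); apply/ffunP => v; rewrite !ffunE valK.
  rewrite -[X in _ - X%:Z]addn1 -[X in X%:Z - _]addn1 !PoszD opprD addrACA subrr addr0.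
  by rewrite (@gez0_abs (_ - _)) ?subr_ge0 ?abszE ?ler_norm // opprB addrCA subrr addr0.
have [g hg] := choice hsurj.
by exists g => // s; apply: hinj.
Qed.

End ConeIsomorphism.

Lemma Rmain_facts (D : zmodType) (Dp : set D) (E : zmodClosed rat) (M : main_data Dp E)
    (zA zB : 'I_(r_ M 1) -> bpath (Cdiag M)) (rho : recipe (Cdiag M))
    (phi : ipath (Cdiag M) -> ipath (Cdiag M)) :
  main_recipe (l := 1) 0 zA zB rho -> fits phi rho ->
  let G := Rmain rho phi in
  [/\ etale_basis G, preserves (wD (M := M)) G, preserves (wE (M := M)) G,
      forall l p q, in_E 0 l p -> in_E 0 l q -> pend p = pend q ->
        cls G (cyl p) = cls G (cyl q)
    & forall l, vcls G l.+1 (Some (wa M l.+1)) *+ r_ M l.+1 =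
        vcls G l.+1 None *+ r_ M l.+1].
Proof.
move=> hrho hphi G; pose s0 : stage M 0 := Stage hrho.
have [v [f hvf]] := side_data s0; have [g hg] := code hvf.
have ZS := zz_system (s0 := s0) hvf hg hphi.
have hA := rA_root hvf g; have hP := @phi_theta _ _ _ _ s0 _ _ hvf _ hg _ hphi.
have hC : has_successors (Cdiag M) := @C_successors D Dp E M.
pose Z := zz s0 v f g true.
(* The sides of w_a and w_b alternate with the level because each recursive step reverses the
   recipe; the balance conditions are symmetric in them. *)
have ends l : (zLv Z l.+1 = Some (wa M l.+1) /\ zRv Z l.+1 = None) \/
              (zLv Z l.+1 = None /\ zRv Z l.+1 = Some (wa M l.+1)).
  by rewrite /Z /= !(v_succ hvf); case: (odd l); [right|left].
split.
- exact: (etale_generated_rel hC ZS hA hP).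
- apply: (preserves_generated_rel hC ZS hA hP (@harmonic_wD D Dp E M)) => l.
  by case: (ends l) => -[-> ->].
- apply: (preserves_generated_rel hC ZS hA hP (@harmonic_wE D Dp E M)) => l.
  by case: (ends l) => -[-> ->]; rewrite /= er_r mul0rn.
- exact: (generated_tail_cls hC ZS hA hP).
move=> l; have h := cls_fan_balance hC ZS hA hP l.
by case: (ends l) h => -[-> ->] // ->.
Qed.

Theorem theorem6p4 (D : zmodType) (Dp : set D)
    (hD : dimension_group Dp) (hsimple : simple_ordered Dp)
    (hcyclic : ~ cyclic_zmod D)
    (E : zmodClosed rat)
    (hZE : {subset Num.int <= E}) (hE : exists2 q, q \in E & q \isn't a Num.int)
    (M : main_data Dp E)
    (zA zB : 'I_(r_ M 1) -> bpath (Cdiag M)) (rho : recipe (Cdiag M))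
    (hrho : main_recipe (l := 1) 0 zA zB rho)
    (phi : ipath (Cdiag M) -> ipath (Cdiag M)) (hphi : fits phi rho) :
  [/\ exists kappa, is_dim_iso (M := M) kappa,
      exists alpha, is_alpha (rho := rho) (phi := phi) alpha,
      exists beta, is_beta (rho := rho) (phi := phi) beta,
      forall kappa alpha beta,
        is_dim_iso (M := M) kappa ->
        is_alpha (rho := rho) (phi := phi) alpha ->
        is_beta (rho := rho) (phi := phi) beta ->
        let alphabeta (s : tsemi (Rmain rho phi)) :=
          (kappa (alpha s), beta s) in
        injective alphabeta /\ range alphabeta = target_cone Dp E
    & exists h : {additive H0 (Rmain rho phi) -> D * modZ E},
        bijective h /\ h @` H0pos (Rmain rho phi) = target_cone Dp E].
Proof.
have [eG pD pE tc bal] := Rmain_facts hrho hphi.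
have hk : exists kappa, is_dim_iso (M := M) kappa.
  apply: (exists_dim_iso (BD_dim M) (@BD_successors D Dp E M)).
  exact: (@BD_reach D Dp E M).
split=> //; last exact: H0_iso.
- by have [kappa hkappa] := hk; exact: exists_alpha hkappa.
- exact: exists_beta.
exact: alphabeta_iso.
Qed.
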